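(* If $M$ is a maximal simple regular matroid of rank $d\in\{3,4,5\}$, then one of the following holds (up to isomorphism of $M$): (1) $M$ is the graphic matroid $M(K_{d+1})$ and $\operatorname{sys}_3^*(M)=\tfrac{6}{d+1}$. (2) $M$ is the cographic matroid $M^*(K_{3,3})$ of rank four and $\operatorname{sys}_3^*(M)=\tfrac{4}{3}$. (3) $M$ is the cographic matroid $M^*(G_{5,3})$ of rank five and $\operatorname{sys}_3^*(M)=\tfrac{12}{11}$. (4) $M$ is the cographic matroid $M^*(G_{5,4})$ of rank five and $\operatorname{sys}_3^*(M)=\tfrac{9}{8}$. (5) $M$ is the sporadic matroid $R_{10}$ of rank five and $\operatorname{sys}_3^*(M)=\tfrac{6}{5}$.
   Context: Matroids are finite. A maximal simple regular matroid of rank $d$ is a simple regular matroid of rank $d$ that is not isomorphic to a proper restriction of another simple regular matroid of rank $d$. $M(G)$ is the cycle matroid of a graph $G$ and $M^*(G)$ is its dual. A triple of cocircuits $C_1^*,C_2^*,C_3^*$ has the non-inclusion property if $C_h^*\not\subseteq C_i^*\cup C_j^*$ for all $\{h,i,j\}=\{1,2,3\}$. For a matroid $M$ with ground set $E$ of rank at least three, the $3$-cosystole is $$\operatorname{sys}_3^*(M)=\max_\mu\ \min\ \sum_{i=1}^3\mu(C_i^* ),$$ where the maximum runs over functions $\mu:E\to\mathbb{R}_{\geq 0}$ with $\mu(E)=1$, the minimum runs over all triples of cocircuits of $M$ with the non-inclusion property, and $\mu(X)=\sum_{e\in X}\mu(e)$. $G_{5,3}$ and $G_{5,4}$ are the unique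 (connected) cubic non-planar graphs on eight vertices of girth $3$ and $4$, respectively. Explicitly, $G_{5,3}$ is obtained from $K_{3,3}$ by replacing one vertex with a triangle (subdivide two edges at a common vertex and join the two new vertices by an edge), and $G_{5,4}$ is the Moebius ladder with vertices $1,\dots,8$ (indices modulo $8$) and edges $\{i,i+1\}$ and $\{i,i+4\}$. $R_{10}$ is the vector matroid over $\mathbb{Z}_2$ on the columns of $$\begin{pmatrix} 1&0&0&0&0&1&1&0&0&1\\ 0&1&0&0&0&1&1&1&0&0\\ 0&0&1&0&0&0&1&1&1&0\\ 0&0&0&1&0&0&0&1&1&1\\ 0&0&0&0&1&1&0&0&1&1 \end{pmatrix}.$$ *)

(* Defs.v *)
From mathcomp Require Import all_boot all_order all_algebra.
From mathcomp Require Import boolp reals.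

Set Implicit Arguments.
Unset Strict Implicit.
Unset Printing Implicit Defensive.

Import Order.TTheory GRing.Theory Num.Theory.
Local Open Scope ring_scope.

Record matroid (E : finType) := Matroid {
  indep : pred {set E};
  indep0 : indep set0;
  indepS : forall I J : {set E}, J \subset I -> indep I -> indep J;
  indep_aug : forall I J : {set E}, indep I -> indep J -> (#|I| < #|J|)%N ->
    exists2 e, e \in J :\: I & indep (e |: I)
}.

Section MatroidNotions.
Variables (E : finType) (M : matroid E).

Definition rank : nat := \max_(S : {set E} | indep M S) #|S|.

Definition basis (B : {set E}) : bool := maxset (indep M) B.

Definition circuit (C : {set E}) : bool := minset [pred S | ~~ indep M S] C.

(* Neither loops (circuits of size one) nor parallel pairs (of size two). *)
Definition simple : Prop := forall C : {set E}, circuit C -> (2 < #|C|)%N.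

Lemma indep_basis (S T : {set E}) (B0 : {set E}) :
    indep M S -> S \subset T -> basis B0 -> B0 \subset T ->
  exists2 B, basis B & (S \subset B) && (B \subset T).
Proof.
move=> iS sST /maxsetP [iB0 mB0] sB0T.
have P S' : [&& indep M S', S \subset S' & S' \subset T] = 
    [pred S' : {set E} | [&& indep M S', S \subset S' & S' \subset T]] S' by [].
have : [pred S' : {set E} | [&& indep M S', S \subset S' & S' \subset T]] S.
  by rewrite /= iS subxx.
case/maxset_exists => B /maxsetP [/and3P [iB sSB sBT] mB] _.
exists B; last by rewrite sSB.
have le : (#|B0| <= #|B|)%N.
  rewrite leqNgt; apply/negP => lt.
  have [e /setDP [eB0 eB] ie] := indep_aug iB iB0 lt.
  have := mB (e |: B); rewrite /= ie (subset_trans sSB) ?subsetU1 //=.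
  rewrite subUset sub1set (subsetP sB0T) //= sBT => /(_ isT isT) eq.
  by move: eB; rewrite -eq setU11.
apply/maxsetP; split=> // C iC sBC.
apply/eqP; rewrite eq_sym eqEcard sBC /= (leq_trans _ le) // leqNgt.
apply/negP => lt; have [e /setDP [eC eB] ie] := indep_aug iB0 iC lt.
by move: eB; rewrite -(mB0 _ ie) ?setU11 ?subsetU1.
Qed.

Lemma exists_basis : exists B, basis B.
Proof. by have [B mB _] := maxset_exists (indep0 M); exists B. Qed.

Definition dual_indep : pred {set E} :=
  [pred S : {set E} | [exists B : {set E}, basis B && [disjoint B & S]]].

Lemma dual_indep0 : dual_indep set0.
Proof.
have [B bB] := exists_basis; apply/existsP; exists B.
by rewrite bB disjoints_subset setC0 subsetT.
Qed.

Lemma dual_indepS (I J : {set E}) : J \subset I -> dual_indep I -> dual_indep J.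
Proof.
move=> sJI /existsP [B /andP [bB dB]]; apply/existsP; exists B.
by rewrite bB (disjointWr sJI).
Qed.

Lemma dual_indep_aug (I J : {set E}) : dual_indep I -> dual_indep J -> (#|I| < #|J|)%N ->
  exists2 e, e \in J :\: I & dual_indep (e |: I).
Proof.
move=> /existsP [BI /andP [bBI dI]] /existsP [B /andP [bB dJ]] lt.
have iBI : indep M (B :\: I).
  by apply: indepS (subsetDl _ _) _; case/maxsetP: bB.
have sBI : B :\: I \subset ~: I by rewrite setDE subsetIr.
have sBI' : BI \subset ~: I by rewrite -disjoints_subset.
have [C bC /andP [sC1 sC2]] := indep_basis iBI sBI bBI sBI'.
have [sJC|/subsetPn [e eJ eC]] := boolP (J :\: I \subset C); last first.
  exists e => //; apply/existsP; exists C; rewrite bC disjoint_sym.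
  rewrite disjoints_subset subUset sub1set inE eC /=.
  by rewrite -disjoints_subset disjoint_sym disjoints_subset.
exfalso.
have leCB : (#|C| <= #|B|)%N.
  case/maxsetP: bC => iC _; case/maxsetP: bB => iB mB.
  rewrite leqNgt; apply/negP => lt'.
  have [e /setDP [_ eB] ie] := indep_aug iB iC lt'.
  by move: eB; rewrite -(mB _ ie) ?setU11 ?subsetU1.
have leU : (#|(B :\: I) :|: (J :\: I)| <= #|C|)%N.
  by rewrite subset_leq_card // subUset sC1.
have d0 : (B :\: I) :&: (J :\: I) = set0.
  apply/eqP; rewrite setI_eq0 (disjointWl (subsetDl _ _)) //.
  by rewrite (disjointWr (subsetDl _ _)).
have leIB : (#|B :&: I| <= #|I :\: J|)%N.
  apply/subset_leq_card/subsetP => e; rewrite !inE => /andP [eB ->].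
  by rewrite (disjointFr dJ eB).
rewrite cardsU d0 cards0 subn0 in leU.
have := leq_trans leU leCB.
rewrite -(cardsID I B) addnC leq_add2r leqNgt => /negP; apply.
rewrite (leq_ltn_trans leIB) // -(ltn_add2l #|I :&: J|) cardsID.
by rewrite setIC cardsID.
Qed.

Definition dual : matroid E := Matroid dual_indep0 dual_indepS dual_indep_aug.

Section Restriction.
Variable X : {set E}.

Definition restr_indep : pred {set {x : E | x \in X}} :=
  [pred S : {set {x : E | x \in X}} | indep M [set val x | x in S]].

Lemma restr_indep0 : restr_indep set0.
Proof. by rewrite /restr_indep /= imset0 indep0. Qed.

Lemma restr_indepS (I J : {set {x : E | x \in X}}) : J \subset I -> restr_indep I -> restr_indep J.
Proof. by move=> sJI; apply/indepS/imsetS. Qed.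

Lemma restr_indep_aug (I J : {set {x : E | x \in X}}) : restr_indep I -> restr_indep J ->
  (#|I| < #|J|)%N -> exists2 e, e \in J :\: I & restr_indep (e |: I).
Proof.
move=> iI iJ lt.
have [|e /setDP [/imsetP [f fJ ->]]] := indep_aug iI iJ.
  by rewrite !card_imset //; apply: val_inj.
rewrite (mem_imset _ _ val_inj) => fI ie; exists f; first by rewrite inE fI.
by rewrite /restr_indep /= imsetU1.
Qed.

Definition restriction : matroid {x : E | x \in X} :=
  Matroid restr_indep0 restr_indepS restr_indep_aug.

End Restriction.

End MatroidNotions.

Definition cocircuit (E : finType) (M : matroid E) (C : {set E}) : bool :=
  circuit (dual M) C.

Definition isomorphic (E F : finType) (M : matroid E) (N : matroid F) : Prop :=
  exists f : E -> F, bijective f /\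
    forall S : {set E}, indep N [set f x | x in S] = indep M S.

Section FamilyMatroid.
Variables (K : fieldType) (vT : vectType K) (E : finType) (v : E -> vT).

(* [free] is taken on a sequence, so that repeated vectors are dependent. *)
Definition family_indep : pred {set E} :=
  [pred S : {set E} | free [seq v e | e in S]].

Lemma family_indepD1 (S : {set E}) e : e \in S ->
  family_indep S =
    (v e \notin <<[seq v f | f in S :\ e]>>%VS) && family_indep (S :\ e).
Proof.
move=> eS; rewrite /family_indep /= -free_cons; apply: perm_free.
rewrite /image_mem -(map_cons v); apply: perm_map; apply: uniq_perm.
- exact: enum_uniq.
- by rewrite /= enum_uniq mem_enum setD11.
by move=> f; rewrite !inE !mem_enum !inE; case: eqP => // ->.
Qed.

Lemma family_span_sub (S T : {set E}) : S \subset T ->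
  (<<[seq v e | e in S]>> <= <<[seq v e | e in T]>>)%VS.
Proof.
move=> sST; apply: sub_span => u /mapP [e]; rewrite mem_enum => eS ->.
by apply: map_f; rewrite mem_enum (subsetP sST).
Qed.

Lemma family_indep0 : family_indep set0.
Proof. by rewrite /family_indep /= /image_mem enum_set0 nil_free. Qed.

Lemma family_indepP (S : {set E}) :
  reflect (forall e, e \in S -> v e \notin <<[seq v f | f in S :\ e]>>%VS)
          (family_indep S).
Proof.
apply: (iffP idP) => [iS e eS|].
  by move: iS; rewrite (family_indepD1 eS) => /andP[].
have [n] := ubnP #|S|; elim: n S => // n IH S; rewrite ltnS => le H.
have [->|/set0Pn [e eS]] := eqVneq S set0; first exact: family_indep0.
rewrite (family_indepD1 eS) H // IH //.
  by rewrite (leq_trans _ le) // [X in (_ < X)%N](cardsD1 e) eS.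
move=> f /setD1P [ne fS]; apply: contra (H _ fS); apply/subvP.
exact/family_span_sub/setSD/subsetDl.
Qed.

Lemma family_indepS (I J : {set E}) :
  J \subset I -> family_indep I -> family_indep J.
Proof.
move=> sJI /family_indepP H; apply/family_indepP => e eJ.
apply: contra (H e (subsetP sJI _ eJ)); apply/subvP.
exact/family_span_sub/setSD.
Qed.

Lemma family_indep_aug (I J : {set E}) : family_indep I -> family_indep J ->
  (#|I| < #|J|)%N -> exists2 e, e \in J :\: I & family_indep (e |: I).
Proof.
move=> iI iJ lt.
have [/exists_inP [e eJ eI]|/exists_inPn H] :=
    boolP [exists e in J, v e \notin <<[seq v f | f in I]>>%VS].
  have nI : e \notin I.
    apply: contra eI => eI; apply: memv_span.
    by apply/mapP; exists e; rewrite ?mem_enum.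
  exists e; first by rewrite inE nI.
  by rewrite (family_indepD1 (setU11 _ _)) setU1K // eI.
have : (<<[seq v f | f in J]>> <= <<[seq v f | f in I]>>)%VS.
  apply/span_subvP => u /mapP [e]; rewrite mem_enum => eJ ->.
  by have := H e eJ; rewrite negbK.
move/dimvS; rewrite (eqP iI) (eqP iJ) !size_map -!cardE.
by rewrite leqNgt lt.
Qed.

Definition family_matroid : matroid E :=
  Matroid family_indep0 family_indepS family_indep_aug.

End FamilyMatroid.

Definition vector_matroid (K : fieldType) (m n : nat) (A : 'M[K]_(m, n)) :
  matroid 'I_n := family_matroid (fun j => col j A).

(* Selections of rows or columns with repetitions or in a different order
   only contribute the determinants 0 and plus or minus those of genuine
   square submatrices. *)
Definition totally_unimodular (m n : nat) (A : 'M[rat]_(m, n)) : Prop :=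
  forall (k : nat) (f : 'I_k -> 'I_m) (g : 'I_k -> 'I_n),
    \det (mxsub f g A) \in [:: -1; 0; 1].

Definition regular (E : finType) (M : matroid E) : Prop :=
  exists (m n : nat) (A : 'M[rat]_(m, n)),
    totally_unimodular A /\ isomorphic M (vector_matroid A).

Definition maximal_simple_regular (d : nat) (E : finType) (M : matroid E) :
    Prop :=
  [/\ simple M, regular M, rank M = d &
      ~ exists (F : finType) (N : matroid F) (X : {set F}),
          [/\ simple N, regular N, rank N = d, X \proper [set: F] &
              isomorphic M (restriction N X)]].

Record sgraph := SGraph {
  vertex :> finType;
  adj : rel vertex;
  adj_sym : symmetric adj;
  adj_irr : irreflexive adj
}.

Definition edges (G : sgraph) : {set {set G}} :=
  [set e : {set G} | [exists x, exists y, adj x y && (e == [set x; y])]].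

Definition edge (G : sgraph) : finType := {e : {set G} | e \in edges G}.

Section CycleMatroid.
Variable G : sgraph.
Implicit Types S : {set edge G}.

Definition joined S : rel G :=
  [rel x y | [set x; y] \in [set val e | e in S]].

(* A duplicate-free closed walk is a cycle when it has at least three
   vertices: shorter ones would be single vertices or edges run back and
   forth. *)
Definition acyclic S : bool :=
  `[< forall p : seq G, ucycle (joined S) p -> (size p <= 2)%N >].

Lemma joined_sym S : symmetric (joined S).
Proof. by move=> x y; rewrite /joined /= setUC. Qed.

Lemma edgeE (e : edge G) : exists x y, x != y /\ val e = [set x; y].
Proof.
have := valP e; rewrite inE => /existsP [x /existsP [y /andP [a /eqP ->]]].
by exists x, y; split=> //; apply: contraTneq a => ->; rewrite adj_irr.
Qed.

Lemma set2_inj (x y a b : G) : a != b -> [set a; b] = [set x; y] ->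
  (a = x /\ b = y) \/ (a = y /\ b = x).
Proof.
move=> ab /setP eq; have := eq a; have := eq b; rewrite !inE !eqxx orbT /=.
move=> /esym/orP [] /eqP bE /esym/orP [] /eqP aE; subst; rewrite ?eqxx // in ab.
  by right.
by left.
Qed.

Definition delta (x : G) : {ffun G -> ('F_2)^o} := [ffun z => (z == x)%:R].

Definition incidence (e : edge G) : {ffun G -> ('F_2)^o} :=
  [ffun z => (z \in val e)%:R].

Lemma addF2 (u : {ffun G -> ('F_2)^o}) : u + u = 0.
Proof. by apply/ffunP => z; rewrite !ffunE (addrr_pchar2 (pchar_Fp _)). Qed.

Lemma incidenceE (e : edge G) x y : x != y -> val e = [set x; y] ->
  incidence e = delta x + delta y.
Proof.
move=> xy ve; apply/ffunP => z; rewrite !ffunE ve !inE.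
have [->|_] := eqVneq z x; first by rewrite (negPf xy) addr0.
by rewrite add0r.
Qed.

Lemma joined_delta S x y : joined S x y ->
  delta x + delta y \in <<[seq incidence e | e in S]>>%VS.
Proof.
move=> /imsetP [e eS eq].
have -> : delta x + delta y = incidence e.
  have [a [b [ab ve]]] := edgeE e.
  rewrite (incidenceE ab ve).
  have [[-> ->] //|[-> ->]] := set2_inj ab (etrans (esym ve) (esym eq)).
  exact: addrC.
by apply/memv_span/mapP; exists e; rewrite ?mem_enum.
Qed.

Lemma path_delta S x p : path (joined S) x p ->
  delta x + delta (last x p) \in <<[seq incidence e | e in S]>>%VS.
Proof.
elim: p x => [|y p IH] x /=; first by rewrite addF2 mem0v.
move=> /andP [/joined_delta xy /IH yp].
have -> : delta x + delta (last y p) =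
    (delta x + delta y) + (delta y + delta (last y p)).
  by rewrite addrA -(addrA (delta x)) addF2 addr0.
exact: memvD.
Qed.

Lemma acyclicE S : acyclic S = family_indep incidence S.
Proof.
apply/asboolP/family_indepP => [H e eS|H p].
  apply/negP => esp; have [x [y [xy ve]]] := edgeE e.
  set r := joined (S :\ e).
  have [/connectP [p0 rp0 yE]|nc] := boolP (connect r x y).
    case/shortenP: rp0 yE => p rp up _ yE.
    have := H (x :: p); rewrite /ucycle /= rcons_path -/r.
    have -> : path (joined S) x p.
      apply: sub_path rp => a b /imsetP [f /setD1P [_ fS] fE].
      by apply/imsetP; exists f.
    have -> : joined S (last x p) x.
      by apply/imsetP; exists e; rewrite // -yE setUC.
    rewrite /=; case: p rp up yE => [|z [|w p]] /= rp up yE.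
    - by rewrite yE eqxx in xy.
    - move: rp; rewrite andbT -yE => /imsetP [f /setD1P [nf _] fE].
      by move: nf; rewrite -(inj_eq val_inj) -fE ve eqxx.
    - by move/(_ up).
  pose phi (u : {ffun G -> ('F_2)^o}) : ('F_2)^o := \sum_(z | connect r x z) u z.
  have phiD u w : phi (u + w) = phi u + phi w.
    by rewrite /phi -big_split; apply: eq_bigr => z _; rewrite ffunE.
  have phiZ c u : phi (c *: u) = c * phi u.
    by rewrite /phi mulr_sumr; apply: eq_bigr => z _; rewrite ffunE.
  have phi0 : phi 0 = 0 by rewrite /phi big1 // => z _; rewrite ffunE.
  have phid z : phi (delta z) = (connect r x z)%:R.
    have [c|c] := boolP (connect r x z).
      rewrite /phi (bigD1 z) //= ffunE eqxx big1 ?addr0 // => t /andP [_ nt].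
      by rewrite ffunE (negPf nt).
    rewrite /phi big1 // => t ct; rewrite ffunE.
    by case: eqP => // tE; rewrite -tE ct in c.
  have phie : phi (incidence e) = 1.
    by rewrite (incidenceE xy ve) phiD !phid connect0 (negPf nc) addr0.
  have phif f : f \in S :\ e -> phi (incidence f) = 0.
    move=> fS; have [a [b [ab vf]]] := edgeE f.
    have rab : r a b by apply/imsetP; exists f.
    rewrite (incidenceE ab vf) phiD !phid.
    rewrite (same_connect1r (sym_connect_sym (@joined_sym _)) rab).
    by rewrite (addrr_pchar2 (pchar_Fp _)).
  have := coord_span (X := in_tuple _) esp => eE.
  have := phie; rewrite eE.
  rewrite (big_morph phi phiD phi0) big1 => [/esym/eqP|i _].
    by rewrite oner_eq0.
  rewrite phiZ.
  have /mapP [f] : (in_tuple [seq incidence f | f in S :\ e])`_i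
      \in [seq incidence f | f in S :\ e] by apply: mem_nth.
  by rewrite mem_enum => fS ->; rewrite phif // mulr0.
case: p => [|x [|y [|z s]]] //; rewrite /ucycle => /andP [].
set t := z :: s; rewrite (lock t) /= rcons_path -lock => /and3P [rxy ryt rtx].
move=> /andP []; rewrite inE negb_or => /andP [xy xt] /andP [yt ut].
exfalso; case/imsetP: (rxy) => e eS eE.
have sub a b : joined S a b -> [set a; b] != [set x; y] ->
    joined (S :\ e) a b.
  move=> /imsetP [f fS fE] ne; apply/imsetP; exists f => //.
  by rewrite !inE fS andbT; apply: contra ne => /eqP fe; rewrite fE fe eE.
have lt : last y t \in t by rewrite /t /= mem_last.
have p1 : path (joined (S :\ e)) y (rcons t x).
  rewrite rcons_path; apply/andP; split.
    have sub_x : {in predC1 x &, subrel (joined S) (joined (S :\ e))}.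
      move=> a b; rewrite !inE => ax bx rab; apply: sub => //.
      apply/eqP => /setP /(_ x); rewrite !inE eqxx /=.
      by rewrite (eq_sym x a) (eq_sym x b) (negPf ax) (negPf bx).
    apply: (sub_in_path sub_x _ ryt); apply/allP => a.
    rewrite in_cons => /predU1P [->|at_]; apply/eqP; first exact/nesym/eqP.
    by move=> ax; rewrite -ax at_ in xt.
  apply: sub => //; apply/eqP => /setP /(_ y); rewrite !inE eqxx orbT.
  rewrite (eq_sym y x) (negPf xy) orbF => /eqP yE.
  by move: yt; rewrite yE lt.
have := path_delta p1; rewrite last_rcons addrC -(incidenceE xy (esym eE)).
by apply/negP/H.
Qed.

Lemma acyclic0 : acyclic set0.
Proof. by rewrite acyclicE family_indep0. Qed.

Lemma acyclicS (I J : {set edge G}) : J \subset I -> acyclic I -> acyclic J.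
Proof. by rewrite !acyclicE; apply: family_indepS. Qed.

Lemma acyclic_aug (I J : {set edge G}) : acyclic I -> acyclic J ->
  (#|I| < #|J|)%N -> exists2 e, e \in J :\: I & acyclic (e |: I).
Proof.
rewrite !acyclicE => iI iJ /(family_indep_aug iI iJ) [e eJ ie].
by exists e; rewrite ?acyclicE.
Qed.

Definition cycle_matroid : matroid (edge G) :=
  Matroid acyclic0 acyclicS acyclic_aug.

End CycleMatroid.

Section GraphOfRel.
Variables (V : finType) (r : rel V).

Definition sym_adj : rel V := [rel x y | (x != y) && (r x y || r y x)].

Lemma sym_adj_sym : symmetric sym_adj.
Proof. by move=> x y; rewrite /sym_adj /= eq_sym orbC. Qed.

Lemma sym_adj_irr : irreflexive sym_adj.
Proof. by move=> x; rewrite /sym_adj /= eqxx. Qed.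

Definition graph_of_rel : sgraph := SGraph sym_adj_sym sym_adj_irr.

End GraphOfRel.

Definition complete_graph (n : nat) : sgraph :=
  graph_of_rel (fun _ _ : 'I_n => true).

Definition K33 : sgraph :=
  graph_of_rel (fun x y : 'I_3 + 'I_3 =>
    match x, y with inl _, inr _ => true | _, _ => false end).

(* K_{3,3} has the parts {u, 3, 4} and {5, 6, 7}; the vertex u is replaced by
   the triangle {0, 1, 2}, its edges to 5, 6, 7 becoming 0-5, 1-6, 2-7. *)
Definition G53 : sgraph :=
  graph_of_rel (fun x y : 'I_8 =>
    (val x, val y) \in
      [:: (0, 1); (1, 2); (0, 2);
          (0, 5); (1, 6); (2, 7);
          (3, 5); (3, 6); (3, 7);
          (4, 5); (4, 6); (4, 7)]%N).

Definition G54 : sgraph :=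
  graph_of_rel (fun x y : 'I_8 =>
    (val y == (x + 1) %% 8) || (val y == (x + 4) %% 8))%N.

Definition R10_rows : seq (seq nat) :=
  [:: [:: 1; 0; 0; 0; 0; 1; 1; 0; 0; 1];
      [:: 0; 1; 0; 0; 0; 1; 1; 1; 0; 0];
      [:: 0; 0; 1; 0; 0; 0; 1; 1; 1; 0];
      [:: 0; 0; 0; 1; 0; 0; 0; 1; 1; 1];
      [:: 0; 0; 0; 0; 1; 1; 0; 0; 1; 1]]%N.

Definition R10 : matroid 'I_10 :=
  vector_matroid
    (\matrix_(i < 5, j < 10) (nth 0%N (nth [::] R10_rows i) j)%:R : 'M['F_2]_(5, 10)).

Definition non_inclusion (E : finType) (C : 'I_3 -> {set E}) : Prop :=
  forall h i j : 'I_3, h != i -> h != j -> i != j ->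
    ~~ (C h \subset C i :|: C j).

Definition is_min (R : realType) (A : R -> Prop) (m : R) : Prop :=
  A m /\ forall x, A x -> m <= x.

Definition is_max (R : realType) (A : R -> Prop) (m : R) : Prop :=
  A m /\ forall x, A x -> x <= m.

Section Cosystole.
Variables (R : realType) (E : finType) (M : matroid E).

Definition weight (mu : E -> R) : Prop :=
  (forall e, 0 <= mu e) /\ \sum_e mu e = 1.

Definition triple_weight (mu : E -> R) (x : R) : Prop :=
  exists C : 'I_3 -> {set E},
    [/\ forall i, cocircuit M (C i), non_inclusion C &
        x = \sum_i \sum_(e in C i) mu e].

(* [is_cosystole3 s] says that the max-min defining the 3-cosystole exists
   and equals s. *)
Definition is_cosystole3 (s : R) : Prop :=
  is_max (fun m => exists2 mu, weight mu & is_min (triple_weight mu) m) s.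

End Cosystole.

(* Main.v *)
From Stdlib Require Import BinPosDef.
From HB Require Import structures.
Require Import Defs.
From mathcomp Require Import all_boot all_order all_fingroup all_algebra.
From mathcomp Require Import boolp reals.

Set Implicit Arguments.
Unset Strict Implicit.
Unset Printing Implicit Defensive.

Import Order.TTheory GRing.Theory Num.Theory.
Local Open Scope ring_scope.

(* A regular matroid of rank d is represented by vectors in Q^d all of whose
   maximal minors are 0, 1 or -1, so the coordinates of every element in every
   basis are 0, 1 or -1 as well. Starting from a basis, one adds elements one
   at a time; up to a change of basis, only a few dozen partial configurations
   occur. In each of them one fixes an embedding into one of the listed
   matroids: a further element either stays in the image, or has a coordinate
   of absolute value at least 2 in some basis, or leads to a larger
   configuration. Hence every simple regular matroid of rank d is a
   restriction of a listed one, and maximality turns this into an isomorphism.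
   Total unimodularity makes independence over Q and over F_2 agree, so the
   cocircuits are minimal supports of linear functionals on F_2^d, at most 31
   of them. The cosystole is a linear program: an optimal weight gives one
   bound and a weighted family of triples covering the ground set evenly, the
   dual solution, gives the other. *)

(** * Relations and minors *)

(** Rational coordinates supply the pruning test. Over ['F_2] alone the seven vectors of the Fano
    plane look harmless, whereas any lift of them with entries 0, 1, -1 has a maximal minor of
    absolute value at least 2. In a fixed basis an element is, up to sign, one of (3^d - 1) / 2
    vectors, that is 13, 40 or 121, so each configuration needs a finite check. Only necessary
    conditions are tested, in a few bases inside the configuration; keeping a configuration that
    occurs in no regular matroid would enlarge the tree without harming soundness. One embedding per
    configuration is enough, because an element that it misses is itself the next vector to adjoin.
    Maximality speaks only of simple regular matroids of rank d, so every target must be certified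
    to be one. The constants of the linear programs have a common origin: under the optimal weight
    every cocircuit of a listed matroid weighs at least a third of the cosystole, and the triples of
    the dual solution consist of cocircuits attaining this bound. *)

Section FamilyIndep.
Variables (K : fieldType) (E : finType).
Implicit Types (S : {set E}) (c : E -> K).

Lemma family_span_rel (vT : vectType K) (v : E -> vT) (s : seq E) u :
  u \in <<[seq v e | e <- s]>>%VS ->
  exists2 c, (forall e, e \notin s -> c e = 0) & u = \sum_e c e *: v e.
Proof.
elim: s u => [|a s IH] u /=.
  rewrite span_nil memv0 => /eqP ->; exists (fun=> 0) => //.
  by rewrite big1 // => e _; rewrite scale0r.
rewrite span_cons => /memv_addP [_ /vlineP [k ->] [w /IH [c c0 ->] ->]].
exists (fun e => c e + (if e == a then k else 0)) => [e|].
  by rewrite inE negb_or => /andP [/negPf -> /c0 ->]; rewrite addr0.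
rewrite addrC; under [RHS]eq_bigr do rewrite scalerDl.
rewrite big_split; congr (_ + _).
rewrite (bigD1 a) //= eqxx big1 ?addr0 // => e /negPf ->.
by rewrite scale0r.
Qed.

(** Coefficients live on all of [E] and vanish off [S], so that a relation can be mapped, rescaled
    or compared with one in another family without reindexing. *)
Lemma family_indep_relP (vT : vectType K) (v : E -> vT) S :
  reflect (forall c, (forall e, e \notin S -> c e = 0) ->
             \sum_e c e *: v e = 0 -> forall e, c e = 0)
          (family_indep v S).
Proof.
apply: (iffP (family_indepP _ _)) => [H c cS c0 e|H e eS].
  apply/eqP/negPn/negP => ce.
  have eS : e \in S by apply: contraNT ce => /cS ->.
  have /negP [] := H e eS.
  move: c0; rewrite (bigD1 e) //= => /eqP; rewrite addr_eq0 => /eqP ve.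
  rewrite -[v e]scale1r -(mulVf ce) -scalerA ve.
  apply/memvZ; rewrite memvN; apply: memv_suml => f fe.
  have [fS|/cS ->] := boolP (f \in S); last by rewrite scale0r mem0v.
  by apply/memvZ/memv_span/map_f; rewrite mem_enum !inE fe.
apply/negP => /family_span_rel [c cS ve].
have cE : c e = 0 by rewrite cS // mem_enum !inE eqxx.
(* Subtracting [v e] from its own expression by the other vectors yields a relation with coefficient
   -1 at [e]. *)
suff /eqP : c e - (e == e)%:R = 0 by rewrite eqxx cE sub0r oppr_eq0 oner_eq0.
apply: (H (fun f => c f - (f == e)%:R)) => [f fS|].
  rewrite cS ?sub0r; last by rewrite mem_enum !inE (negPf fS) andbF.
  by case: eqP fS => [->|]; rewrite ?eS ?oppr0.
under eq_bigr do rewrite scalerBl.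
rewrite sumrB -ve [X in _ - X](bigD1 e) //= eqxx scale1r big1 ?addr0 ?subrr //.
by move=> f /negPf ->; rewrite scale0r.
Qed.

(** A relation is carried over by [L]. Equivalences arise by applying this to a map and to one that
    undoes it on the family. *)
Lemma family_indep_linear (vT wT : vectType K) (L : {linear vT -> wT})
    (v : E -> vT) S :
  family_indep (L \o v) S -> family_indep v S.
Proof.
move=> /family_indep_relP H; apply/family_indep_relP => c cS c0.
apply: H => //; have := congr1 L c0; rewrite linear0 linear_sum => {2}<-.
by apply: eq_bigr => e _; rewrite linearZ.
Qed.

Lemma family_indep_scale (vT : vectType K) (a : E -> K) (v w : E -> vT) S :
  (forall e, a e != 0) -> (forall e, w e = a e *: v e) ->
  family_indep w S = family_indep v S.
Proof.
have aux (b : E -> K) (v' w' : E -> vT) : (forall e, b e != 0) ->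
    (forall e, w' e = b e *: v' e) -> family_indep w' S -> family_indep v' S.
  move=> b0 wE /family_indep_relP H; apply/family_indep_relP => c cS c0 e.
  suff /eqP : c e / b e = 0.
    by rewrite mulf_eq0 invr_eq0 (negPf (b0 _)) orbF => /eqP.
  apply: (H (fun e => c e / b e)) => [f /cS ->|]; first by rewrite mul0r.
  by rewrite -[RHS]c0; apply: eq_bigr => f _; rewrite wE scalerA divfK.
move=> a0 wE; apply/idP/idP; first exact: aux wE.
apply: (@aux (fun e => (a e)^-1)) => e; first by rewrite invr_eq0.
by rewrite wE scalerA mulVf ?scale1r.
Qed.
End FamilyIndep.

Lemma family_indep_imset (K : fieldType) (E F : finType) (vT : vectType K)
    (f : E -> F) (v : F -> vT) (S : {set E}) :
  injective f -> family_indep v (f @: S) = family_indep (v \o f) S.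
Proof.
move=> fi; rewrite /family_indep /=; apply: perm_free.
rewrite /image_mem (map_comp v f); apply: perm_map; apply: uniq_perm.
- exact: enum_uniq.
- by rewrite map_inj_uniq // enum_uniq.
move=> y; rewrite mem_enum; apply/imsetP/mapP => [[x xS ->]|[x xS ->]];
  exists x; by rewrite // mem_enum in xS *.
Qed.

Lemma sum_col_enum (K : fieldType) (m n : nat) (A : 'M[K]_(m, n))
    (S : {set 'I_n}) (c : 'I_n -> K) : (forall e, e \notin S -> c e = 0) ->
  \sum_e c e *: col e A =
  colsub (fun i : 'I_#|S| => enum_val i) A *m \col_i c (enum_val i).
Proof.
move=> cS; rewrite (bigID (mem S)) /= [X in _ + X]big1 ?addr0; last first.
  by move=> e /cS ->; rewrite scale0r.
rewrite big_enum_val; apply/matrixP => i j; rewrite summxE !mxE.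
by apply: eq_bigr => k _; rewrite !mxE mulrC.
Qed.

(** Independent columns have full column rank, so some rows cut out an invertible square. In this
    form independence can be compared between fields. *)
Lemma family_indep_minorP (K : fieldType) (m n : nat) (A : 'M[K]_(m, n))
    (S : {set 'I_n}) :
  family_indep (fun j => col j A) S <->
  exists f : 'I_#|S| -> 'I_m, \det (mxsub f enum_val A) != 0.
Proof.
pose B := colsub (fun i : 'I_#|S| => enum_val i) A.
split => [/family_indep_relP H|[f df]].
  have fB : row_full B.
    (* Each column of the cokernel of [B] is a relation among the columns of [B]; [c] extends it by
       zero. *)
    rewrite -cokermx_eq0; apply/eqP/matrixP => i j; rewrite [RHS]mxE.
    pose c e := if [pick i : 'I_#|S| | enum_val i == e] is Some i
                then cokermx B i j else 0.
    have cE k : c (enum_val k) = cokermx B k j.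
      rewrite /c; case: pickP => [k' /eqP /enum_val_inj -> //|/(_ k) /=].
      by rewrite eqxx.
    have cS e : e \notin S -> c e = 0.
      by rewrite /c; case: pickP => // k /eqP <-; rewrite enum_valP.
    rewrite -cE; apply: H => //; rewrite (sum_col_enum A cS).
    have -> : \col_i c (enum_val i) = col j (cokermx B).
      by apply/matrixP => k l; rewrite [LHS]mxE cE [RHS]mxE.
    by rewrite colE mulmxA mulmx_coker mul0mx.
  have := fullrowsub_unit fB; rewrite unitmxE unitfE => dB.
  by exists (fullrankfun fB); rewrite mxsubrc.
apply/family_indep_relP => c cS; rewrite (sum_col_enum A cS) => c0 e.
have [eS|/cS //] := boolP (e \in S).
have u : mxsub f (fun i : 'I_#|S| => enum_val i) A \in unitmx.
  by rewrite unitmxE unitfE.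
have z : \col_i c (enum_val i) = 0 :> 'cV_#|S|.
  rewrite -[LHS](mulKmx u).
  rewrite [X in _ *m (X *m _)]mxsubrc mul_rowsub_mx c0.
  have -> : rowsub f 0 = 0 :> 'cV[K]_#|S| by apply/matrixP => i j; rewrite !mxE.
  by rewrite mulmx0.
have := congr1 (fun M : 'cV_#|S| => M (enum_rank_in eS e) 0) z.
by rewrite !mxE enum_rankK_in.
Qed.

(** * Total unimodularity *)

(** One integer list serves over the integers, the rationals and ['F_2]: every minor is the image of
    an integer one. *)
Definition colmx (R : pzRingType) (d : nat) (T : seq (seq int)) :
  'M[R]_(d, size T) := \matrix_(i, j) ((nth [::] T j)`_i)%:~R.

Lemma map_colmx (R : pzRingType) d T :
  colmx R d T = map_mx intr (colmx int d T).
Proof. by apply/matrixP => i j; rewrite !mxE intz. Qed.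

Lemma det_colmx (R : comNzRingType) d T k (f : 'I_k -> 'I_d) g :
  \det (mxsub f g (colmx R d T)) = (\det (mxsub f g (colmx int d T)))%:~R.
Proof. by rewrite map_colmx -map_mxsub det_map_mx. Qed.

Lemma unit_intP (R : numDomainType) (z : int) :
  (z%:~R \in [:: -1; 0; 1 : R]) = (z \in [:: -1; 0; 1]).
Proof.
have e1 : -1 = (-1)%:~R :> R by rewrite rmorphN1.
by rewrite !inE intr_eq0 e1 -[X in [|| _, _ | _ == X]]/(1%:~R) !eqr_int.
Qed.

(* The nonzero minors of a totally unimodular matrix are 1 or -1, hence nonzero
   in every field. *)
Lemma tu_indep (K : fieldType) d T : totally_unimodular (colmx rat d T) ->
  indep (vector_matroid (colmx K d T)) =1 indep (vector_matroid (colmx rat d T)).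
Proof.
move=> tu S.
have minE (L : fieldType) : indep (vector_matroid (colmx L d T)) S <->
    exists f : 'I_#|S| -> 'I_d,
      (\det (mxsub f enum_val (colmx int d T)))%:~R != 0 :> L.
  rewrite [indep _ _]/(family_indep (fun j => col j (colmx L d T)) S).
  rewrite family_indep_minorP.
  by split=> -[f df]; exists f; move: df; rewrite (det_colmx L).
have tuf (L : fieldType) (f : 'I_#|S| -> 'I_d) :
    ((\det (mxsub f enum_val (colmx int d T)))%:~R != 0 :> L) =
    (\det (mxsub f enum_val (colmx int d T)) != 0).
  have := tu _ f enum_val; rewrite (det_colmx rat) unit_intP !inE.
  by case/or3P => /eqP ->;
    rewrite ?mulrN1z ?mulr0z ?mulr1z ?eqxx ?oppr_eq0 ?oner_eq0.
by apply/idP/idP => /minE [f df]; apply/minE; exists f; rewrite !tuf in df *.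
Qed.

Definition sumz (n : nat) (F : nat -> int) : int :=
  foldr (fun i s => F i + s) 0 (iota 0 n).

Lemma sumzE n F : sumz n F = \sum_(i < n) F i.
Proof.
rewrite -(big_mkord xpredT F) /index_iota subn0 /sumz.
by elim: (iota 0 n) => [|i s IH] /=; rewrite ?big_nil // big_cons IH.
Qed.

(** Laplace expansion along the first selected column, in a form that evaluates; the many zero
    entries of the targets cut the recursion. *)
Fixpoint minorz (T : seq (seq int)) (c r : seq nat) : int :=
  if c is j :: c' then
    sumz (size r) (fun i => let a := (nth [::] T j)`_(nth 0%N r i) in
      if a == 0 then 0
      else a * ((-1) ^+ i * minorz T c' (take i r ++ drop i.+1 r)))
  else 1.

Lemma nth_rem T (x0 : T) (r : seq T) i k : (i < size r)%N ->
  nth x0 (take i r ++ drop i.+1 r) k = nth x0 r (bump i k).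
Proof.
move=> ir; rewrite nth_cat size_take ir /bump; case: ltnP => [ki|ik].
  by rewrite nth_take.
by rewrite nth_drop addSn subnKC.
Qed.

Lemma minorzE T c r : size r = size c ->
  minorz T c r = \det (\matrix_(i < size c, j < size c)
                         (nth [::] T (nth 0%N c j))`_(nth 0%N r i)).
Proof.
elim: c r => [|j c IH] r sr; first by rewrite det_mx00.
rewrite (expand_det_col _ ord0) /= sr sumzE.
apply: eq_bigr => i _; rewrite mxE /=.
case: eqP => [->|_]; first by rewrite mul0r.
rewrite /cofactor addn0 IH; last first.
  rewrite size_cat size_take size_drop sr ltn_ord /= subSS subnKC //.
  by rewrite -ltnS.
congr (_ * (_ * \det _)); apply/matrixP => a b; rewrite !mxE /= nth_rem ?sr //.
Qed.

Fixpoint subseqs (k : nat) (s : seq nat) : seq (seq nat) :=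
  match k, s with
  | 0%N, _ => [:: [::]]
  | k'.+1, x :: s' => map (cons x) (subseqs k' s') ++ subseqs k s'
  | _, _ => [::]
  end.

Lemma mem_subseqs t s : subseq t s -> t \in subseqs (size t) s.
Proof.
elim: s t => [|x s IH] [|y t] //= yt; rewrite mem_cat; case: eqP yt => [->|_].
  by move=> /IH ts; rewrite map_f.
by move=> /(IH (y :: t)) ->; rewrite orbT.
Qed.

(** Increasing selections represent all those without repetition, and more than [d] rows cannot be
    selected without repetition. *)
Definition tu_check (d : nat) (T : seq (seq int)) : bool :=
  all (fun k => all (fun r => all (fun c => minorz T c r \in [:: -1; 0; 1])
      (subseqs k (iota 0 (size T)))) (subseqs k (iota 0 d))) (iota 0 d.+1).

(** Brings a minor on distinct indices to one on increasing indices, at the cost of a sign. *)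
Lemma sorting_perm k m (f : 'I_k -> 'I_m) : injective f ->
  exists (s : 'S_k) (t : seq nat), [/\ size t = k, subseq t (iota 0 m) &
    forall i, f (s i) = nth 0%N t i :> nat].
Proof.
move=> fi; pose t := [tuple val (f i) | i < k].
have /tuple_permP [s st] : perm_eq (sort leq t) t by rewrite perm_sort.
exists s, (sort leq t); split => [||i].
- by rewrite size_sort size_tuple.
- have lt : sorted ltn (sort leq t).
    rewrite ltn_sorted_uniq_leq sort_uniq sort_sorted ?andbT; last exact: leq_total.
    by rewrite map_inj_uniq ?enum_uniq // => x y /val_inj /fi.
  suff -> : sort leq t = [seq x <- iota 0 m | x \in sort leq t].
    exact: filter_subseq.
  apply: (irr_sorted_eq ltn_trans ltnn) => //.
    by apply: sorted_filter (iota_ltn_sorted _ _); apply: ltn_trans.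
  move=> x; rewrite mem_filter mem_iota add0n andbC.
  case: (boolP (x \in _)); rewrite ?andbF // mem_sort => /mapP [i _ ->].
  by rewrite ltn_ord.
by rewrite st -tnth_nth !tnth_mktuple.
Qed.

Lemma tu_checkP d T : tu_check d T -> totally_unimodular (colmx rat d T).
Proof.
move=> chk k f g; rewrite det_colmx unit_intP; set A := colmx int d T.
have [/injectiveP fi|/injectivePn [i [j ij fE]]] := boolP (injectiveb f); last first.
  rewrite (determinant_alternate ij) // => x; by rewrite !mxE fE.
have [/injectiveP gi|/injectivePn [i [j ij gE]]] := boolP (injectiveb g); last first.
  rewrite -det_tr (determinant_alternate ij) // => x; by rewrite !mxE gE.
have [s [r [sr rs rE]]] := sorting_perm fi.
have [u [c [sc cs cE]]] := sorting_perm gi.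
(* Undoing the two sorting permutations contributes only signs to the determinant. *)
have -> : mxsub f g A =
    row_perm s^-1 (col_perm u^-1 (mxsub (f \o s) (g \o u) A)).
  by apply/matrixP => i j; rewrite !mxE /= !permKV.
rewrite row_permE col_permE !det_mulmx !det_perm.
suff : \det (mxsub (f \o s) (g \o u) A) \in [:: -1; 0; 1].
  rewrite !inE => /or3P [] /eqP ->; case: (odd_perm _); case: (odd_perm _);
  by rewrite ?expr0 ?expr1 ?mulr0 ?mul0r ?mulr1 ?mul1r ?mulN1r ?opprK ?eqxx ?orbT.
have kd : (k <= d)%N by rewrite -sr (leq_trans (size_subseq rs)) ?size_iota.
have /allP /(_ k) := chk; rewrite mem_iota ltnS kd => /(_ isT) /allP /(_ r).
rewrite -{1}sr mem_subseqs // => /(_ isT) /allP /(_ c).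
rewrite -{1}sc mem_subseqs // => /(_ isT); rewrite minorzE ?sr ?sc //.
have -> : mxsub (f \o s) (g \o u) A = \matrix_(i < k, j < k)
    (nth [::] T (nth 0%N c j))`_(nth 0%N r i).
  by apply/matrixP => i j; rewrite !mxE /= rE cE intz.
by rewrite {cE cs}; case: _ / sc.
Qed.

(** * Unimodular coordinates of regular matroids *)

(** Only the [d] by [d] minors enter: passing to coordinates in a basis taken from the family
    multiplies all of them by the same sign. *)
Definition unimodular (E : finType) d (w : E -> 'cV[rat]_d) : Prop :=
  forall g : 'I_d -> E, \det (\matrix_(i, j) w (g j) i 0) \in [:: -1; 0; 1].

Lemma rank_attained (E : finType) (M : matroid E) :
  exists2 S, indep M S & #|S| = rank M.
Proof.
have [|S iS rS] := @eq_bigmax_cond _ (indep M) (fun S : {set E} => #|S|).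
  by apply/card_gt0P; exists set0; apply: indep0.
by exists S.
Qed.

Lemma indep_le_rank (E : finType) (M : matroid E) S :
  indep M S -> (#|S| <= rank M)%N.
Proof. by move=> iS; apply: leq_bigmax_cond. Qed.

(** Some minor of order the rank, on rows [r] and columns [q], is nonzero. Keeping only the rows [r]
    loses nothing, since [Y] undoes this projection on the column space. *)
Lemma regular_unimodular (E : finType) (M : matroid E) : regular M ->
  exists w : E -> 'cV[rat]_(rank M),
    [/\ indep M =1 family_indep w, unimodular w &
        exists g, \det (\matrix_(i, j) w (g j) i 0) != 0].
Proof.
move=> [m [n [A [tu [f [fb iM]]]]]].
have [f' fK f'K] := fb; have fi := can_inj fK.
have {}iM S : indep M S = family_indep (fun j => col j A) (f @: S).
  by rewrite -iM.
have [S0 iS0 cS0] := rank_attained M; pose S1 := f @: S0.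
(* A column outside this span would enlarge an independent set that already has the size of the
   rank. *)
have rk x : col x A \in <<[seq col e A | e in S1]>>%VS.
  have [xS|xS] := boolP (x \in S1).
    by apply/memv_span/map_f; rewrite mem_enum.
  apply: contraT => nx.
  have /indep_le_rank : indep M (f' x |: S0).
    rewrite iM imsetU1 f'K (@family_indepD1 _ _ _ (fun j => col j A) _ x (setU11 _ _)).
    by rewrite setU1K // nx -iM.
  rewrite cardsU1 -cS0 [f' x \in S0](_ : _ = false) ?add1n ?ltnn //.
  by apply: contraNF xS => xS; apply/imsetP; exists (f' x).
have [r [q [dq qE]]] : exists (r : 'I_(rank M) -> 'I_m) (q : 'I_(rank M) -> 'I_n),
    \det (mxsub r q A) != 0 /\ forall x, exists c, col x A = colsub q A *m c.
  have <- : #|S1| = rank M by rewrite card_imset.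
  move: iS0; rewrite iM => /family_indep_minorP [r dr].
  exists r, enum_val; split=> // x.
  have [c cS ->] := family_span_rel (rk x).
  exists (\col_i c (enum_val i)); apply: (sum_col_enum A) => e eS.
  by apply: cS; rewrite mem_enum.
pose w e := col (f e) (rowsub r A).
have wE (g : 'I_(rank M) -> E) :
    \matrix_(i, j) w (g j) i 0 = mxsub r (f \o g) A.
  by apply/matrixP => i j; rewrite !mxE.
exists w; split; last first.
- exists (f' \o q); rewrite wE.
  suff -> : mxsub r (f \o (f' \o q)) A = mxsub r q A by [].
  by apply/matrixP => i j; rewrite !mxE /= f'K.
- by move=> g; rewrite wE; apply: tu.
move=> S; rewrite iM (family_indep_imset _ _ fi).
have u : mxsub r q A \in unitmx by rewrite unitmxE unitfE.
pose Y := colsub q A *m invmx (mxsub r q A).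
have vE e : col (f e) A = Y *m w e.
  have [c cE] := qE (f e); rewrite cE -mulmxA; congr (_ *m _).
  have -> : w e = mxsub r q A *m c.
    rewrite [mxsub r q A]mxsubrc mul_rowsub_mx -cE.
    by apply/matrixP => i j; rewrite !mxE.
  by rewrite mulKmx.
have wE' e : w e = rowsub r 1%:M *m col (f e) A.
  by rewrite mul_rowsub_mx mul1mx; apply/matrixP => i j; rewrite !mxE.
apply/idP/idP => H.
- apply: (family_indep_linear (L := mulmx Y)).
  by congr family_indep: H; apply/funext => e; rewrite /= vE.
- apply: (family_indep_linear (L := mulmx (rowsub r 1%:M))).
  by congr family_indep: H; apply/funext => e; rewrite /= wE'.
Qed.

(* Cramer's rule: the coordinates of a vector in a basis of the family are
   quotients of two maximal minors. *)
Lemma unimodular_coord (E : finType) d (w : E -> 'cV[rat]_d) (h : 'M[rat]_d) :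
  unimodular w ->
  (forall k, exists e (s : bool), h *m w e = (-1) ^+ s *: delta_mx k 0) ->
  forall e k, (h *m w e) k 0 \in [:: -1; 0; 1].
Proof.
move=> uw /fin_all_exists [g /fin_all_exists [s gE]] e k.
pose W (a : 'I_d -> E) := \matrix_(i, j) w (a j) i 0.
pose D := h *m W g.
(* [e] takes the place of the [k]-th basis element; Cramer's rule compares the minors of [g'] and
   [g]. *)
pose g' j := if j == k then e else g j.
pose D' := h *m W g'.
have colE a i j : (h *m W a) i j = (h *m w (a j)) i 0.
  by rewrite !mxE; apply: eq_bigr => l _; rewrite !mxE.
(* Row [k] of [h *m W a] vanishes off the diagonal, and the cofactor does not see column [k], so it
   is common to [g] and [g']. *)
have detE (a : 'I_d -> E) : (forall j, j != k -> a j = g j) ->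
    \det (h *m W a) = (h *m w (a k)) k 0 * cofactor D k k.
  move=> ag; rewrite (expand_det_row _ k) (bigD1 k) //= big1 ?addr0.
    rewrite colE; congr (_ * (_ * \det _)); apply/matrixP => i j.
    by rewrite !mxE; apply: eq_bigr => l _; rewrite !mxE ag // eq_sym neq_lift.
  by move=> j jk; rewrite colE ag // gE !mxE eq_sym (negPf jk) mulr0 mul0r.
have gk : (h *m w (g k)) k 0 = (-1) ^+ s k.
  by rewrite gE !mxE !eqxx mulr1.
have d0 : \det D != 0.
  have -> : D = diag_mx (\row_j (-1) ^+ s j).
    apply/matrixP => i j; rewrite /D colE gE !mxE eqxx andbT.
    by case: eqP => [->|]; rewrite ?mulr1 ?mulr0.
  rewrite det_diag prodf_seq_neq0; apply/allP => j _.
  by rewrite mxE signr_eq0.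
have := d0; rewrite /D det_mulmx mulf_eq0 negb_or => /andP [h0 W0].
have eqn : \det (W g') * (-1) ^+ s k = (h *m w e) k 0 * \det (W g).
  apply: (mulfI h0); rewrite mulrA -det_mulmx -/D' mulrCA -det_mulmx.
  rewrite (detE g) // (detE g') => [|j /negPf jk]; last by rewrite /g' jk.
  have -> : g' k = e by rewrite /g' eqxx.
  by rewrite gk -mulrA [cofactor _ _ _ * _]mulrC.
have := uw g'; have := uw g; rewrite -/(W g) -/(W g') => Wg Wg'.
have -> : (h *m w e) k 0 = \det (W g') * (-1) ^+ s k / \det (W g).
  by rewrite eqn mulfK.
move: Wg Wg' W0; rewrite !inE => /or3P [] /eqP -> /or3P [] /eqP ->;
  case: (s k) => //;
  by rewrite ?eqxx // ?expr0 ?expr1 ?invrN1 ?invr1 ?mul0r ?mulr1 ?mulrN1 ?opprK ?eqxx ?orbT.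
Qed.

(** * The classification certificate *)

(* Entries 0, 1, -1 are the base-4 digits 0, 1, 3, least significant first,
   closed by a leading 1. *)
Fixpoint trits (p : positive) : seq int :=
  match p with
  | xO (xO q) => 0 :: trits q
  | xI (xO q) => 1 :: trits q
  | xI (xI q) => -1 :: trits q
  | _ => [::]
  end.

Fixpoint chunks (d fuel : nat) (s : seq int) : seq (seq int) :=
  if fuel is n.+1 then
    if s is [::] then [::] else take d s :: chunks d n (drop d s)
  else [::].

Definition vecs (d : nat) (p : positive) : seq (seq int) :=
  let s := trits p in chunks d (size s) s.

Fixpoint zdot (u v : seq int) : int :=
  match u, v with
  | a :: u', b :: v' => a * b + zdot u' v'
  | _, _ => 0
  end.

Definition zmulv (h : seq (seq int)) (u : seq int) : seq int :=
  [seq zdot r u | r <- h].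

Definition pm_mem (u : seq int) (s : seq (seq int)) : bool :=
  (u \in s) || (map -%R u \in s).

Definition smallz (x : int) : bool := x \in [:: -1; 0; 1].

Fixpoint small_vecs (d : nat) : seq (seq int) :=
  if d is d'.+1 then
    let s := small_vecs d' in
    map (cons 0) s ++ map (cons 1) s ++ map (cons (-1)) s
  else [:: [::]].

(** From each pair u, -u of nonzero vectors with entries 0, 1, -1 this keeps the one whose first
    nonzero entry is 1. *)
Fixpoint normal_vecs (d : nat) : seq (seq int) :=
  if d is d'.+1 then
    map (cons 0) (normal_vecs d') ++ map (cons 1) (small_vecs d')
  else [::].

Definition unit_vecs (d : nat) : seq (seq int) :=
  [seq mkseq (fun i => (i == k)%:R) d | k <- iota 0 d].

(* A node is a configuration [nd_set], known up to signs, together with changes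
   of basis [nd_bases] to bases inside it and an embedding [nd_emb], with right
   inverse [nd_inv], into the target [nd_tgt]. A child is a further vector and a
   change of basis after which the enlarged configuration contains the one of a
   later node, [ch_idx] places further in the remaining list. *)
Record child := Child {
  ch_vec : positive; ch_mat : positive; ch_idx : nat
}.

Record node := Node {
  nd_set : positive; nd_bases : seq positive; nd_tgt : nat;
  nd_emb : positive; nd_inv : positive; nd_ch : seq child
}.

(** The rows of [h] are the coordinate functionals of a basis contained, up to signs, in [s].
    Applied to [nd_emb] and [nd_inv], the same test certifies that the embedding is invertible. *)
Definition spanning (d : nat) (h s : seq (seq int)) : bool :=
  (size h == d) &&
  let s' := [seq zmulv h u | u <- s] in all (fun e => pm_mem e s') (unit_vecs d).

(** The later configuration need only be contained in the enlarged one; forgetting vectors lets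
    branches merge. *)
Definition check_child d (R : seq (seq int)) (rest : seq node) (c : child) :=
  let R' := [seq zmulv (vecs d (ch_mat c)) u | u <- take d (trits (ch_vec c)) :: R] in
  if drop (ch_idx c) rest is nd :: _ then
    all (fun r => pm_mem r R') (vecs d (nd_set nd))
  else false.

(** [Phi] collects the coordinate functionals of all chosen bases; one value other than 0, 1, -1
    excludes a candidate. *)
Definition check_node d (Ts : seq (seq (seq int))) (rest : seq node) (nd : node) :=
  let R := vecs d (nd_set nd) in
  let H := [seq vecs d p | p <- nd_bases nd] in
  let k := vecs d (nd_emb nd) in
  let T := nth [::] Ts (nd_tgt nd) in
  let Phi := flatten H in
  let us := [seq take d (trits (ch_vec c)) | c <- nd_ch nd] in
  [&& (nd_tgt nd < size Ts)%N,
      all (fun e => pm_mem e R) (unit_vecs d),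
      all (fun h => spanning d h R) H,
      spanning d k (vecs d (nd_inv nd)),
      all (check_child d R rest) (nd_ch nd) &
      all (fun u => [|| has (fun f => ~~ smallz (zdot f u)) Phi,
                        pm_mem (zmulv k u) T | pm_mem u us]) (normal_vecs d)].

Fixpoint check_nodes d Ts (nds : seq node) : bool :=
  if nds is nd :: rest then check_node d Ts rest nd && check_nodes d Ts rest
  else true.

(** The root consists of unit vectors, so coordinates in an arbitrary basis of the matroid represent
    it. *)
Definition check_cert d Ts (nds : seq node) : bool :=
  check_nodes d Ts nds &&
  if nds is nd :: _ then
    all (fun r => r \in unit_vecs d) (vecs d (nd_set nd))
  else false.

(** * Soundness of the certificate *)

Section Soundness.
Variable d : nat.

Definition vecC (u : seq int) : 'cV[rat]_d := \col_i (u`_i)%:~R.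
Definition matC (h : seq (seq int)) : 'M[rat]_d :=
  \matrix_(i, j) ((nth [::] h i)`_j)%:~R.

Lemma zdotE n (r u : seq int) : (size u <= n)%N ->
  zdot r u = \sum_(j < n) r`_j * u`_j.
Proof.
have nil0 (v : seq int) : \sum_(j < n) [::]`_j * v`_j = 0.
  by rewrite big1 // => j _; rewrite nth_nil mul0r.
elim: r u n nil0 => [|a r IH] [|b u] n nil0 su; rewrite ?nil0 //.
  by rewrite big1 // => j _; rewrite nth_nil mulr0.
case: n su {nil0} => // n su; rewrite big_ord_recl /= (IH u n) // => v.
rewrite big1 // => j _.
by rewrite nth_nil mul0r.
Qed.

Lemma mulmx_vecC h u : (size u <= d)%N ->
  matC h *m vecC u = vecC (zmulv h u).
Proof.
move=> su; apply/matrixP => i j; rewrite !mxE.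
have -> : (zmulv h u)`_i = zdot (nth [::] h i) u.
  have [ih|hi] := ltnP i (size h); first by rewrite (nth_map [::]).
  by rewrite !nth_default ?size_map // .
rewrite (zdotE _ su) rmorph_sum.
by apply: eq_bigr => l _; rewrite !mxE rmorphM.
Qed.

Lemma vecCN u : vecC (map -%R u) = - vecC u.
Proof.
apply/matrixP => i j; rewrite !mxE -rmorphN; congr _%:~R.
have [iu|ui] := ltnP i (size u); first by rewrite (nth_map 0).
by rewrite !nth_default ?size_map ?oppr0.
Qed.

Lemma pm_memP u s : pm_mem u s ->
  exists2 v, v \in s & exists b : bool, vecC v = (-1) ^+ b *: vecC u.
Proof.
case/orP => us; [exists u => //; exists false|exists (map -%R u) => //; exists true].
  by rewrite scale1r.
by rewrite vecCN expr1 scaleN1r.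
Qed.

Lemma size_vecs p u : u \in vecs d p -> (size u <= d)%N.
Proof.
rewrite /vecs; move: (size _) => n; elim: n (trits p) => [|n IH] [|a s] //=.
by rewrite inE => /predU1P [->|/IH //]; rewrite size_take_min geq_minl.
Qed.

Lemma vecC_unit k : vecC (mkseq (fun i => (i == k)%:R) d) =
  \col_i (val i == k)%:R.
Proof.
by apply/matrixP => i j; rewrite !mxE nth_mkseq // rmorph_nat.
Qed.

Lemma unit_vecsP u : u \in unit_vecs d ->
  exists k : 'I_d, vecC u = delta_mx k 0.
Proof.
move=> /mapP [k]; rewrite mem_iota add0n => kd ->; exists (Ordinal kd).
by rewrite vecC_unit; apply/matrixP => i j; rewrite !mxE [j]ord1 eqxx andbT.
Qed.

Lemma mem_unit_vecs (k : 'I_d) :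
  exists2 u, u \in unit_vecs d & vecC u = delta_mx k 0.
Proof.
exists (mkseq (fun i => (i == k)%:R) d).
  by apply/mapP; exists (val k); rewrite // mem_iota /=.
by rewrite vecC_unit; apply/matrixP => i j; rewrite !mxE [j]ord1 eqxx andbT.
Qed.

Lemma sign_scaleK (b : bool) (x y : 'cV[rat]_d) :
  x = (-1) ^+ b *: y -> y = (-1) ^+ b *: x.
Proof. by move=> ->; rewrite scalerA -expr2 sqrr_sign scale1r. Qed.

Lemma spanningP h s : {in s, forall u : seq int, (size u <= d)%N} -> spanning d h s ->
  forall k : 'I_d, exists2 u, u \in s &
    exists b : bool, matC h *m vecC u = (-1) ^+ b *: delta_mx k 0.
Proof.
move=> ss /andP [_ /allP H] k; have [e /H] := mem_unit_vecs k.
move=> /pm_memP [_ /mapP [u us ->] [b eb]] <-; exists u => //.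
by exists b; rewrite mulmx_vecC ?ss.
Qed.

Lemma surj_unitmx (h : 'M[rat]_d) :
  (forall k, exists (x : 'cV[rat]_d) (b : bool), h *m x = (-1) ^+ b *: delta_mx k 0) ->
  h \in unitmx.
Proof.
move=> /fin_all_exists [x /fin_all_exists [b H]].
suff : h *m (\matrix_(i, j) ((-1) ^+ b j *: x j) i 0) = 1%:M by case/mulmx1_unit.
apply/matrixP => i j; have := congr1 (fun y : 'cV_d => y i 0) (sign_scaleK (H j)).
rewrite !mxE eqxx andbT => ->; rewrite mulr_sumr.
by apply: eq_bigr => l _; rewrite !mxE mulrCA.
Qed.

Lemma mem_small_vecs n u : size u = n -> all smallz u -> u \in small_vecs n.
Proof.
elim: n u => [|n IH] [|a u] //= [su] /andP [sa /(IH _ su) uu].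
have ci : injective (cons a) by move=> ? ? [].
rewrite !mem_cat; move: sa; rewrite /smallz !inE => /or3P [] /eqP ea;
by subst a; rewrite (mem_map ci) uu ?orbT.
Qed.

Lemma mem_normal_vecs n u : size u = n -> all smallz u -> has (predC1 0) u ->
  pm_mem u (normal_vecs n).
Proof.
elim: n u => [|n IH] [|a u] //= [su] /andP [sa su'].
have ci (x : int) : injective (cons x) by move=> ? ? [].
rewrite /pm_mem !mem_cat; move: (sa); rewrite /smallz !inE => /or3P [] /eqP -> /=.
- rewrite (_ : - -1 = 1) // => _; rewrite (mem_map (ci 1)) mem_small_vecs ?orbT //.
    by rewrite size_map.
  rewrite all_map; apply: sub_all su' => x; rewrite /smallz !inE /=.
  by case/or3P => /eqP ->.
- move=> /(IH _ su su'); rewrite !(mem_map (ci 0)).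
  by case/orP => ->; rewrite ?orbT.
by rewrite (mem_map (ci 1)) mem_small_vecs // orbT.
Qed.

Lemma small_colP (x : 'cV[rat]_d) : (forall k, x k 0 \in [:: -1; 0; 1]) -> x != 0 ->
  exists2 u, u \in normal_vecs d & exists b : bool, x = (-1) ^+ b *: vecC u.
Proof.
move=> sx x0.
pose z (y : rat) : int := if y == 1 then 1 else if y == -1 then -1 else 0.
pose u := mkseq (fun i => if insub i is Some k then z (x k 0) else 0) d.
have uE (k : 'I_d) : u`_k = z (x k 0) by rewrite nth_mkseq // valK.
have xE : vecC u = x.
  apply/matrixP => i j; rewrite [j]ord1 mxE uE.
  by have := sx i; rewrite !inE => /or3P [] /eqP ->.
have su : size u = d by rewrite size_mkseq.
have [|v vn [b eb]] := @pm_memP u (normal_vecs d).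
  apply: mem_normal_vecs => //.
    apply/(all_nthP 0) => i; rewrite su => id.
    rewrite (uE (Ordinal id)) /z /smallz.
    by case: ifP => // _; case: ifP.
  apply: contraNT x0 => /hasPn u0; rewrite -xE; apply/eqP/matrixP => i j.
  have /u0 /= : u`_i \in u by rewrite mem_nth // su.
  by rewrite !mxE negbK => /eqP ->.
by exists v => //; exists b; rewrite -xE; apply: sign_scaleK.
Qed.

Variables (E : finType) (w : E -> 'cV[rat]_d) (Ts : seq (seq (seq int))).
Hypotheses (uw : unimodular w) (w0 : forall e, w e != 0).

(** [R] is a part of what the elements look like in the coordinates [h]; nothing is asked of the
    remaining elements, so the property passes to smaller configurations. *)
Definition represents (h : 'M[rat]_d) (R : seq (seq int)) : Prop :=
  {in R, forall r, exists e (b : bool), h *m w e = (-1) ^+ b *: vecC r}.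

Definition embedded : Prop :=
  exists2 T, T \in Ts & exists2 h : 'M[rat]_d, h \in unitmx &
    forall e, exists2 t, t \in T & exists b : bool, h *m w e = (-1) ^+ b *: vecC t.

Lemma represents_spanning h R H : represents h R ->
  {in R, forall u : seq int, (size u <= d)%N} -> spanning d H R ->
  forall k, exists e (b : bool), matC H *m h *m w e = (-1) ^+ b *: delta_mx k 0.
Proof.
move=> hR sR /(spanningP sR) span k; have [u uR [b ub]] := span k.
have [e [c ec]] := hR u uR; exists e, (b (+) c).
by rewrite -mulmxA ec -scalemxAr ub scalerA signr_addb mulrC.
Qed.

Lemma mem_sign (b : bool) (x : rat) :
  ((-1) ^+ b * x \in [:: -1; 0; 1]) = (x \in [:: -1; 0; 1]).
Proof.
case: b; rewrite ?mul1r // expr1 mulN1r !inE !eqr_oppLR opprK oppr0.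
by case: (x == 1); case: (x == 0); case: (x == -1).
Qed.

Lemma size_normal_vecs n u : u \in normal_vecs n -> size u = n.
Proof.
have ss m (v : seq int) : v \in small_vecs m -> size v = m.
  elim: m v => [|m IH] v /=; first by rewrite inE => /eqP ->.
  by rewrite !mem_cat => /or3P [] /mapP [t /IH <- ->].
elim: n u => [|n IH] u //=; rewrite mem_cat => /orP [] /mapP [t].
  by move=> /IH <- ->.
by move=> /ss <- ->.
Qed.

(** Induction along the list, for all positions at once because a child may lie several places
    further. An element missed by the embedding of the node has coordinates [v] up to sign. Of the
    three alternatives checked for [v], the first contradicts unimodularity, the second the choice
    of the element, and the third leads to a later node. *)
Lemma check_nodesP nds : check_nodes d Ts nds ->
  forall i nd rest, drop i nds = nd :: rest ->
  forall h, represents h (vecs d (nd_set nd)) -> embedded.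
Proof.
elim: nds => [|nd0 rest0 IH] //= /andP [cn /IH {}IH].
case=> [|i] nd rest; last exact: IH.
move=> [<- _] h {nd rest}; move: nd0 rest0 cn IH => nd rest cn IH.
move: cn; rewrite /check_node; set R := vecs d _; set k := vecs d (nd_emb nd).
set T := nth _ _ _; set H := map _ _; set us := map _ _.
move=> /andP [Tlt /and5P [/allP Rstd /allP RH kspan /(all_nthP (Child xH xH 0)) Rch /allP chk]] hR.
have sR : {in R, forall u : seq int, (size u <= d)%N} by apply: size_vecs.
(* The configuration contains the unit vectors up to sign, so [h] gives coordinates in a basis
   consisting of elements, up to signs. *)
have hstd k0 : exists e (b : bool), h *m w e = (-1) ^+ b *: delta_mx k0 0.
  have [u /Rstd /pm_memP [v vR [b vb]] uE] := mem_unit_vecs k0.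
  have [e [c ec]] := hR v vR; exists e, (b (+) c).
  by rewrite ec vb uE scalerA signr_addb mulrC.
have hu : h \in unitmx.
  by apply: surj_unitmx => k0; have [e [b eb]] := hstd k0; exists (w e), b.
have ku : matC k \in unitmx.
  apply: surj_unitmx => k0.
  have [u _ ub] := spanningP (@size_vecs _) kspan k0.
  by exists (vecC u).
have [emb|/existsNP [e ne]] := pselect (forall e, exists2 t, t \in T &
    exists b : bool, matC k *m h *m w e = (-1) ^+ b *: vecC t).
  exists T; first exact: mem_nth.
  by exists (matC k *m h); rewrite ?unitmx_mul ?ku.
have [||v vn [b vb]] := @small_colP (h *m w e).
- exact: unimodular_coord.
- by apply: contra_neq (w0 e) => he; rewrite -[w e](mulKmx hu) he mulmx0.
have sv := size_normal_vecs vn.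
have mE m : matC m *m h *m w e = (-1) ^+ b *: vecC (zmulv m v).
  by rewrite -mulmxA vb -scalemxAr mulmx_vecC ?sv.
case/or3P: (chk v vn).
- case/hasP => f /flattenP [m mH fm] /negP [].
  have := unimodular_coord uw (represents_spanning hR sR (RH m mH)) e.
  have [/eqP sm _] := andP (RH m mH).
  case/(nthP [::]): fm => i; rewrite sm => im <- /(_ (Ordinal im)).
  rewrite mE !mxE (nth_map [::]) ?sm //= => z.
  by rewrite /smallz -(unit_intP rat) -(mem_sign b).
- move=> /pm_memP [t tT [c tc]]; case: ne; exists t => //.
  by exists (b (+) c); rewrite mE tc scalerA -signr_addb addbK.
move=> /pm_memP [u /(nthP [::]) [i]]; rewrite size_map => ich.
rewrite (nth_map (Child xH xH 0)) //; set c := nth _ _ _ => uE [b' ub'].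
have := Rch i ich; rewrite /check_child -/c.
case dE : (drop _ _) => [//|nd2 rest2] /allP R2.
(* The matrix of the child acts after [h]; in the new coordinates the configuration of the later
   node occurs. *)
apply: (IH _ _ _ dE (matC (vecs d (ch_mat c)) *m h)) => r /R2.
rewrite uE => /pm_memP [_ /mapP [u0 u0in ->] [b0 b0E]].
have [e0 [c0 ec0]] : exists e (b : bool), h *m w e = (-1) ^+ b *: vecC u0.
  move: u0in; rewrite inE => /predU1P [->|]; last exact: hR.
  exists e, (b (+) b'); rewrite vb ub' scalerA -signr_addb addbK //.
have su0 : (size u0 <= d)%N.
  move: u0in; rewrite inE => /predU1P [->|/sR //].
  by rewrite -uE size_take_min geq_minl.
exists e0, (c0 (+) b0); rewrite -mulmxA ec0 -scalemxAr mulmx_vecC // b0E.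
by rewrite scalerA signr_addb.
Qed.

End Soundness.

Lemma check_certP (d : nat) (E : finType) (w : E -> 'cV[rat]_d) Ts nds :
  unimodular w -> (forall e, w e != 0) ->
  (exists g : 'I_d -> E, \det (\matrix_(i, j) w (g j) i 0) != 0) ->
  check_cert d Ts nds -> embedded w Ts.
Proof.
move=> uw w0 [g dg] /andP [chk]; case: nds chk => // nd nds chk /allP R0.
set W := \matrix_(i, j) _ in dg.
have Wu : W \in unitmx by rewrite unitmxE unitfE.
apply: (check_nodesP uw w0 chk (drop0 _) (h := invmx W)) => r /R0.
move=> /unit_vecsP [k ->]; exists (g k), false; rewrite scale1r.
rewrite -[RHS](mulKmx Wu); congr (_ *m _); rewrite -colE.
by apply/matrixP => i j; rewrite !mxE [j]ord1.
Qed.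

(** * Embedding into a listed matroid *)

Lemma simple_indep (E : finType) (M : matroid E) (S : {set E}) :
  simple M -> (#|S| <= 2)%N -> indep M S.
Proof.
move=> sM S2; apply: contraT => nS.
have [C mC CS] := minset_exists (P := [pred S | ~~ indep M S]) nS.
by have := sM C mC; rewrite ltnNge (leq_trans (subset_leq_card CS)).
Qed.

Lemma F2_neq0 (x : 'F_2) : x != 0 -> x = 1.
Proof. by case: x => [[|[|x]]] //= i _; apply: val_inj. Qed.

(** The only nonzero scalar is 1, so parallel vectors are equal. *)
Lemma simple_F2 (E : finType) (vT : vectType 'F_2) (v : E -> vT) :
  injective v -> (forall e, v e != 0) -> simple (family_matroid v).
Proof.
move=> vi v0 C /minsetP [/= dC _]; rewrite ltnNge; apply: contra dC => C2.
apply/family_indepP => e eC.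
have le1 : (#|C :\ e| <= 1)%N by move: C2; rewrite (cardsD1 e) eC.
case: (set_0Vmem (C :\ e)) => [->|[f fC]].
  by rewrite /image_mem enum_set0 span_nil memv0.
have -> : C :\ e = [set f].
  by apply/esym/eqP; rewrite eqEcard sub1set fC cards1.
rewrite /image_mem enum_set1 span_seq1; apply/negP => /vlineP [k ve].
have [k0|/F2_neq0 k1] := eqVneq k 0.
  by have := v0 e; rewrite ve k0 scale0r eqxx.
by move: fC; rewrite !inE; move: ve; rewrite k1 scale1r => /vi ->; rewrite eqxx.
Qed.

Definition parities (u : seq int) : seq bool := [seq odd `|x|%N | x <- u].

Lemma natr_F2 (n : nat) : n%:R = (odd n)%:R :> 'F_2.
Proof.
by rewrite -[in LHS](odd_double_half n) natrD -mul2n natrM pchar_Zp // mul0r addr0.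
Qed.

Lemma intr_F2 (z : int) : z%:~R = (odd `|z|%N)%:R :> 'F_2.
Proof.
case: z => n; first exact: natr_F2.
by rewrite NegzE mulrNz abszN absz_nat -pmulrn -natr_F2 (oppr_pchar2 (pchar_Fp _)).
Qed.

(** The clauses match what maximality asks of a larger matroid: total unimodularity gives
    regularity, the unit vectors give the rank, and columns that are distinct and nonzero modulo 2
    give simplicity. *)
Definition target_check (d : nat) (T : seq (seq int)) : bool :=
  [&& tu_check d T, all (fun e => e \in T) (unit_vecs d),
      all (fun u => size u == d) T & uniq (nseq d false :: map parities T)].

Section Target.
Variables (d : nat) (T : seq (seq int)).
Hypothesis Tok : target_check d T.

Let N := vector_matroid (colmx 'F_2 d T).

Lemma target_indep :
  indep N =1 indep (vector_matroid (colmx rat d T)).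
Proof. by apply: tu_indep; apply: tu_checkP; case/and4P: Tok. Qed.

Lemma target_regular : regular N.
Proof.
exists d, (size T), (colmx rat d T); split.
  by apply: tu_checkP; case/and4P: Tok.
exists id; split; first by exists id.
by move=> S; rewrite imset_id target_indep.
Qed.

Lemma size_target (j : 'I_(size T)) : size (nth [::] T j) = d.
Proof. by have /and4P [_ _ /allP sT _] := Tok; apply/eqP/sT/mem_nth. Qed.

Lemma col_F2 (j : 'I_(size T)) (i : 'I_d) :
  col j (colmx 'F_2 d T) i 0 = (nth false (parities (nth [::] T j)) i)%:R.
Proof. by rewrite !mxE intr_F2 (nth_map 0) // size_target. Qed.

Lemma target_simple : simple N.
Proof.
have /and4P [_ _ _] := Tok; rewrite cons_uniq => /andP [T0 Tu].
have sp (j : 'I_(size T)) : size (parities (nth [::] T j)) = d.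
  by rewrite size_map size_target.
apply: simple_F2 => [i j ij|j].
  apply/ord_inj/eqP; rewrite -(nth_uniq [::] _ _ Tu) ?size_map //.
  rewrite !(nth_map [::]) //; apply/eqP; apply: (@eq_from_nth _ false).
    by rewrite !sp.
  rewrite sp => k kd; have := congr1 (fun x : 'cV_d => x (Ordinal kd) 0) ij.
  by rewrite !col_F2 /=; case: (nth _ _ _); case: (nth _ _ _).
apply: contraNneq T0 => c0; apply/(nthP [::]); exists j; rewrite ?size_map //.
rewrite (nth_map [::]) //; apply: (@eq_from_nth _ false).
  by rewrite sp size_nseq.
rewrite sp => k kd; have := congr1 (fun x : 'cV_d => x (Ordinal kd) 0) c0.
by rewrite col_F2 mxE nth_nseq kd /=; case: (nth _ _ _).
Qed.

Lemma target_unit : exists q : 'I_d -> 'I_(size T),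
  forall (R : pzRingType) k, col (q k) (colmx R d T) = delta_mx k 0.
Proof.
have /and4P [_ /allP uT _ _] := Tok.
have H (k : 'I_d) : exists j : 'I_(size T),
    nth [::] T j = mkseq (fun i => (i == k)%:R) d.
  have /uT /(nthP [::]) [j jT jE] : mkseq (fun i => (i == k)%:R : int) d \in unit_vecs d.
    by apply/mapP; exists (val k); rewrite // mem_iota /=.
  by exists (Ordinal jT).
have [q qE] := fin_all_exists H; exists q => R k.
apply/matrixP => i j; rewrite !mxE qE nth_mkseq // [j]ord1 eqxx andbT.
by rewrite rmorph_nat.
Qed.

Lemma target_rank : rank N = d.
Proof.
apply/eqP; rewrite eqn_leq; apply/andP; split.
  have [S iS <-] := rank_attained N; have [f df] := (family_indep_minorP _ _).1 iS.
  rewrite -[X in (_ <= X)%N]card_ord -[X in (X <= _)%N]card_ord.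
  have [/injectiveP/leq_card //|/injectivePn [i [j ij fE]]] := boolP (injectiveb f).
  by move: df; rewrite (determinant_alternate ij) ?eqxx // => x; rewrite !mxE fE.
have [q qE] := target_unit.
have qi : injective q.
  move=> a b ab; have := qE 'F_2 a; rewrite ab qE.
  move=> /(congr1 (fun x : 'cV_d => x a 0)); rewrite !mxE !eqxx !andbT.
  by case: eqP.
have : indep N (q @: [set: 'I_d]).
  rewrite [indep _ _](family_indep_imset (fun j => col j (colmx 'F_2 d T)) _ qi).
  apply/family_indep_relP => c _ c0 k.
  have := congr1 (fun x : 'cV_d => x k 0) c0; rewrite summxE mxE => <-.
  rewrite (bigD1 k) //= qE !mxE !eqxx mulr1 big1 ?addr0 // => l lk.
  by rewrite /= qE !mxE eq_sym (negPf lk) mulr0.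
by move=> /indep_le_rank; rewrite card_imset // cardsT card_ord.
Qed.

(** Each element goes to its column up to sign. Two elements with one image would be parallel,
    against simplicity, and a column that is missed would exhibit [M] as a proper restriction of
    [N], against maximality. *)
Lemma embedded_isomorphic (E : finType) (M : matroid E) (w : E -> 'cV[rat]_d)
    (h : 'M[rat]_d) : maximal_simple_regular d M -> indep M =1 family_indep w ->
  h \in unitmx ->
  (forall e, exists2 t, t \in T & exists b : bool, h *m w e = (-1) ^+ b *: vecC d t) ->
  isomorphic M N.
Proof.
move=> [sM _ _ maxM] iM hu ht.
have /fin_all_exists [f /fin_all_exists [b fE]] e :
    exists (j : 'I_(size T)) (b : bool),
      h *m w e = (-1) ^+ b *: col j (colmx rat d T).
  have [t /(nthP [::]) [j jT <-] [b ->]] := ht e.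
  exists (Ordinal jT), b; congr (_ *: _).
  by apply/matrixP => x y; rewrite !mxE.
have fi : injective f.
  move=> e e' ee; apply/eqP; apply: contraT => ne.
  have : indep M [set e; e'] by apply: simple_indep => //; rewrite cards2 ne.
  rewrite iM => /family_indepP /(_ e); rewrite !inE eqxx => /(_ isT) /negP [].
  have -> : w e = ((-1) ^+ b e * (-1) ^+ b e') *: w e'.
    rewrite -[w e](mulKmx hu) -[w e' in RHS](mulKmx hu) !fE ee.
    rewrite -!scalemxAr !scalerA; congr (_ *: _).
    by rewrite -mulrA -expr2 sqrr_sign mulr1.
  apply/memvZ/memv_span/map_f; rewrite mem_enum !inE eqxx orbT andbT.
  by rewrite eq_sym.
have iMN (S : {set E}) : indep N (f @: S) = indep M S.
  rewrite target_indep iM.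
  rewrite [indep _ _](family_indep_imset (fun j => col j (colmx rat d T)) _ fi).
  transitivity (family_indep (fun e => h *m w e) S).
    apply/esym/(@family_indep_scale _ _ _ (fun e => (-1) ^+ b e)) => // e.
    by rewrite signr_eq0.
  apply/idP/idP => H; first exact: (family_indep_linear (L := mulmx h)).
  apply: (family_indep_linear (L := mulmx (invmx h))).
  by congr family_indep: H; apply/funext => e; rewrite /= mulKmx.
have [XT|nXT] := eqVneq (f @: [set: E]) setT.
  exists f; split; last exact: iMN.
  by apply: (inj_card_bij fi); rewrite -cardsT -XT card_imset // cardsT.
case: maxM; exists 'I_(size T), N, (f @: [set: E]); split.
- exact: target_simple.
- exact: target_regular.
- exact: target_rank.
- by rewrite properT.
have fX e : f e \in f @: [set: E] by apply: imset_f.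
exists (fun e => Sub (f e) (fX e)); split.
  apply: inj_card_bij => [e e' /(congr1 val) /= /fi //|].
  by rewrite card_sig card_imset // cardsT.
move=> S; rewrite -iMN /= /restr_indep /=; congr (indep N _).
by rewrite -imset_comp; apply: eq_imset.
Qed.

End Target.

Lemma classification (d : nat) (Ts : seq (seq (seq int))) (nds : seq node)
    (E : finType) (M : matroid E) :
  all (target_check d) Ts -> check_cert d Ts nds -> maximal_simple_regular d M ->
  exists2 T, T \in Ts & isomorphic M (vector_matroid (colmx 'F_2 d T)).
Proof.
move=> /allP Tok chk mM; have [sM rM rkM _] := mM.
have [w [iM uw gw]] := regular_unimodular rM.
move: w iM uw gw; rewrite rkM => w iM uw gw.
have w0 e : w e != 0.
  have : indep M [set e] by apply: simple_indep => //; rewrite cards1.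
  rewrite iM => /family_indepP /(_ e); rewrite inE eqxx => /(_ isT).
  by apply: contraNneq => ->; apply: mem0v.
have [T TTs [h hu ht]] := check_certP uw w0 gw chk.
by exists T => //; apply: (embedded_isomorphic (Tok T TTs) mM iM hu ht).
Qed.

(** * Cocircuits as supports of functionals *)

Lemma linear_hom (K : fieldType) (vT wT : vectType K) (f : vT -> wT) :
  linear f -> exists phi : 'Hom(vT, wT), phi =1 f.
Proof.
move=> fl; pose fL := GRing.isLinear.Build K vT wT *:%R f fl.
pose g : {linear vT -> wT} := HB.pack f fL.
by exists (linfun g) => x; rewrite lfunE.
Qed.

Section DualFamily.
Variables (K : fieldType) (vT : vectType K) (E : finType) (v : E -> vT).
Variables (M : matroid E).
Hypothesis iM : indep M =1 family_indep v.

(** The component of [x] in a complement of [V] is nonzero, so one of its coordinates is. *)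
Lemma separating_functional (V : {vspace vT}) (x : vT) : x \notin V ->
  exists2 phi : 'Hom(vT, K^o), (forall y, y \in V -> phi y = 0) & phi x != 0.
Proof.
move=> xV; pose p := (\1 - projv V)%VF.
have pE y : p y = y - projv V y by rewrite add_lfunE opp_lfunE id_lfunE.
have pV y : y \in V -> p y = 0 by move=> yV; rewrite pE projv_id // subrr.
have px : p x != 0.
  apply: contraNneq xV => /eqP; rewrite pE subr_eq0 => /eqP ->.
  exact: memv_proj.
have [i ci] : exists i, coord (vbasis fullv) i (p x) != 0.
  apply/existsP; apply: contraNT px; rewrite negb_exists => /forallP c0.
  rewrite (coord_vbasis (memvf (p x))) big1 // => i _.
  by have := c0 i; rewrite negbK => /eqP ->; rewrite scale0r.
have [|phi phiE] := @linear_hom K vT K^o (fun y => coord (vbasis fullv) i (p y)).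
  by move=> a y z; rewrite !linearP.
by exists phi => [y yV|]; rewrite phiE // pV // linear0.
Qed.

(** For the incidence vectors of a graph these are its edge cuts. *)
Definition cut (phi : 'Hom(vT, K^o)) : {set E} := [set e | phi (v e) != 0].

(** [S] is coindependent when its complement spans the family, and this fails exactly when a
    functional vanishes off [S] but not on the whole family. The conclusion concerns the cut and not
    [phi], because the family may span less than [vT]. *)
Lemma dual_indepP (S : {set E}) : reflect (forall phi, cut phi \subset S -> cut phi = set0)
  (dual_indep M S).
Proof.
apply: (iffP existsP) => [[B /andP [/maxsetP [iB mB] dBS]] phi cS|H].
  apply/setP => e; rewrite !inE; apply/negbTE; rewrite negbK.
  have phiB x : x \in <<[seq v e | e in B]>>%VS -> phi x = 0.
    move=> /family_span_rel [c cB ->]; rewrite linear_sum big1 // => f _.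
    rewrite linearZ /=; have [fB|fB] := boolP (f \in B); last first.
      by rewrite cB ?mem_enum // scale0r.
    have : f \notin cut phi.
      by apply: contraTN fB => /(subsetP cS) fS; rewrite (disjointFl dBS).
    by rewrite inE negbK => /eqP ->; rewrite scaler0.
  apply/eqP/phiB; have [eB|eB] := boolP (e \in B).
    by apply/memv_span/map_f; rewrite mem_enum.
  apply: contraT => ne; have := mB (e |: B); rewrite iM (family_indepD1 _ (setU11 _ _)).
  rewrite setU1K // ne -iM iB subsetU1 => /(_ isT isT) BE.
  by rewrite -BE setU11 in eB.
have [B /maxsetP [/andP [iB sB] mB] _] := @maxset_exists _
    [pred B : {set E} | indep M B && (B \subset ~: S)] set0
    (introT andP (conj (indep0 M) (sub0set _))).
have span e : e \notin S -> v e \in <<[seq v e | e in B]>>%VS.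
  move=> eS; have [eB|eB] := boolP (e \in B).
    by apply/memv_span/map_f; rewrite mem_enum.
  apply: contraT => ne; have := mB (e |: B).
  rewrite /= iM (family_indepD1 _ (setU11 _ _)) setU1K // ne -iM iB subUset sub1set.
  rewrite inE eS sB subsetU1 => /(_ isT isT) BE.
  by rewrite -BE setU11 in eB.
exists B; rewrite disjoints_subset sB andbT; apply/maxsetP; split=> // B' iB' BB'.
apply/eqP; rewrite eqEsubset BB' andbT; apply/subsetP => e eB'.
apply: contraT => eB; have ne : v e \notin <<[seq v e | e in B]>>%VS.
  have : family_indep v (e |: B).
    by rewrite -iM; apply: indepS iB'; rewrite subUset sub1set eB'.
  by rewrite (family_indepD1 _ (setU11 _ _)) setU1K // => /andP [].
(* If [B] were not a basis, a functional vanishing on [B], hence off [S], but not at [e] would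
   contradict [H]. *)
have [phi phiB phie] := separating_functional ne.
have /H c0 : cut phi \subset S.
  apply/subsetP => f; rewrite inE; apply: contraR => /span /phiB ->.
  by rewrite eqxx.
by have := in_set0 e; rewrite -c0 inE phie.
Qed.

(** A set dependent in the dual contains a nonempty cut, which is itself dependent there; minimality
    forces equality. *)
Lemma cocircuit_cut C : cocircuit M C -> exists phi, C = cut phi.
Proof.
move=> /minsetP [/= /dual_indepP /existsNP [phi /not_implyP [cC c0]] mC].
exists phi; apply/esym/mC => //=; apply/dual_indepP => H.
by apply: c0; apply: H.
Qed.

Lemma cut_cocircuit phi : cut phi != set0 ->
  (forall psi, cut psi \subset cut phi -> cut psi != set0 -> cut psi = cut phi) ->
  cocircuit M (cut phi).
Proof.
move=> c0 mphi; apply/minsetP; split=> [/=|D /= /dual_indepP dD DC].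
  by apply/dual_indepP => /(_ phi (subxx _)) /eqP; rewrite (negPf c0).
have /existsNP [psi /not_implyP [cD /eqP p0]] := dD.
apply/eqP; rewrite eqEsubset DC.
by rewrite -(mphi psi) // (subset_trans cD).
Qed.

End DualFamily.

Fixpoint bools (d : nat) : seq (seq bool) :=
  if d is d'.+1 then [seq b :: y | y <- bools d', b <- [:: false; true]]
  else [:: [::]].

Fixpoint bdot (y t : seq bool) : bool :=
  match y, t with
  | a :: y', b :: t' => (a && b) (+) bdot y' t'
  | _, _ => false
  end.

(** One mask for each functional on F_2^d. In [bools] the first bit varies fastest, so the
    functional at index i has the binary digits of i as its coordinates; the cosystole certificates
    refer to these indices. *)
Definition cuts (d : nat) (T : seq (seq int)) : seq (seq bool) :=
  let P := [seq parities t | t <- T] in [seq [seq bdot y t | t <- P] | y <- bools d].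

Definition mset (n : nat) (m : seq bool) : {set 'I_n} := [set j : 'I_n | nth false m j].

(** With [m2] and [m3] equal this is inclusion. With both empty it says that [m1] marks nothing,
    because missing entries count as false. *)
Definition msub (n : nat) (m1 m2 m3 : seq bool) : bool :=
  all (fun j => nth false m1 j ==> nth false m2 j || nth false m3 j) (iota 0 n).

Lemma msubE n m1 m2 m3 : msub n m1 m2 m3 = (mset n m1 \subset mset n m2 :|: mset n m3).
Proof.
apply/allP/subsetP => H j; first by rewrite !inE; apply/implyP/H; rewrite mem_iota /=.
by rewrite mem_iota add0n => jn; have := H (Ordinal jn); rewrite !inE => /implyP.
Qed.

Lemma boolsS d :
  bools d.+1 = [seq b :: y | y <- bools d, b <- [:: false; true]].
Proof. by []. Qed.

Lemma mem_bools d y : size y = d -> y \in bools d.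
Proof.
elim: d y => [|d IH] [|b y] // [sy]; rewrite boolsS.
by apply/allpairsPdep; exists y, b; rewrite IH //; case: b.
Qed.

Lemma size_bools d y : y \in bools d -> size y = d.
Proof.
elim: d y => [|d IH] y; first by rewrite inE => /eqP ->.
by rewrite boolsS => /allpairsPdep [z [b [/IH <- _ ->]]].
Qed.

Lemma bdotE d (y t : seq bool) : size y = d -> size t = d ->
  (bdot y t)%:R = \sum_(i < d) (nth false y i)%:R * (nth false t i)%:R :> 'F_2.
Proof.
elim: d y t => [|k IH] [|a y] [|b t] //=; first by rewrite big_ord0.
move=> [sy] [st]; rewrite big_ord_recl /= -(IH y t) //.
by case: a; case: b; case: (bdot y t); rewrite /= ?mulr0 ?mulr1 ?addr0 ?add0r //
  (addrr_pchar2 (pchar_Fp _)).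
Qed.

Lemma F2_eq_nat (x : 'F_2) : x = (x != 0)%:R.
Proof. by have [->|/F2_neq0 ->] := eqVneq x 0. Qed.

Section TargetCuts.
Variables (d : nat) (T : seq (seq int)).
Hypothesis Tok : target_check d T.
Let n := size T.
Let N := vector_matroid (colmx 'F_2 d T).
Let v (j : 'I_n) := col j (colmx 'F_2 d T).

(** The values of [phi] on the unit vectors, collected in [y], determine it. *)
Lemma cut_mem (phi : 'Hom('cV['F_2]_d, ('F_2)^o)) :
  exists2 m, m \in cuts d T & cut v phi = mset n m.
Proof.
pose y := mkseq (fun i => if insub i is Some k then phi (delta_mx k 0) != 0 else false) d.
have sy : size y = d by rewrite size_mkseq.
exists [seq bdot y t | t <- [seq parities t | t <- T]].
  by apply: map_f; apply: mem_bools.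
apply/setP => j; rewrite !inE (nth_map [::]) ?size_map // (nth_map [::]) //.
have -> : phi (v j) = (bdot y (parities (nth [::] T j)))%:R.
  rewrite (@bdotE d) ?size_map ?size_iota ?(size_target Tok) //.
  have -> : v j = \sum_i (v j i 0) *: delta_mx i 0.
    rewrite [LHS]matrix_sum_delta; apply: eq_bigr => i _.
    by rewrite big_ord_recl big_ord0 addr0.
  rewrite linear_sum; apply: eq_bigr => i _.
  rewrite linearZ (col_F2 Tok) nth_mkseq // valK mulrC; congr (_ * _).
  exact: F2_eq_nat.
by case: (bdot _ _); rewrite ?eqxx ?oner_eq0.
Qed.

Lemma mem_cuts m : m \in cuts d T -> exists phi, cut v phi = mset n m.
Proof.
move=> /mapP [y /size_bools sy ->].
pose f (x : 'cV['F_2]_d) : ('F_2)^o := ((\row_i (nth false y i)%:R) *m x) 0 0.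
have [|phi phiE] := @linear_hom _ _ _ f.
  by move=> a x z; rewrite /f mulmxDr -scalemxAr !mxE.
exists phi; apply/setP => j; rewrite !inE phiE.
rewrite (nth_map [::]) ?size_map // (nth_map [::]) //.
have -> : f (v j) = (bdot y (parities (nth [::] T j)))%:R.
  rewrite (@bdotE d) ?size_map ?size_iota ?(size_target Tok) // /f mxE.
  by apply: eq_bigr => i _; rewrite (col_F2 Tok) mxE.
by case: (bdot _ _); rewrite ?eqxx ?oner_eq0.
Qed.

Definition is_cocircuit (m : seq bool) : bool :=
  [&& m \in cuts d T, ~~ msub n m [::] [::] &
      all (fun m' => msub n m' m m ==> msub n m' [::] [::] || msub n m m' m')
        (cuts d T)].

Lemma is_cocircuitP m : is_cocircuit m -> cocircuit N (mset n m).
Proof.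
have ms0 : mset n [::] = set0 by apply/setP => j; rewrite !inE nth_nil.
rewrite /is_cocircuit msubE setUid ms0 subset0.
move=> /and3P [/mem_cuts [phi pE] m0 /allP H]; rewrite -pE.
apply: (cut_cocircuit (v := v)) => //; first by rewrite pE.
move=> psi; have [m' m'in m'E] := cut_mem psi; rewrite m'E pE => s1 n0.
have := H m' m'in; rewrite !msubE !setUid s1 ms0 subset0 (negPf n0) /= => s2.
by apply/eqP; rewrite eqEsubset s1.
Qed.

Lemma cocircuit_cuts C : cocircuit N C -> exists2 m, m \in cuts d T & C = mset n m.
Proof.
move=> /(cocircuit_cut (v := v)) [//|phi ->]; exact: cut_mem.
Qed.

End TargetCuts.

(** * Cosystoles *)

Section Isomorphic.
Variables (E F : finType) (M : matroid E) (N : matroid F) (f : E -> F).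
Hypotheses (fb : bijective f) (fM : forall S : {set E}, indep N (f @: S) = indep M S).

Let fi := bij_inj fb.

Lemma imset_surj (D : {set F}) : exists S : {set E}, D = f @: S.
Proof.
have [g fK gK] := fb; exists (g @: D); rewrite -imset_comp.
by rewrite (eq_imset (g := id)) ?imset_id // => x /=; rewrite gK.
Qed.

Lemma imset_sub (A B : {set E}) : (f @: A \subset f @: B) = (A \subset B).
Proof.
apply/idP/idP => [/subsetP H|]; last exact: imsetS.
by apply/subsetP => x xA; rewrite -(mem_imset _ _ fi) H ?imset_f.
Qed.

Lemma isomorphic_basis (B : {set E}) : basis N (f @: B) = basis M B.
Proof.
apply/maxsetP/maxsetP => [[iB mB]|[iB mB]]; split; rewrite ?fM // in iB *.
  by move=> C; rewrite -fM -imset_sub => /mB H /H /(imset_inj fi).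
by move=> D; have [C ->] := imset_surj D; rewrite fM imset_sub => /mB H /H ->.
Qed.

Lemma isomorphic_dual_indep (S : {set E}) : dual_indep N (f @: S) = dual_indep M S.
Proof.
have disj (A B : {set E}) : [disjoint f @: A & f @: B] = [disjoint A & B].
  by rewrite -!setI_eq0 -imsetI ?imset_eq0 // => x y _ _; apply: fi.
apply/existsP/existsP => [[D]|[B /andP [bB dB]]].
  have [B ->] := imset_surj D; rewrite isomorphic_basis disj => bdB.
  by exists B.
by exists (f @: B); rewrite isomorphic_basis bB disj.
Qed.

Lemma isomorphic_cocircuit (C : {set E}) : cocircuit N (f @: C) = cocircuit M C.
Proof.
apply/minsetP/minsetP => -[/= iC mC]; split; rewrite /= ?isomorphic_dual_indep // in iC *.
  by move=> B; rewrite /= -isomorphic_dual_indep -imset_sub => /mC H /H /(imset_inj fi).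
move=> D; have [B ->] := imset_surj D.
by rewrite /= isomorphic_dual_indep imset_sub => /mC H /H ->.
Qed.

Lemma isomorphic_triple_weight (R : realType) (mu : F -> R) x :
  triple_weight N mu x <-> triple_weight M (mu \o f) x.
Proof.
have sumE (A : {set E}) : \sum_(e in f @: A) mu e = \sum_(e in A) mu (f e).
  by rewrite big_imset //=; apply: in2W.
split=> [[C [cC nC ->]]|[C [cC nC ->]]].
  have [C' C'E] := fin_all_exists (fun i => imset_surj (C i)).
  exists C'; split=> [i|h i j hi hj ij|].
  - by rewrite -isomorphic_cocircuit -C'E.
  - by have := nC h i j hi hj ij; rewrite !C'E -imsetU imset_sub.
  - by apply: eq_bigr => i _; rewrite C'E sumE.
exists (fun i => f @: C i); split=> [i|h i j hi hj ij|].
- by rewrite isomorphic_cocircuit.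
- by rewrite -imsetU imset_sub; apply: nC.
- by apply: eq_bigr => i _; rewrite sumE.
Qed.

(** The optimal weight is pulled back along [f]; a competing weight on [E] is carried to [F] by the
    inverse [g]. *)
Lemma isomorphic_cosystole_bij (R : realType) (s : R) :
  is_cosystole3 N s -> is_cosystole3 M s.
Proof.
have [g fK gK] := fb.
have minE (mu : F -> R) m :
    is_min (triple_weight N mu) m <-> is_min (triple_weight M (mu \o f)) m.
  by split=> -[tm lm]; split; [apply/isomorphic_triple_weight|
    move=> x /isomorphic_triple_weight /lm|apply/isomorphic_triple_weight|
    move=> x /isomorphic_triple_weight /lm].
have sumE (mu : F -> R) : \sum_e mu (f e) = \sum_e mu e.
  by rewrite [RHS](reindex f) //; apply: onW_bij.
move=> [[mu [mu0 mu1] mmu] maxs]; split.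
  exists (mu \o f); last exact/minE.
  by split=> [e|]; [apply: mu0|rewrite -mu1 -sumE].
move=> m [nu [nu0 nu1] mnu]; apply: maxs.
have nuE : nu = (nu \o g) \o f by apply/funext => e /=; rewrite fK.
exists (nu \o g); first by split=> [e|]; [apply: nu0|rewrite -sumE -nu1 [in RHS]nuE].
by apply/minE; rewrite -nuE.
Qed.

End Isomorphic.

Lemma isomorphic_cosystole (R : realType) (E F : finType) (M : matroid E)
    (N : matroid F) (s : R) :
  isomorphic M N -> is_cosystole3 N s -> is_cosystole3 M s.
Proof. by move=> [f [fb fM]]; exact: (isomorphic_cosystole_bij fb fM). Qed.

Lemma isomorphic_trans (E F H : finType) (M : matroid E) (N : matroid F)
    (P : matroid H) : isomorphic M N -> isomorphic N P -> isomorphic M P.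
Proof.
move=> [f [fb fM]] [g [gb gN]]; exists (g \o f); split; first exact: bij_comp.
by move=> S; rewrite -fM -gN -imset_comp.
Qed.

Definition noninc (n : nat) (ms : seq (seq bool)) : bool :=
  let mn := nth [::] ms in
  all (fun t => ~~ msub n (mn t.1.1) (mn t.1.2) (mn t.2))
    [:: (0, 1, 2); (0, 2, 1); (1, 0, 2); (1, 2, 0); (2, 0, 1); (2, 1, 0)]%N.

Section CosystoleCheck.
Variables (d : nat) (T : seq (seq int)).
Let n := size T.

Definition mask_weight (ws : seq nat) (m : seq bool) : nat := sumn (mask m ws).

(* The triples of [fam] are given by multiplicities and by indices into
   [cuts d T]. They form a dual solution: counted with multiplicity, they cover
   each element at most [thr / W] times their number. *)
Definition cosystole_check (ws : seq nat) (thr : nat)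
    (fam : seq (nat * seq nat)) : bool :=
  let cs := cuts d T in
  let L := [seq (m, mask_weight ws m) | m <- cs] in
  let fam' := [seq (p.1, [seq nth [::] cs i | i <- p.2]) | p <- fam] in
  let W := sumn ws in
  let tot := sumn [seq p.1 | p <- fam'] in
  [&& size ws == n, 0 < W, 0 < tot,
      all (fun a => all (fun b => all (fun c =>
        (thr <= a.2 + b.2 + c.2) || ~~ noninc n [:: a.1; b.1; c.1]) L) L) L,
      all (fun p => [&& size p.2 == 3, all (is_cocircuit d T) p.2 & noninc n p.2]) fam',
      has (fun p => sumn [seq mask_weight ws m | m <- p.2] == thr) fam' &
      all (fun j => W * sumn [seq p.1 * count (fun m => nth false m j) p.2 | p <- fam']
                    <= thr * tot) (iota 0 n)]%N.

Hypothesis Tok : target_check d T.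
Let N := vector_matroid (colmx 'F_2 d T).

Lemma nonincP ms :
  noninc n ms <-> non_inclusion (fun i : 'I_3 => mset n (nth [::] ms i)).
Proof.
split=> [/allP H h i j hi hj ij|H].
  rewrite -msubE; apply: (H (h : nat, i : nat, j : nat)).
  by move: h i j hi hj ij => [[|[|[|h]]] hh] [[|[|[|i]]] ii] [[|[|[|j]]] jj].
apply/allP => -[[h i] j] hij; rewrite msubE /=.
have /and5P [h3 i3 j3 hi /andP [hj ij]] :
    [&& h < 3, i < 3, j < 3, h != i, h != j & i != j]%N.
  by move: hij; rewrite !inE; do 5?[case/orP]; move=> /eqP [-> -> ->].
exact: (H (Ordinal h3) (Ordinal i3) (Ordinal j3)).
Qed.

Lemma sum_mset (R : realType) (ws : seq nat) m : size ws = n -> size m = n ->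
  \sum_(e in mset n m) (nth 0%N ws e)%:R = (mask_weight ws m)%:R :> R.
Proof.
move=> sw sm; rewrite -natr_sum /mask_weight; congr _%:R.
rewrite (eq_bigl (fun e : 'I_n => nth false m e)); last by move=> e; rewrite inE.
move: n sw sm => k; elim: k ws m => [|k IH] [|w ws] [|b m] //; first by rewrite big_ord0.
move=> [sw] [sm]; rewrite big_mkcond big_ord_recl /= -big_mkcond IH //.
by case: b.
Qed.

Lemma size_cuts m : m \in cuts d T -> size m = n.
Proof. by move=> /mapP [y _ ->]; rewrite !size_map. Qed.

(** Weak duality of linear programs. The lower bound is tested on all triples of cuts, which is safe
    because every cocircuit is a cut; the triples of [fam], which bound from above, must consist of
    genuine cocircuits. *)
Lemma cosystole_checkP (R : realType) ws thr fam : cosystole_check ws thr fam ->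
  is_cosystole3 N (thr%:R / (sumn ws)%:R : R).
Proof.
rewrite /cosystole_check; set cs := cuts d T; set L := [seq _ | m <- cs].
set fam' := [seq _ | p <- fam]; set W := sumn ws; set tot := sumn _.
move=> /and5P [/eqP sw W0 tot0 /allP low /and3P [/allP famok hthr /allP cov]].
have W0' : 0 < W%:R :> R by rewrite ltr0n.
have tot0' : 0 < tot%:R :> R by rewrite ltr0n.
have fam_tw p (mu : 'I_n -> R) : p \in fam' ->
    triple_weight N mu (\sum_(i < 3) \sum_(e in mset n (nth [::] p.2 i)) mu e).
  move=> /famok /and3P [/eqP s3 /allP cc ni].
  exists (fun i : 'I_3 => mset n (nth [::] p.2 i)); split=> //; last exact/nonincP.
  by move=> i; apply: is_cocircuitP => //; apply/cc/mem_nth; rewrite s3.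
have fam_cs p m : p \in fam' -> m \in p.2 -> m \in cs.
  by move=> /famok /and3P [_ /allP cc _] /cc /and3P [].
pose mu (e : 'I_n) : R := (nth 0%N ws e)%:R / W%:R.
have sum_mu m : m \in cs -> \sum_(e in mset n m) mu e = (mask_weight ws m)%:R / W%:R.
  by move=> mcs; rewrite -mulr_suml sum_mset // size_cuts.
split.
  exists mu; split.
  - by move=> e; rewrite divr_ge0.
  - rewrite -mulr_suml -natr_sum (_ : (\sum_(e < n) nth 0 ws e)%N = W) ?divff ?gt_eqF //.
    by rewrite /W sumnE (big_nth 0%N) sw big_mkord.
  - have /hasP [p pf /eqP pthr] := hthr; have := fam_tw p mu pf.
    have -> // : \sum_(i < 3) \sum_(e in mset n (nth [::] p.2 i)) mu e = thr%:R / W%:R.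
    have /and3P [/eqP s3 _ _] := famok p pf.
    rewrite -pthr sumnE big_map natr_sum mulr_suml (big_nth [::]) s3 big_mkord.
    apply: eq_bigr => i _; rewrite sum_mu //; apply: (fam_cs p) => //.
    by rewrite mem_nth // s3.
  move=> x [C [cC nC ->]].
  have [ms msE] := fin_all_exists2 (fun i => cocircuit_cuts Tok (cC i)).
  move=> CE; pose l := [:: ms ord0; ms 1; ms 2].
  have lE (i : 'I_3) : nth [::] l i = ms i.
    by case: i => [[|[|[|i]]] ip] //=; congr ms; apply: val_inj.
  have ni : noninc n l.
    apply/nonincP => h i j hi hj ij; by rewrite !lE -!CE; apply: nC.
  have lowL i : (ms i, mask_weight ws (ms i)) \in L by apply: map_f.
  have /allP /(_ _ (lowL 1)) := low _ (lowL ord0).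
  move=> /allP /(_ _ (lowL 2)); rewrite ni orbF /= => lw.
  rewrite !big_ord_recl big_ord0 addr0.
  have e1 : lift ord0 (ord0 : 'I_2) = 1 :> 'I_3 by apply: val_inj.
  have e2 : lift ord0 (lift ord0 (ord0 : 'I_1)) = 2 :> 'I_3 by apply: val_inj.
  rewrite e1 e2 !CE !sum_mu // -!mulrDl ler_pM2r ?invr_gt0 //.
  by rewrite -!natrD ler_nat addnA.
(* The minimum for [nu] is at most its average over [fam], and by [cov] no element is counted more
   than [thr * tot / W] times in the sum. *)
move=> m [nu [nu0 nu1] [_ mnu]].
rewrite ler_pdivlMr // -(ler_pM2r tot0').
have step p : p \in fam' -> m * p.1%:R <=
    \sum_(e < n) nu e * (p.1 * count (fun k => nth false k e) p.2)%:R.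
  move=> pf; have /and3P [/eqP s3 _ _] := famok p pf.
  have := mnu _ (fam_tw p nu pf) => le.
  rewrite (eq_bigr (fun e => (nu e * (count (fun k => nth false k e) p.2)%:R) * p.1%:R));
    last by move=> e _; rewrite natrM mulrCA mulrC.
  rewrite -mulr_suml ler_wpM2r //; apply: le_trans le _.
  rewrite (eq_bigr (fun i : 'I_3 => \sum_e nu e * (nth false (nth [::] p.2 i) e)%:R)).
    rewrite exchange_big; apply: ler_sum => e _ /=.
    rewrite -mulr_sumr -natr_sum -sum1_count (big_nth [::]) s3 big_mkord.
    by rewrite [in leRHS]big_mkcond.
  move=> i _; rewrite big_mkcond; apply: eq_bigr => e _.
  by rewrite inE; case: (nth _ _ _); rewrite ?mulr1 ?mulr0.
have totE : m * tot%:R <=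
    \sum_(e < n) nu e * (sumn [seq p.1 * count (fun k => nth false k e) p.2 | p <- fam'])%:R.
  rewrite /tot sumnE big_map natr_sum mulr_sumr.
  under [leRHS]eq_bigr do rewrite sumnE big_map natr_sum mulr_sumr.
  rewrite exchange_big /= big_seq [leRHS]big_seq; exact: ler_sum.
rewrite mulrAC; apply: (le_trans (ler_wpM2r (ltW W0') totE)).
have -> : thr%:R * tot%:R = \sum_(e < n) nu e * (thr%:R * tot%:R).
  by rewrite -mulr_suml nu1 mul1r.
rewrite mulr_suml; apply: ler_sum => e _; rewrite -mulrA ler_wpM2l //.
by rewrite -!natrM ler_nat mulnC; apply: cov; rewrite mem_iota /=.
Qed.

End CosystoleCheck.

(** * Graphic and cographic matroids *)

Lemma sum_col (K : fieldType) (m n : nat) (A : 'M[K]_(m, n)) (c : 'I_n -> K) :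
  \sum_j c j *: col j A = A *m \col_j c j.
Proof.
apply/matrixP => i k; rewrite summxE !mxE.
by apply: eq_bigr => j _; rewrite !mxE mulrC.
Qed.

(** The signed incidence vector of an oriented edge. Orientation disappears modulo 2, but total
    unimodularity and the orthogonality of cycles to stars are checked over the integers. *)
Definition arc (p : nat * nat) (i : nat) : int := (i == p.1)%:R - (i == p.2)%:R.

Definition entry (L : seq (seq int)) (j i : nat) : int := (nth [::] L j)`_i.

Section EdgeList.
Variables (G : sgraph) (nv : nat) (cd : G -> 'I_nv) (ps : seq (nat * nat)).
Hypotheses (cdb : bijective cd)
  (adjE : forall x y : G, adj x y =
     (((cd x : nat), (cd y : nat)) \in ps) || (((cd y : nat), (cd x : nat)) \in ps))
  (psu : uniq ps) (psN : all (fun p => (p.2, p.1) \notin ps) ps)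
  (pslt : all (fun p => (p.1 < nv) && (p.2 < nv))%N ps).
Let n := size ps.
Let pj (j : 'I_n) := nth (0, 0)%N ps j.

(** Each edge is listed in one direction only, so indices and edges correspond. The same condition
    excludes loops, since a pair with equal ends is its own reverse. *)
Lemma edge_list : exists2 f : 'I_n -> edge G, bijective f &
  forall j z, (z \in val (f j)) = (cd z == (pj j).1 :> nat) || (cd z == (pj j).2 :> nat).
Proof.
have [dc cdK dcK] := cdb; have ci := can_inj cdK.
have pin j : pj j \in ps by apply: mem_nth.
have /fin_all_exists [f fE] : forall j, exists (e : edge G) x y,
    [/\ val e = [set x; y], cd x = (pj j).1 :> nat & cd y = (pj j).2 :> nat].
  move=> j.
  have /allP /(_ _ (pin j)) /andP [lt1 lt2] := pslt.
  pose x := dc (Ordinal lt1); pose y := dc (Ordinal lt2).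
  have e : [set x; y] \in edges G.
    rewrite inE; apply/existsP; exists x; apply/existsP; exists y.
    by rewrite eqxx adjE !dcK /= -surjective_pairing pin.
  by exists (Sub [set x; y] e), x, y; rewrite !dcK.
exists f; last first.
  move=> j z; have [x [y [-> <- <-]]] := fE j.
  by rewrite !inE !(inj_eq val_inj) !(inj_eq ci).
have fi : injective f.
  move=> i j ij; have [x [y [vi xi yi]]] := fE i; have [x' [y' [vj xj yj]]] := fE j.
  have ni : x != y.
    apply: contraTneq (pin i) => xy; move/allP: psN => /(_ (pj i)).
    have e : (pj i).1 = (pj i).2 by rewrite -xi -yi xy.
    by rewrite e -{1}e -surjective_pairing => h; apply/negP => /h/negP.
  have := set2_inj ni (etrans (esym vi) (etrans (congr1 val ij) vj)).
  have pE : pj i = pj j -> i = j.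
    by move=> /eqP; rewrite nth_uniq // => /eqP /ord_inj.
  case=> -[ex ey]; subst.
    by apply: pE; rewrite [LHS]surjective_pairing -xi -yi xj yj -surjective_pairing.
  have /allP /(_ _ (pin j)) := psN.
  by rewrite -xj -yj xi yi -surjective_pairing pin.
have fs e : exists j, f j = e.
  have := valP e; rewrite inE => /existsP [x /existsP [y /andP [axy /eqP ve]]].
  suff [j jE] : exists j, pj j = (cd x : nat, cd y : nat) \/ pj j = (cd y : nat, cd x : nat).
    exists j; apply: val_inj; rewrite ve; have [x' [y' [-> ]]] := fE j.
    case: jE => -> /= /val_inj/ci -> /val_inj/ci -> //.
    by rewrite setUC.
  move: axy; rewrite adjE => /orP [] pin'; exists (Ordinal (etrans (index_mem _ _) pin')).
    by left; rewrite /pj nth_index.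
  by right; rewrite /pj nth_index.
have [g gE] := fin_all_exists fs; exists g => // j.
by apply: fi; rewrite gE.
Qed.

Definition arcmx : 'M['F_2]_(nv, n) := \matrix_(i, j) (arc (pj j) i)%:~R.

Variable f : 'I_n -> edge G.
Hypothesis fE : forall j z,
  (z \in val (f j)) = (cd z == (pj j).1 :> nat) || (cd z == (pj j).2 :> nat).

Lemma incidence_arc j z : incidence (f j) z = arcmx (cd z) j.
Proof.
have p12 : (pj j).1 != (pj j).2.
  have pin : pj j \in ps by apply: mem_nth.
  have /allP /(_ _ pin) := psN; apply: contraNneq => e.
  by rewrite e -{1}e -surjective_pairing.
rewrite ffunE fE mxE rmorphB !rmorph_nat (oppr_pchar2 (pchar_Fp _)) //.
have [->|_] := eqVneq (cd z : nat) (pj j).1; last by rewrite add0r.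
by rewrite (negPf p12) addr0.
Qed.

Lemma sum_incidence (c : 'I_n -> 'F_2) :
  \sum_j c j *: incidence (f j) = 0 <-> arcmx *m \col_j c j = 0.
Proof.
have cE z : (\sum_j c j *: incidence (f j)) z = (arcmx *m \col_j c j) (cd z) 0.
  rewrite sum_ffunE mxE; apply: eq_bigr => j _.
  by rewrite ffunE incidence_arc [LHS]mulrC; congr (_ * _); rewrite mxE.
have [dc _ dcK] := cdb; split=> [c0|c0].
  by apply/matrixP => i k; rewrite -(dcK i) [k]ord1 -cE c0 ffunE mxE.
by apply/ffunP => z; rewrite cE c0 mxE ffunE.
Qed.

(** A functional is a weighting of the vertices, so its values on the edges form a coboundary: an
    element of the row space of [arcmx]. *)
Lemma functional_incidence (phi : 'Hom({ffun G -> ('F_2)^o}, ('F_2)^o)) :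
  exists y : 'rV_nv, forall j, phi (incidence (f j)) = (y *m arcmx) 0 j.
Proof.
have [dc cdK dcK] := cdb.
exists (\row_i phi (delta (dc i))) => j.
have -> : incidence (f j) = \sum_z incidence (f j) z *: delta z.
  apply/ffunP => z; rewrite sum_ffunE (bigD1 z) //= big1 ?addr0 => [|t tz].
    by rewrite !ffunE eqxx [RHS]mulr1.
  by rewrite !ffunE eq_sym (negPf tz) [LHS]mulr0.
rewrite linear_sum mxE (reindex cd) /=; last by exists dc => x _.
apply: eq_bigr => z _; rewrite linearZ /= incidence_arc [in RHS]mxE cdK.
exact: mulrC.
Qed.

Lemma incidence_functional (y : 'rV['F_2]_nv) :
  exists phi : 'Hom({ffun G -> ('F_2)^o}, ('F_2)^o),
    forall j, phi (incidence (f j)) = (y *m arcmx) 0 j.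
Proof.
have [|phi phiE] := @linear_hom 'F_2 {ffun G -> ('F_2)^o} ('F_2)^o
    (fun u => \sum_z y 0 (cd z) * u z).
  move=> a u v; rewrite scaler_sumr -big_split; apply: eq_bigr => z _.
  by rewrite !ffunE mulrDr; congr (_ + _); apply: mulrCA.
exists phi => j; rewrite phiE mxE [RHS](reindex cd); last exact: onW_bij.
by apply: eq_bigr => z _; rewrite incidence_arc.
Qed.

End EdgeList.

Lemma family_indep_eq_rel (K : fieldType) (E : finType) (vT wT : vectType K)
    (v : E -> vT) (w : E -> wT) (S : {set E}) :
  (forall c : E -> K, \sum_e c e *: v e = 0 <-> \sum_e c e *: w e = 0) ->
  family_indep v S = family_indep w S.
Proof.
by move=> vw; apply/family_indep_relP/family_indep_relP => H c cS /vw; apply: H.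
Qed.

Section GraphTarget.
Variables (G : sgraph) (d nv : nat) (cd : G -> 'I_nv) (ps : seq (nat * nat)).
Variable (T : seq (seq int)).
Hypotheses (cdb : bijective cd)
  (adjE : forall x y : G, adj x y =
     (((cd x : nat), (cd y : nat)) \in ps) || (((cd y : nat), (cd x : nat)) \in ps)).

Definition edge_list_check : bool :=
  [&& uniq ps, all (fun p => (p.2, p.1) \notin ps) ps,
      all (fun p => (p.1 < nv) && (p.2 < nv))%N ps & size T == size ps].

Let pj (j : nat) := nth (0, 0)%N ps j.
Let n := size ps.
Let A : 'M['F_2]_(d, n) := \matrix_(i, j) (entry T j i)%:~R.

Lemma colmx_isomorphic : size T == size ps ->
  isomorphic (vector_matroid (colmx 'F_2 d T)) (vector_matroid A).
Proof.
move=> /eqP sT; rewrite /A /n; case: _ / sT; exists id; split; first by exists id.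
by move=> S; rewrite imset_id; congr (indep (vector_matroid _) S); apply/matrixP.
Qed.

(* The last row of the incidence matrix is minus the sum of the others. *)
Definition graphic_check : bool :=
  [&& edge_list_check, nv == d.+1 &
  all (fun j => all (fun i => entry T j i == arc (pj j) i) (iota 0 d) &&
         (arc (pj j) d == - sumz d (entry T j))) (iota 0 n)].

(** Omitting a row that depends on the others does not change the kernel, hence neither the
    relations between columns. *)
Lemma graphic_isomorphic : graphic_check ->
  isomorphic (vector_matroid (colmx 'F_2 d T)) (cycle_matroid G).
Proof.
move=> /and3P [/and4P [psu psN pslt sT] /eqP nvE /allP chk].
have [f fb fE] := edge_list cdb adjE psu psN pslt.
apply: isomorphic_trans (colmx_isomorphic sT) _; exists f; split=> // S.
rewrite [LHS]acyclicE (family_indep_imset _ _ (bij_inj fb)).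
have jin (j : 'I_n) : val j \in iota 0 n by rewrite mem_iota add0n /=.
have rowE (i : 'I_nv) j (id_ : (i < d)%N) : arcmx nv ps i j = A (Ordinal id_) j.
  rewrite !mxE; have /andP [/allP /(_ i) + _] := chk j (jin j).
  by rewrite mem_iota /= add0n => /(_ id_) /eqP ->.
have lastE (i : 'I_nv) j : i = d :> nat -> arcmx nv ps i j = - \sum_k A k j.
  move=> iE; rewrite mxE iE; have /andP [_ /eqP ->] := chk j (jin j).
  rewrite sumzE rmorphN rmorph_sum; congr (- _).
  by apply: eq_bigr => k _; rewrite mxE.
apply: family_indep_eq_rel => c; rewrite sum_col.
apply: (iff_trans (sum_incidence cdb psN fE c)); split=> c0.
  apply/matrixP => i k; have iv : (i < nv)%N by rewrite nvE ltnW ?ltnS.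
  transitivity ((arcmx nv ps *m \col_j c j) (Ordinal iv) k).
    rewrite [LHS]mxE [RHS]mxE; apply: eq_bigr => j _.
    rewrite (rowE (Ordinal iv) j (ltn_ord i)).
    by congr (_ * _); congr (A _ _); apply: val_inj.
  by rewrite c0 !mxE.
apply/matrixP => i k; rewrite [k]ord1 [RHS]mxE mxE.
have c0E l : \sum_j A l j * c j = 0.
  transitivity ((A *m \col_j c j) l 0); last by rewrite c0 mxE.
  by rewrite [RHS]mxE; apply: eq_bigr => j _; congr (_ * _); rewrite mxE.
have [id_|di] := ltnP i d.
  rewrite -[RHS](c0E (Ordinal id_)); apply: eq_bigr => j _.
  by rewrite (rowE _ _ id_); congr (_ * _); rewrite mxE.
have iE : i = d :> nat by apply/eqP; rewrite eqn_leq di -ltnS -nvE ltn_ord.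
transitivity (- \sum_(l < d) \sum_j A l j * c j); last first.
  by rewrite big1 ?oppr0 // => l _; apply: c0E.
rewrite exchange_big -sumrN; apply: eq_bigr => j _ /=.
by rewrite lastE // -mulr_suml mulNr; congr (- (_ * _)); rewrite mxE.
Qed.

(* Over the integers, the rows of [T] are orthogonal to the vertex stars and,
   if [T c = 0], then [Q c] is a potential with coboundary [c]. *)
Definition cographic_check (Q P : seq (seq int)) : bool :=
  [&& edge_list_check,
  all (fun i => all (fun k => sumz n (fun j => entry T j i * arc (pj j) k) == 0)
    (iota 0 nv)) (iota 0 d) &
  all (fun j => all (fun l =>
      sumz nv (fun k => arc (pj j) k * entry Q k l)
      + sumz d (fun i => entry P j i * entry T l i) == (j == l)%:R)
    (iota 0 n)) (iota 0 n)].

(** The kernel of [A] is the space of coboundaries: [AB] gives one inclusion and [BQ] the other. So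
    a set is independent for [A] when it supports no nonzero coboundary, which by [dual_indepP] is
    coindependence in the cycle matroid. *)
Lemma cographic_isomorphic Q P : cographic_check Q P ->
  isomorphic (vector_matroid (colmx 'F_2 d T)) (dual (cycle_matroid G)).
Proof.
move=> /and3P [/and4P [psu psN pslt sT] /allP chk1 /allP chk2].
have [f fb fE] := edge_list cdb adjE psu psN pslt; have fi := bij_inj fb.
apply: isomorphic_trans (colmx_isomorphic sT) _; exists f; split=> // S.
pose B := arcmx nv ps.
pose Qm : 'M['F_2]_(nv, n) := \matrix_(k, l) (entry Q k l)%:~R.
pose Pm : 'M['F_2]_(n, d) := \matrix_(j, i) (entry P j i)%:~R.
have oin m (j : 'I_m) : val j \in iota 0 m by rewrite mem_iota add0n /=.
have AB : A *m B^T = 0.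
  apply/matrixP => i k; have /allP /(_ k (oin _ _)) /eqP := chk1 i (oin _ _).
  rewrite sumzE => /(congr1 (intmul (1 : 'F_2))); rewrite mulr0z rmorph_sum => z.
  rewrite [RHS]mxE -[RHS]z mxE.
  by apply: eq_bigr => j _; rewrite !mxE rmorphM.
have BQ : B^T *m Qm + Pm *m A = 1%:M.
  apply/matrixP => j l; have /allP /(_ l (oin _ _)) /eqP := chk2 j (oin _ _).
  rewrite !sumzE => /(congr1 (intmul (1 : 'F_2))).
  rewrite rmorphD !rmorph_sum rmorph_nat => z; rewrite [RHS]mxE -[RHS]z !mxE.
  by congr (_ + _); apply: eq_bigr => k _; rewrite !mxE rmorphM.
have iM : indep (cycle_matroid G) =1 family_indep (@incidence G).
  by move=> ?; apply: acyclicE.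
apply/(dual_indepP iM)/(family_indep_relP _ _) => [H c cS|H phi cphi].
  rewrite sum_col; set x := \col_j c j => Ax j.
  (* A relation [x] is the coboundary of the potential [Qm *m x]. *)
  have xE : B^T *m (Qm *m x) = x.
    by rewrite -[RHS]mul1mx -BQ mulmxDl -!mulmxA Ax mulmx0 addr0.
  have [phi phiE] := incidence_functional cdb psN fE (Qm *m x)^T.
  have {}phiE l : phi (incidence (f l)) = c l.
    rewrite phiE -/B; have -> : (Qm *m x)^T *m B = x^T.
      by apply: trmx_inj; rewrite trmx_mul !trmxK.
    by rewrite !mxE.
  have /H c0 : cut (@incidence G) phi \subset f @: S.
    apply/subsetP => e; have [g _ gK] := fb; rewrite -(gK e) inE phiE mem_imset //.
    by apply: contraR => /cS ->.
  by have := in_set0 (f j); rewrite -c0 inE phiE => /negbFE /eqP.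
have [y yE] := functional_incidence cdb psN fE phi.
have c0 : forall j, phi (incidence (f j)) = 0.
  apply: (H (fun j => phi (incidence (f j)))) => [j jS|].
    apply/eqP; apply: contraNT jS => pj0; rewrite -(mem_imset _ _ fi).
    by apply: (subsetP cphi); rewrite inE.
  rewrite sum_col; have -> : \col_j phi (incidence (f j)) = (y *m B)^T.
    by apply/matrixP => j k; rewrite !mxE yE [k]ord1 mxE.
  by rewrite trmx_mul mulmxA AB mul0mx.
apply/setP => e; have [g _ gK] := fb; rewrite -(gK e) !inE c0.
by rewrite eqxx.
Qed.

End GraphTarget.

(** * The listed matroids *)

Lemma ord_rel2 (n : nat) (r s : rel nat) :
  all (fun a => all (fun b => r a b == s a b) (iota 0 n)) (iota 0 n) ->
  forall x y : 'I_n, r x y = s x y.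
Proof.
move=> /allP H x y; have xin (z : 'I_n) : val z \in iota 0 n.
  by rewrite mem_iota add0n /=.
by have /allP /(_ y (xin y)) /eqP := H x (xin x).
Qed.

Definition edge_rel (ps : seq (nat * nat)) : rel nat :=
  fun a b => ((a, b) \in ps) || ((b, a) \in ps).

Definition complete_edges (n : nat) : seq (nat * nat) :=
  [seq (i, j) | j <- iota 0 n, i <- iota 0 j].

(** Cutting off the coordinate of the last vertex turns the edges at this vertex into the unit
    vectors. *)
Definition complete_vectors (d : nat) : seq (seq int) :=
  [seq mkseq (arc p) d | p <- complete_edges d.+1].

Lemma complete_isomorphic (d : nat) :
  all (fun a => all (fun b => (a != b) == edge_rel (complete_edges d.+1) a b)
    (iota 0 d.+1)) (iota 0 d.+1) ->
  graphic_check d d.+1 (complete_edges d.+1) (complete_vectors d) ->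
  isomorphic (vector_matroid (colmx 'F_2 d (complete_vectors d)))
    (cycle_matroid (complete_graph d.+1)).
Proof.
move=> chk; apply: (graphic_isomorphic (cd := (id : complete_graph d.+1 -> 'I_d.+1))).
  by exists id.
move=> x y; rewrite -[RHS](ord_rel2 chk) /= /sym_adj /= andbT.
by rewrite (inj_eq val_inj).
Qed.

Definition K33_edges : seq (nat * nat) :=
  [:: (0, 3); (0, 4); (0, 5); (1, 3); (1, 4); (1, 5); (2, 3); (2, 4); (2, 5)]%N.

(** Coefficients of each edge in the fundamental cycles of a spanning tree, here the union of the
    stars of 0 and 3. The four edges outside the tree get the unit vectors. *)
Definition K33_cycle_coords : seq (seq int) :=
  [:: [:: 1; 1; 1; 1];
     [:: -1; 0; -1; 0];
     [:: 0; -1; 0; -1];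
     [:: -1; -1; 0; 0];
     [:: 1; 0; 0; 0];
     [:: 0; 1; 0; 0];
     [:: 0; 0; -1; -1];
     [:: 0; 0; 1; 0];
     [:: 0; 0; 0; 1]]%Z.

(** The column of a tree edge marks the vertices on the side of its tail once the edge is removed;
    the other columns are zero. This integrates a coboundary along the tree. *)
Definition K33_potentials := vecs 9 0x1000140011000501014001500015.

(** Zero at the tree edges and a unit vector at each other edge, selecting its fundamental cycle. *)
Definition K33_lift := vecs 4 0x1401000040100000000.

Definition G53_edges : seq (nat * nat) :=
  [:: (0, 1); (1, 2); (0, 2); (0, 5); (1, 6); (2, 7);
      (3, 5); (3, 6); (3, 7); (4, 5); (4, 6); (4, 7)]%N.

(** Here the spanning tree omits the edges 0-2, 3-6, 3-7, 4-6 and 4-7. *)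
Definition G53_cycle_coords : seq (seq int) :=
  [:: [:: -1; -1; -1; -1; -1];
     [:: -1; 0; -1; 0; -1];
     [:: 1; 0; 0; 0; 0];
     [:: 0; 1; 1; 1; 1];
     [:: 0; -1; 0; -1; 0];
     [:: 0; 0; -1; 0; -1];
     [:: 0; -1; -1; 0; 0];
     [:: 0; 1; 0; 0; 0];
     [:: 0; 0; 1; 0; 0];
     [:: 0; 0; 0; -1; -1];
     [:: 0; 0; 0; 1; 0];
     [:: 0; 0; 0; 0; 1]]%Z.

Definition G53_potentials := vecs 12 0x1000140000444000505040505001505000540000544000545.

Definition G53_lift := vecs 5 0x1400400001001000000000000100000.

Definition G54_edges : seq (nat * nat) :=
  [:: (0, 1); (1, 2); (2, 3); (3, 4); (4, 5); (5, 6); (6, 7); (7, 0);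
      (0, 4); (1, 5); (2, 6); (3, 7)]%N.

(** Here the spanning tree is the path from 0 to 7 along the rim. It omits the edge 7-0, whose
    fundamental cycle is the whole rim, and the four rungs. *)
Definition G54_cycle_coords : seq (seq int) :=
  [:: [:: 1; -1; 0; 0; 0];
     [:: 1; -1; -1; 0; 0];
     [:: 1; -1; -1; -1; 0];
     [:: 1; -1; -1; -1; -1];
     [:: 1; 0; -1; -1; -1];
     [:: 1; 0; 0; -1; -1];
     [:: 1; 0; 0; 0; -1];
     [:: 1; 0; 0; 0; 0];
     [:: 0; 1; 0; 0; 0];
     [:: 0; 0; 1; 0; 0];
     [:: 0; 0; 0; 1; 0];
     [:: 0; 0; 0; 0; 1]]%Z.

Definition G54_potentials := vecs 12 0x1000000001000001400001500001540001550001554001555.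

Definition G54_lift := vecs 5 0x1400400400400400000000000000000.

(** The binary columns of [R10], with signs in the last two that make the rational matrix totally
    unimodular. *)
Definition R10_vectors : seq (seq int) :=
  [:: [:: 1; 0; 0; 0; 0];
     [:: 0; 1; 0; 0; 0];
     [:: 0; 0; 1; 0; 0];
     [:: 0; 0; 0; 1; 0];
     [:: 0; 0; 0; 0; 1];
     [:: 1; 1; 0; 0; 1];
     [:: 1; 1; 1; 0; 0];
     [:: 0; 1; 1; 1; 0];
     [:: 0; 0; 1; 1; -1];
     [:: 1; 0; 0; -1; 1]]%Z.

Lemma K33_isomorphic :
  isomorphic (vector_matroid (colmx 'F_2 4 K33_cycle_coords)) (dual (cycle_matroid K33)).
Proof.
apply: (cographic_isomorphic (cd := (@unsplit 3 3 : K33 -> 'I_(3 + 3)))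
          (ps := K33_edges) _ _ (Q := K33_potentials) (P := K33_lift)).
- by exists (@split 3 3); [apply: unsplitK|apply: splitK].
- by case=> [[[|[|[|a]]] ha]|[[|[|[|a]]] ha]] //; case=> [[[|[|[|b]]] hb]|[[|[|[|b]]] hb]].
by vm_compute.
Qed.

Lemma G53_isomorphic :
  isomorphic (vector_matroid (colmx 'F_2 5 G53_cycle_coords)) (dual (cycle_matroid G53)).
Proof.
apply: (cographic_isomorphic (cd := (id : G53 -> 'I_8))
          (ps := G53_edges) _ _ (Q := G53_potentials) (P := G53_lift)).
- by exists id.
- move=> x y; apply: (ord_rel2 (s := edge_rel G53_edges)
    (r := fun a b => (a != b) && (edge_rel G53_edges a b))).
  by vm_compute.
by vm_compute.
Qed.

Lemma G54_isomorphic :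
  isomorphic (vector_matroid (colmx 'F_2 5 G54_cycle_coords)) (dual (cycle_matroid G54)).
Proof.
apply: (cographic_isomorphic (cd := (id : G54 -> 'I_8))
          (ps := G54_edges) _ _ (Q := G54_potentials) (P := G54_lift)).
- by exists id.
- pose r a b := ((b == (a + 1) %% 8) || (b == (a + 4) %% 8))%N.
  move=> x y; apply: (ord_rel2 (s := edge_rel G54_edges)
    (r := fun a b => (a != b) && (r a b || r b a))).
  by vm_compute.
by vm_compute.
Qed.

Lemma R10_isomorphic : isomorphic (vector_matroid (colmx 'F_2 5 R10_vectors)) R10.
Proof.
exists id; split; first by exists id.
move=> S; rewrite imset_id; congr (indep (vector_matroid _) S).
apply/matrixP => i j.
pose r a b := odd (nth 0%N (nth [::] R10_rows b) a).
pose s a b := odd `|entry R10_vectors a b|%N.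
have chk : all (fun a => all (fun b => r a b == s a b) (iota 0 5)) (iota 0 10).
  by vm_compute.
have jin : val j \in iota 0 10 by rewrite mem_iota add0n ltn_ord.
have /allP /(_ (val i)) := allP chk _ jin; rewrite mem_iota add0n ltn_ord.
by move=> /(_ isT) /eqP e; rewrite !mxE intr_F2 [LHS]natr_F2 -[odd _ in LHS]/(r _ _) e.
Qed.

(** * Targets and certificates in ranks 3, 4 and 5 *)

Definition rank3_targets := [:: complete_vectors 3].
Definition rank4_targets := [:: complete_vectors 4; K33_cycle_coords].
Definition rank5_targets :=
  [:: complete_vectors 5; G53_cycle_coords; G54_cycle_coords; R10_vectors].

Definition rank3_cert : seq node :=
  [:: Node 0x50101 [::]%positive 0 0x70111 0x71101
        [:: Child 0x54 0x50101 0; Child 0x74 0x70101 0; Child 0x51 0x50044 0; Child 0x45 0x44050 0;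
           Child 0x55 0x50101 1; Child 0x75 0x70101 1; Child 0x5d 0x50301 1];
      Node 0x1510101 [:: 0x50d01]%positive 0 0x70101 0x70101
        [:: Child 0x71 0x50101 1; Child 0x45 0x4cc01 1; Child 0x55 0x70d01 1; Child 0x7d 0x50701 1];
      Node 0x1550101 [:: 0x50d31; 0x4470d]%positive 0 0x50331 0x51301
        [:: Child 0x54 0x70d01 0];
      Node 0x71510101 [:: 0x7411d; 0x70111]%positive 0 0x50301 0x50301
        [:: Child 0x7d 0x50101 0];
      Node 0x1f71510101 [:: 0x5dd11; 0x4c705]%positive 0 0x44701 0x54401
        [::]].

(** Small configurations are all sent to the graphic target. Only the last node, with nine vectors,
    needs [K33_cycle_coords]. *)
Definition rank4_cert : seq node :=
  [:: Node 0x140100401 [::]%positive 0 0x1c0304411 0x1c4310401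
        [:: Child 0x150 0x140100401 0; Child 0x1d0 0x1c0100401 0; Child 0x144 0x140041001 0;
           Child 0x114 0x110044001 0; Child 0x154 0x140100401 1; Child 0x1d4 0x1c0100401 1;
           Child 0x134 0x130044001 0; Child 0x174 0x140300401 1; Child 0x1f4 0x1c0300401 1;
           Child 0x141 0x140011004 0; Child 0x1c1 0x1c0011004 0; Child 0x111 0x110014004 0;
           Child 0x151 0x140100104 1; Child 0x1d1 0x1c0100104 1; Child 0x171 0x140300104 1;
           Child 0x1f1 0x1c0300104 1; Child 0x105 0x104014010 0; Child 0x145 0x140040110 1;
           Child 0x1c5 0x1c0040110 1; Child 0x115 0x110040140 1; Child 0x155 0x140100401 2;
           Child 0x1d5 0x1c0100401 2; Child 0x135 0x130040140 1; Child 0x175 0x140300401 2;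
           Child 0x1f5 0x1c0300401 2; Child 0x1cd 0x1c00c0110 1; Child 0x11d 0x1100c0140 1;
           Child 0x15d 0x140100c01 2; Child 0x1dd 0x1c0100c01 2; Child 0x1fd 0x1c0300c01 2];
      Node 0x15040100401 [:: 0x140d00401]%positive 0 0x1403004d1 0x141310401
        [:: Child 0x144 0x140100401 2; Child 0x1c4 0x1c0300401 2; Child 0x114 0x110400401 2;
           Child 0x154 0x140700401 2; Child 0x134 0x130c00401 2; Child 0x1f4 0x1c0d00401 2;
           Child 0x1c1 0x1c0300104 2; Child 0x111 0x110400104 2; Child 0x151 0x140700104 2;
           Child 0x1f1 0x1c0d00104 2; Child 0x105 0x140100401 3; Child 0x145 0x140100401 4;
           Child 0x1c5 0x1c0300401 4; Child 0x115 0x110400401 4; Child 0x155 0x140700401 4;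
           Child 0x135 0x130c00401 4; Child 0x1f5 0x1c0d00401 4; Child 0x1cd 0x1c0300c01 4;
           Child 0x11d 0x110400c01 4; Child 0x15d 0x140700c01 4; Child 0x1fd 0x1c0d00c01 4];
      Node 0x15440100401 [:: 0x140d0c401; 0x110703401]%positive 0 0x14030c401 0x144300401
        [:: Child 0x150 0x140700401 1; Child 0x141 0x140011004 3; Child 0x1c1 0x140031004 3;
           Child 0x151 0x140100401 4; Child 0x131 0x110034004 3; Child 0x1f1 0x1c0300c01 4;
           Child 0x105 0x104014010 3; Child 0x145 0x140704c01 4; Child 0x115 0x110d01c01 4;
           Child 0x155 0x1c003d0c4 3; Child 0x13d 0x130703401 4; Child 0x1fd 0x1c001d0c4 3];
      Node 0x15540100401 [:: 0x140d0c4c1; 0x110703431;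
        0x1044c1c0d]%positive 0 0x1c0104c31 0x1cc110c01
        [:: Child 0x150 0x140700401 2; Child 0x114 0x1101c4001 2; Child 0x154 0x1c003d0c4 2;
           Child 0x141 0x140431004 2; Child 0x151 0x1c00cd0c1 2];
      Node 0x1445040100401 [:: 0x17010d401; 0x14010c401]%positive 0 0x1c0100401 0x1c0100401
        [:: Child 0x154 0x140100401 3; Child 0x1c1 0x140100401 4; Child 0x111 0x140100401 5;
           Child 0x151 0x1d0100c01 5; Child 0x1f1 0x170300401 5; Child 0x105 0x140041001 5;
           Child 0x145 0x1c4043001 5; Child 0x155 0x140100401 6; Child 0x135 0x170300401 6;
           Child 0x1cd 0x14c0c1001 5; Child 0x11d 0x1d0100c01 6; Child 0x1fd 0x1c0300c01 6];
      Node 0x1055040100401 [:: 0x10440d00d]%positive 0 0x1c0100c01 0x1c0100c01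
        [:: Child 0x144 0x140041001 4; Child 0x154 0x140047001 4; Child 0x134 0x13004c001 4;
           Child 0x1f4 0x1c004d001 4; Child 0x1c1 0x1c0013004 4; Child 0x111 0x110014004 4;
           Child 0x151 0x140017004 4; Child 0x1f1 0x1c001d004 4; Child 0x145 0x1c00c300d 4;
           Child 0x1c5 0x1400c100d 4; Child 0x115 0x1300cc00d 4; Child 0x155 0x1c00cd00d 4;
           Child 0x135 0x1100c400d 4; Child 0x1f5 0x1400c700d 4];
      Node 0x1455040100401 [:: 0x1044cd40d; 0x17010d4d1;
        0x14010c4c1]%positive 0 0x140300cd1 0x141310c01
        [:: Child 0x144 0x1c4043001 3; Child 0x154 0x140700401 4; Child 0x134 0x170400401 4;
           Child 0x151 0x140700104 4; Child 0x155 0x11c0c4c0d 4];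
      Node 0x1515440100401 [:: 0x14c04d0c5; 0x101137035; 0x140d004c1;
        0x110703401]%positive 0 0x1c0700401 0x1f0300401
        [:: Child 0x144 0x140104c01 3; Child 0x141 0x140104304 3; Child 0x155 0x1c0c4c1d0 3];
      Node 0x154445040100401 [:: 0x1d4704c01; 0x110703401]%positive 0 0x130d00401 0x1f0c00401
        [:: Child 0x1c1 0x140100401 3; Child 0x111 0x13404c401 3; Child 0x131 0x11c0c4c01 3;
           Child 0x1f1 0x140700401 3; Child 0x105 0x11c10d001 3; Child 0x145 0x1c030c401 3;
           Child 0x155 0x1c0d0c401 3; Child 0x1cd 0x140104c01 3; Child 0x1fd 0x140704c01 3];
      Node 0x1c1445040100401 [:: 0x1d404107d; 0x10141d304; 0x1c404104d;
        0x140d00401]%positive 0 0x140300c01 0x140300c01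
        [:: Child 0x154 0x140100401 2; Child 0x1f1 0x1c0300104 2; Child 0x1cd 0x1c00c0110 2];
      Node 0x111445040100401 [:: 0x1d4044c7d; 0x1d0400471;
        0x110400431]%positive 0 0x140300c01 0x140300c01
        [:: Child 0x154 0x13404c401 1; Child 0x151 0x1c1013104 1; Child 0x155 0x140100401 2;
           Child 0x1cd 0x113400304 2; Child 0x11d 0x14c100c01 2];
      Node 0x155445040100401 [:: 0x1d4704c7d; 0x101431307;
        0x110703431]%positive 0 0x130d04c01 0x1fccc0c01
        [:: Child 0x111 0x140100401 1; Child 0x151 0x1d4100401 1];
      Node 0x1c154445040100401 [:: 0x101d7714d; 0x1d4704c01; 0x1c0100441;
        0x110703401]%positive 0 0x110700c01 0x150400c01
        [:: Child 0x111 0x140100401 1; Child 0x1cd 0x17c0c3001 1];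
      Node 0x15511445040100401 [:: 0x1d4704c7d; 0x101431307; 0x110703431;
        0x1d0400471]%positive 0 0x1700cc401 0x130fcf001
        [:: Child 0x105 0x140100401 1];
      Node 0x111c154445040100401 [:: 0x14dc4d771; 0x11c044c35; 0x17010d401;
        0x1c0100441]%positive 0 0x130044c01 0x130444001
        [::];
      Node 0x1055511445040100401 [:: 0x1d4704c7d; 0x101431307; 0x110703431; 0x1d0400471;
        0x1c440104d; 0x10410403d]%positive 1 0x140100401 0x140100401
        [::]].

(** The targets [G54_cycle_coords] and [R10_vectors] serve one node each, whose configuration has as
    many vectors as the target; a few nodes go to [G53_cycle_coords] and all others to the graphic
    target. At a node without children every candidate is excluded or lies in the image. *)
Definition rank5_cert : seq node :=
  [:: Node 0x5001001001001 [::]%positive 0 0x7003013011011 0x7313103101001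
        [:: Child 0x540 0x5001001001001 0; Child 0x740 0x7001001001001 0;
           Child 0x710 0x7000404001001 0; Child 0x450 0x4400410001001 0;
           Child 0x550 0x5001001001001 1; Child 0x750 0x7001001001001 1;
           Child 0x4d0 0x4c00410001001 0; Child 0x5d0 0x5003001001001 1;
           Child 0x7d0 0x7003001001001 1; Child 0x504 0x5000104004001 0;
           Child 0x704 0x7000104004001 0; Child 0x444 0x4400110004001 0;
           Child 0x544 0x5001000404001 1; Child 0x744 0x7001000404001 1;
           Child 0x5c4 0x5003000404001 1; Child 0x7c4 0x7003000404001 1;
           Child 0x414 0x4100110010001 0; Child 0x514 0x5000400410001 1;
           Child 0x714 0x7000400410001 1; Child 0x454 0x4400400440001 1;
           Child 0x554 0x5001001001001 2; Child 0x754 0x7001001001001 2;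
           Child 0x4d4 0x4c00400440001 1; Child 0x5d4 0x5003001001001 2;
           Child 0x7d4 0x7003001001001 2; Child 0x434 0x4300110010001 0;
           Child 0x534 0x5000c00410001 1; Child 0x734 0x7000c00410001 1;
           Child 0x474 0x4400c00440001 1; Child 0x574 0x5001003001001 2;
           Child 0x774 0x7001003001001 2; Child 0x4f4 0x4c00c00440001 1;
           Child 0x5f4 0x5003003001001 2; Child 0x7f4 0x7003003001001 2;
           Child 0x501 0x5000044004004 0; Child 0x701 0x7000044004004 0;
           Child 0x441 0x4400050004004 0; Child 0x541 0x5001000104004 1;
           Child 0x741 0x7001000104004 1; Child 0x4c1 0x4c00050004004 0;
           Child 0x5c1 0x5003000104004 1; Child 0x7c1 0x7003000104004 1;
           Child 0x411 0x4100050010004 0; Child 0x511 0x5000400110004 1;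
           Child 0x711 0x7000400110004 1; Child 0x451 0x4400400140004 1;
           Child 0x551 0x5001001000404 2; Child 0x751 0x7001001000404 2;
           Child 0x4d1 0x4c00400140004 1; Child 0x5d1 0x5003001000404 2;
           Child 0x7d1 0x7003001000404 2; Child 0x531 0x5000c00110004 1;
           Child 0x471 0x4400c00140004 1; Child 0x571 0x5001003000404 2;
           Child 0x771 0x7001003000404 2; Child 0x4f1 0x4c00c00140004 1;
           Child 0x5f1 0x5003003000404 2; Child 0x7f1 0x7003003000404 2;
           Child 0x405 0x4040050010010 0; Child 0x505 0x5000100110010 1;
           Child 0x705 0x7000100110010 1; Child 0x445 0x4400100140010 1;
           Child 0x545 0x5001000400410 2; Child 0x745 0x7001000400410 2;
           Child 0x4c5 0x4c00100140010 1; Child 0x5c5 0x5003000400410 2;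
           Child 0x7c5 0x7003000400410 2; Child 0x415 0x4100100140040 1;
           Child 0x515 0x5000400400440 2; Child 0x715 0x7000400400440 2;
           Child 0x455 0x4400400400500 2; Child 0x555 0x5001001001001 3;
           Child 0x755 0x7001001001001 3; Child 0x4d5 0x4c00400400500 2;
           Child 0x5d5 0x5003001001001 3; Child 0x7d5 0x7003001001001 3;
           Child 0x435 0x4300100140040 1; Child 0x535 0x5000c00400440 2;
           Child 0x735 0x7000c00400440 2; Child 0x475 0x4400c00400500 2;
           Child 0x575 0x5001003001001 3; Child 0x775 0x7001003001001 3;
           Child 0x4f5 0x4c00c00400500 2; Child 0x5f5 0x5003003001001 3;
           Child 0x7f5 0x7003003001001 3; Child 0x50d 0x5000300110010 1;
           Child 0x70d 0x7000300110010 1; Child 0x54d 0x5001000c00410 2;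
           Child 0x74d 0x7001000c00410 2; Child 0x4cd 0x4c00300140010 1;
           Child 0x5cd 0x5003000c00410 2; Child 0x7cd 0x7003000c00410 2;
           Child 0x41d 0x4100300140040 1; Child 0x51d 0x5000400c00440 2;
           Child 0x71d 0x7000400c00440 2; Child 0x45d 0x4400400c00500 2;
           Child 0x55d 0x5001001003001 3; Child 0x75d 0x7001001003001 3;
           Child 0x4dd 0x4c00400c00500 2; Child 0x5dd 0x5003001003001 3;
           Child 0x7dd 0x7003001003001 3; Child 0x53d 0x5000c00c00440 2;
           Child 0x57d 0x5001003003001 3; Child 0x4fd 0x4c00c00c00500 2;
           Child 0x5fd 0x5003003003001 3; Child 0x7fd 0x7003003003001 3];
      Node 0x1501001001001001 [:: 0x500d001001001]%positive 0 0x50030030d1011 0x5043103101001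
        [:: Child 0x510 0x5001001001001 3; Child 0x710 0x7003001001001 3;
           Child 0x450 0x4404001001001 3; Child 0x550 0x5007001001001 3;
           Child 0x4d0 0x4c0c001001001 3; Child 0x7d0 0x700d001001001 3;
           Child 0x704 0x7003000404001 3; Child 0x444 0x4404000404001 3;
           Child 0x544 0x5007000404001 3; Child 0x7c4 0x700d000404001 3;
           Child 0x414 0x5001001001001 4; Child 0x514 0x5001001001001 5;
           Child 0x714 0x7003001001001 5; Child 0x454 0x4404001001001 5;
           Child 0x554 0x5007001001001 5; Child 0x4d4 0x4c0c001001001 5;
           Child 0x7d4 0x700d001001001 5; Child 0x434 0x5001003001001 4;
           Child 0x534 0x5001003001001 5; Child 0x734 0x7003003001001 5;
           Child 0x474 0x4404003001001 5; Child 0x574 0x5007003001001 5;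
           Child 0x4f4 0x4c0c003001001 5; Child 0x7f4 0x700d003001001 5;
           Child 0x501 0x5001000104004 3; Child 0x701 0x7003000104004 3;
           Child 0x441 0x4404000104004 3; Child 0x541 0x5007000104004 3;
           Child 0x4c1 0x4c0c000104004 3; Child 0x7c1 0x700d000104004 3;
           Child 0x411 0x5001001000404 4; Child 0x511 0x5001001000404 5;
           Child 0x711 0x7003001000404 5; Child 0x451 0x4404001000404 5;
           Child 0x551 0x5007001000404 5; Child 0x4d1 0x4c0c001000404 5;
           Child 0x7d1 0x700d001000404 5; Child 0x531 0x5001003000404 5;
           Child 0x731 0x7003003000404 5; Child 0x471 0x4404003000404 5;
           Child 0x571 0x5007003000404 5; Child 0x4f1 0x4c0c003000404 5;
           Child 0x7f1 0x700d003000404 5; Child 0x405 0x5001000400410 4;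
           Child 0x505 0x5001000400410 5; Child 0x705 0x7003000400410 5;
           Child 0x445 0x4404000400410 5; Child 0x545 0x5007000400410 5;
           Child 0x4c5 0x4c0c000400410 5; Child 0x7c5 0x700d000400410 5;
           Child 0x415 0x5001001001001 6; Child 0x515 0x5001001001001 7;
           Child 0x715 0x7003001001001 7; Child 0x455 0x4404001001001 7;
           Child 0x555 0x5007001001001 7; Child 0x4d5 0x4c0c001001001 7;
           Child 0x7d5 0x700d001001001 7; Child 0x435 0x5001003001001 6;
           Child 0x535 0x5001003001001 7; Child 0x735 0x7003003001001 7;
           Child 0x475 0x4404003001001 7; Child 0x575 0x5007003001001 7;
           Child 0x4f5 0x4c0c003001001 7; Child 0x7f5 0x700d003001001 7;
           Child 0x50d 0x5001000c00410 5; Child 0x54d 0x5007000c00410 5;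
           Child 0x4cd 0x4c0c000c00410 5; Child 0x7cd 0x700d000c00410 5;
           Child 0x41d 0x5001001003001 6; Child 0x51d 0x5001001003001 7;
           Child 0x71d 0x7003001003001 7; Child 0x45d 0x4404001003001 7;
           Child 0x55d 0x5007001003001 7; Child 0x4dd 0x4c0c001003001 7;
           Child 0x7dd 0x700d001003001 7; Child 0x53d 0x5001003003001 7;
           Child 0x57d 0x5007003003001 7; Child 0x4fd 0x4c0c003003001 7;
           Child 0x7fd 0x700d003003001 7];
      Node 0x1541001001001001 [:: 0x500d031001001;
        0x440700d001001]%positive 0 0x70010130010d1 0x7311043101001
        [:: Child 0x540 0x5007001001001 2; Child 0x504 0x5000104004001 4;
           Child 0x704 0x5000304004001 4; Child 0x444 0x4400110004001 4;
           Child 0x544 0x5001001001001 7; Child 0x4c4 0x4400310004001 4;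
           Child 0x7c4 0x7003003001001 7; Child 0x414 0x4100110010001 4;
           Child 0x514 0x5007013001001 7; Child 0x454 0x440d007001001 7;
           Child 0x554 0x70003340c4001 4; Child 0x434 0x4100310010001 4;
           Child 0x734 0x700d031001001 7; Child 0x4f4 0x4c0700d001001 7;
           Child 0x7f4 0x70001340c4001 4; Child 0x501 0x5000044004004 4;
           Child 0x701 0x50000c4004004 4; Child 0x541 0x5001001000404 7;
           Child 0x4c1 0x44000d0004004 4; Child 0x7c1 0x7003003000404 7;
           Child 0x411 0x4100050010004 4; Child 0x511 0x5007013000404 7;
           Child 0x451 0x440d007000404 7; Child 0x551 0x70000f40c4004 4;
           Child 0x4f1 0x4c0700d000404 7; Child 0x7f1 0x70000740c4004 4;
           Child 0x405 0x4040050010010 5; Child 0x505 0x5001001001001 8;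
           Child 0x705 0x7003003001001 8; Child 0x445 0x4404001001001 8;
           Child 0x545 0x5001001001001 9; Child 0x4c5 0x4c0c003001001 8;
           Child 0x7c5 0x7003003001001 9; Child 0x415 0x4104004001001 8;
           Child 0x515 0x5007013001001 9; Child 0x455 0x440d007001001 9;
           Child 0x555 0x5007013001001 8; Child 0x435 0x430c00c001001 8;
           Child 0x735 0x700d031001001 9; Child 0x4f5 0x4c0700d001001 9;
           Child 0x7f5 0x700d031001001 8; Child 0x50d 0x5001001003001 8;
           Child 0x70d 0x7003003003001 8; Child 0x54d 0x5001001003001 9;
           Child 0x4cd 0x4c0c003003001 8; Child 0x7cd 0x7003003003001 9;
           Child 0x41d 0x4104004003001 8; Child 0x51d 0x5007013003001 9;
           Child 0x45d 0x440d007003001 9; Child 0x55d 0x5007013003001 8;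
           Child 0x4fd 0x4c0700d003001 9; Child 0x7fd 0x700d031003001 8];
      Node 0x1551001001001001 [:: 0x500d0310c1001; 0x440700d031001;
        0x4104c0700d001]%positive 0 0x7001013031001 0x7301103001001
        [:: Child 0x540 0x5007001001001 3; Child 0x450 0x4401c10001001 3;
           Child 0x550 0x70003340c4001 3; Child 0x504 0x5004304004001 3;
           Child 0x544 0x7000c340c1001 3; Child 0x501 0x5000044004004 5;
           Child 0x701 0x50000c4004004 5; Child 0x441 0x4400050004004 5;
           Child 0x541 0x5001000104004 8; Child 0x4c1 0x44000d0004004 5;
           Child 0x7c1 0x5001000304004 8; Child 0x451 0x4400400140004 8;
           Child 0x551 0x700c1003d0310 8; Child 0x431 0x41000d0010004 5;
           Child 0x731 0x5000400310004 8; Child 0x4f1 0x4400400340004 8;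
           Child 0x7f1 0x700c1001d0310 8; Child 0x405 0x4040050010010 5;
           Child 0x505 0x5000100110010 8; Child 0x445 0x4400100140010 8;
           Child 0x545 0x700c4003d0304 8; Child 0x415 0x4100100140040 8;
           Child 0x515 0x700d0003c4304 8; Child 0x455 0x4c070003340c4 8;
           Child 0x555 0x70000f40c4304 5; Child 0x70d 0x5000100310010 8;
           Child 0x7cd 0x700c4001d0304 8; Child 0x43d 0x4100100340040 8;
           Child 0x73d 0x700d0001c4304 8; Child 0x4fd 0x4c070001340c4 8;
           Child 0x7fd 0x70000740c4304 5];
      Node 0x1555001001001001 [:: 0x500d0310c1301; 0x440700d0310c1; 0x4104c0700d031;
        0x4044304c0700d]%positive 0 0x5003031013031 0x5113301103001
        [:: Child 0x540 0x5007001001001 4; Child 0x450 0x4401c10001001 4;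
           Child 0x550 0x5007013001001 6; Child 0x504 0x5004304004001 4;
           Child 0x544 0x5007010c04001 6; Child 0x414 0x4100710010001 4;
           Child 0x514 0x5004c10c10001 6; Child 0x454 0x4401c04c40001 6;
           Child 0x554 0x70000f40c4304 4; Child 0x501 0x50040c4004004 4;
           Child 0x441 0x44010d0004004 4; Child 0x541 0x7000c00cd0301 6;
           Child 0x451 0x4c0c000c340c1 6; Child 0x551 0x70003340c4301 4;
           Child 0x505 0x70030030c1301 6; Child 0x545 0x7000c340c1301 4];
      Node 0x510501001001001001 [:: 0x5c01035001001;
        0x5001031001001]%positive 0 0x5003003001351 0x5013043101001
        [:: Child 0x550 0x5001001001001 7; Child 0x504 0x5001001001001 8;
           Child 0x704 0x7003003001001 8; Child 0x444 0x5001001001001 9;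
           Child 0x544 0x7401003001001 9; Child 0x4c4 0x7003003001001 9;
           Child 0x7c4 0x5c03001001001 9; Child 0x414 0x5000404001001 9;
           Child 0x514 0x710040c001001 9; Child 0x554 0x5001001001001 10;
           Child 0x4d4 0x5c03001001001 10; Child 0x434 0x7000c0c001001 9;
           Child 0x734 0x5300c04001001 9; Child 0x474 0x7401003001001 10;
           Child 0x7f4 0x7003003001001 10; Child 0x701 0x7003003000404 8;
           Child 0x441 0x5001001000404 9; Child 0x541 0x7401003000404 9;
           Child 0x7c1 0x5c03001000404 9; Child 0x411 0x5000404000404 9;
           Child 0x511 0x710040c000404 9; Child 0x551 0x5001001000404 10;
           Child 0x4d1 0x5c03001000404 10; Child 0x731 0x5300c04000404 9;
           Child 0x471 0x7401003000404 10; Child 0x7f1 0x7003003000404 10;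
           Child 0x405 0x5001001001001 11; Child 0x505 0x5001001001001 12;
           Child 0x705 0x7003003001001 12; Child 0x445 0x5001001001001 13;
           Child 0x545 0x7401003001001 13; Child 0x4c5 0x7003003001001 13;
           Child 0x7c5 0x5c03001001001 13; Child 0x415 0x5000404001001 13;
           Child 0x515 0x710040c001001 13; Child 0x555 0x5001001001001 14;
           Child 0x4d5 0x5c03001001001 14; Child 0x435 0x7000c0c001001 13;
           Child 0x735 0x5300c04001001 13; Child 0x475 0x7401003001001 14;
           Child 0x7f5 0x7003003001001 14; Child 0x70d 0x7003003003001 12;
           Child 0x44d 0x5001001003001 13; Child 0x54d 0x7401003003001 13;
           Child 0x7cd 0x5c03001003001 13; Child 0x41d 0x5000404003001 13;
           Child 0x51d 0x710040c003001 13; Child 0x55d 0x5001001003001 14;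
           Child 0x4dd 0x5c03001003001 14; Child 0x73d 0x5300c04003001 13;
           Child 0x47d 0x7401003003001 14; Child 0x7fd 0x7003003003001 14];
      Node 0x414501001001001001 [:: 0x410403400d001]%positive 0 0x5003003001341 0x5013043001001
        [:: Child 0x510 0x5000404001001 8; Child 0x710 0x700040c001001 8;
           Child 0x450 0x4400410001001 8; Child 0x550 0x500041c001001 8;
           Child 0x4d0 0x4c00430001001 8; Child 0x7d0 0x7000434001001 8;
           Child 0x504 0x5000104004001 8; Child 0x704 0x700010c004001 8;
           Child 0x444 0x4400110004001 8; Child 0x544 0x500011c004001 8;
           Child 0x4c4 0x4c00130004001 8; Child 0x7c4 0x7000134004001 8;
           Child 0x514 0x7000c0c00d001 8; Child 0x714 0x5000c0400d001 8;
           Child 0x454 0x4c00c3000d001 8; Child 0x554 0x7000c3400d001 8;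
           Child 0x4d4 0x4400c1000d001 8; Child 0x7d4 0x5000c1c00d001 8;
           Child 0x701 0x7003000104004 10; Child 0x441 0x4404000104004 10;
           Child 0x541 0x5007000104004 10; Child 0x7c1 0x700d000104004 10;
           Child 0x711 0x5001001001001 14; Child 0x451 0x4c0c001001001 14;
           Child 0x551 0x700d001001001 14; Child 0x7d1 0x5007001001001 14;
           Child 0x431 0x4300300140040 10; Child 0x531 0x7003003003001 14;
           Child 0x731 0x5001003003001 14; Child 0x471 0x4c0c003003001 14;
           Child 0x571 0x700d003003001 14; Child 0x4f1 0x4404003003001 14;
           Child 0x7f1 0x5007003003001 14; Child 0x405 0x4040400140040 10;
           Child 0x505 0x7003000404001 14; Child 0x705 0x5001000404001 14;
           Child 0x445 0x4c0c000404001 14; Child 0x545 0x700d000404001 14;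
           Child 0x4c5 0x4404000404001 14; Child 0x7c5 0x5007000404001 14;
           Child 0x415 0x4100700140040 10; Child 0x515 0x7003001007001 14;
           Child 0x715 0x5001001007001 14; Child 0x455 0x4c0c001007001 14;
           Child 0x555 0x700d001007001 14; Child 0x4d5 0x4404001007001 14;
           Child 0x7d5 0x5007001007001 14; Child 0x70d 0x5001000c0c001 14;
           Child 0x44d 0x4c0c000c0c001 14; Child 0x54d 0x700d000c0c001 14;
           Child 0x7cd 0x5007000c0c001 14; Child 0x43d 0x4300d00140040 10;
           Child 0x53d 0x700300300d001 14; Child 0x73d 0x500100300d001 14;
           Child 0x47d 0x4c0c00300d001 14; Child 0x57d 0x700d00300d001 14;
           Child 0x4fd 0x440400300d001 14; Child 0x7fd 0x500700300d001 14];
      Node 0x514501001001001001 [:: 0x4104c3500d001; 0x5c010350d1001;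
        0x50010310c1001]%positive 0 0x50030030d1001 0x5043103001001
        [:: Child 0x510 0x710040c001001 7; Child 0x550 0x5007001001001 8;
           Child 0x4d0 0x5c04001001001 8; Child 0x544 0x5007000404001 8;
           Child 0x554 0x4700c1300d001 8; Child 0x501 0x5001000104004 10;
           Child 0x701 0x5001000304004 10; Child 0x441 0x4404000104004 11;
           Child 0x541 0x4c07000304004 11; Child 0x4c1 0x4404000304004 11;
           Child 0x7c1 0x4c07000104004 11; Child 0x511 0x5001001001001 14;
           Child 0x551 0x5001001001001 15; Child 0x4d1 0x5c03001001001 15;
           Child 0x431 0x7003001000c04 13; Child 0x731 0x7003003003001 14;
           Child 0x471 0x7401003003001 15; Child 0x7f1 0x7003003003001 15;
           Child 0x405 0x7003000400410 13; Child 0x505 0x5001000404001 14;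
           Child 0x545 0x5001000404001 15; Child 0x4c5 0x5c03000404001 15;
           Child 0x415 0x7103001007001 14; Child 0x515 0x7103003000c34 13;
           Child 0x555 0x7501001007001 15; Child 0x4d5 0x7103001007001 15;
           Child 0x7cd 0x7003000c0c001 15; Child 0x43d 0x530100300d001 14;
           Child 0x73d 0x7103003000434 13; Child 0x47d 0x530100300d001 15;
           Child 0x7fd 0x5f0300300d001 15];
      Node 0x415501001001001001 [:: 0x410403400d031;
        0x404400400700d]%positive 0 0x7001001003031 0x7001001103001
        [:: Child 0x510 0x5000404001001 10; Child 0x710 0x700040c001001 10;
           Child 0x450 0x4400410001001 10; Child 0x550 0x500041c001001 10;
           Child 0x4d0 0x4c00430001001 10; Child 0x7d0 0x7000434001001 10;
           Child 0x504 0x5000104004001 10; Child 0x544 0x500011c004001 10;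
           Child 0x4c4 0x4c00130004001 10; Child 0x7c4 0x7000134004001 10;
           Child 0x414 0x4100700140040 8; Child 0x514 0x7103001007001 13;
           Child 0x714 0x5101001007001 13; Child 0x454 0x4d0c001007001 13;
           Child 0x554 0x710d001007001 13; Child 0x4d4 0x4504001007001 13;
           Child 0x7d4 0x5107001007001 13; Child 0x701 0x700004c004004 10;
           Child 0x441 0x4400050004004 10; Child 0x541 0x500005c004004 10;
           Child 0x7c1 0x7000074004004 10; Child 0x711 0x7303003003031 13;
           Child 0x451 0x4704003003031 13; Child 0x551 0x5307003003031 13;
           Child 0x7d1 0x730d003003031 13; Child 0x505 0x50c1000c0c00d 13;
           Child 0x705 0x70c3000c0c00d 13; Child 0x445 0x44c4000c0c00d 13;
           Child 0x545 0x50c7000c0c00d 13; Child 0x4c5 0x4ccc000c0c00d 13;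
           Child 0x7c5 0x70cd000c0c00d 13; Child 0x515 0x7000c0c00d031 10;
           Child 0x715 0x5000c0400d031 10; Child 0x455 0x4c00c3000d031 10;
           Child 0x555 0x7000c3400d031 10; Child 0x4d5 0x4400c1000d031 10;
           Child 0x7d5 0x5000c1c00d031 10];
      Node 0x515501001001001001 [:: 0x4104c3500d031; 0x404433440700d; 0x5c010350d1341;
        0x50010310c1301]%positive 0 0x7001001073031 0x70c1301103001
        [:: Child 0x510 0x710040c001001 9; Child 0x550 0x5007001001001 10;
           Child 0x4d0 0x5c04001001001 10; Child 0x544 0x5007000404001 10;
           Child 0x414 0x7003001007001 11; Child 0x514 0x7103003000c34 11;
           Child 0x554 0x4d07001007001 13; Child 0x4d4 0x4504001007001 13;
           Child 0x501 0x701004c004004 9; Child 0x541 0x5007000104004 10;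
           Child 0x4c1 0x5c04000104004 10; Child 0x511 0x7103003003031 11;
           Child 0x551 0x4704c03003031 13; Child 0x4d1 0x4f07c03003031 13;
           Child 0x545 0x44c4300c0c00d 13; Child 0x555 0x4700c1300d031 10];
      Node 0x544541001001001001 [:: 0x53004340c5001; 0x404131c035001; 0x500d0010c1001;
        0x440700d001001]%positive 0 0x7007001001001 0x7c03001001001
        [:: Child 0x510 0x5001013001001 5; Child 0x504 0x5001010c04001 5;
           Child 0x554 0x700c4304d0001 5; Child 0x501 0x5000044004004 11;
           Child 0x701 0x50000c4004004 11; Child 0x4c1 0x44000d0004004 11;
           Child 0x7c1 0x5001001001001 13; Child 0x411 0x53000d0070004 11;
           Child 0x511 0x5001001001001 14; Child 0x451 0x4404001001001 14;
           Child 0x551 0x5000053070004 11; Child 0x731 0x7003003003001 14;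
           Child 0x4f1 0x4c0c003003001 14; Child 0x7f1 0x50000d3070004 11;
           Child 0x405 0x50c00d0070010 11; Child 0x505 0x5001000404001 14;
           Child 0x445 0x4404000404001 14; Child 0x545 0x5000050c70010 11;
           Child 0x555 0x5004c00470001 14; Child 0x435 0x5304000470001 14;
           Child 0x70d 0x7003000c0c001 14; Child 0x4cd 0x4c0c000c0c001 14;
           Child 0x7cd 0x50000d0c70010 11; Child 0x41d 0x710c000cd0001 14;
           Child 0x7fd 0x700c400cd0001 14];
      Node 0x505541001001001001 [:: 0x5c0100d0d1341; 0x40443344c500d; 0x53004070c5311;
        0x50010010c1301]%positive 0 0x5003007003311 0x5013c43103001
        [:: Child 0x540 0x4c07003001001 7; Child 0x504 0x40c4300310010 7;
           Child 0x544 0x5001000404001 13; Child 0x4c4 0x4440110004001 11;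
           Child 0x514 0x5000400410001 13; Child 0x554 0x4c4011c034001 11;
           Child 0x434 0x4140110010001 11; Child 0x4f4 0x5c03000434001 13;
           Child 0x541 0x5001000104004 13; Child 0x4c1 0x4410050004004 11;
           Child 0x511 0x5000400110004 13; Child 0x551 0x4c1005c034004 11;
           Child 0x545 0x44c0310c0400d 11; Child 0x4c5 0x50c401cc0400d 13;
           Child 0x515 0x41c0310c1000d 11; Child 0x555 0x44c1010c1c00d 13];
      Node 0x545541001001001001 [:: 0x40443340c500d; 0x470041c0350d1; 0x40140c4304007;
        0x53004340c5311; 0x44070010310c1]%positive 0 0x500d0030030d1 0x5411043103001
        [:: Child 0x510 0x5001013001001 7; Child 0x504 0x5000104004001 10;
           Child 0x444 0x4400110004001 10; Child 0x544 0x5000050c70010 9;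
           Child 0x554 0x5000113070001 10; Child 0x434 0x5300110070001 10;
           Child 0x501 0x5000044004004 10; Child 0x551 0x5000053070004 10;
           Child 0x505 0x44c0310c0400d 10; Child 0x555 0x53c0310c7000d 10];
      Node 0x154110501001001001001 [:: 0x7507013001001;
        0x440700d001001]%positive 0 0x4407003001311 0x5414043101001
        [:: Child 0x504 0x5001001001001 12; Child 0x704 0x7003003001001 12;
           Child 0x444 0x4700c13001001 12; Child 0x544 0x5007001001001 12;
           Child 0x4c4 0x4d00431001001 12; Child 0x7c4 0x700d003001001 12;
           Child 0x414 0x4d0301c001001 12; Child 0x514 0x5001013001001 12;
           Child 0x554 0x5007013001001 12; Child 0x434 0x4701034001001 12;
           Child 0x734 0x7003031001001 12; Child 0x7f4 0x700d031001001 12;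
           Child 0x701 0x7003003000404 12; Child 0x441 0x4700c13000404 12;
           Child 0x4c1 0x4d00431000404 12; Child 0x7c1 0x700d003000404 12;
           Child 0x411 0x4d0301c000404 12; Child 0x511 0x5001013000404 12;
           Child 0x551 0x5007013000404 12; Child 0x731 0x7003031000404 12;
           Child 0x7f1 0x700d031000404 12; Child 0x405 0x5001001001001 13;
           Child 0x505 0x5001001001001 14; Child 0x705 0x7003003001001 14;
           Child 0x445 0x4700c13001001 14; Child 0x545 0x5007001001001 14;
           Child 0x4c5 0x4d00431001001 14; Child 0x7c5 0x700d003001001 14;
           Child 0x415 0x4d0301c001001 14; Child 0x515 0x5001013001001 14;
           Child 0x555 0x5007013001001 14; Child 0x435 0x4701034001001 14;
           Child 0x735 0x7003031001001 14; Child 0x7f5 0x700d031001001 14;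
           Child 0x70d 0x7003003003001 14; Child 0x44d 0x4700c13003001 14;
           Child 0x4cd 0x4d00431003001 14; Child 0x7cd 0x700d003003001 14;
           Child 0x41d 0x4d0301c003001 14; Child 0x51d 0x5001013003001 14;
           Child 0x55d 0x5007013003001 14; Child 0x73d 0x7003031003001 14;
           Child 0x7fd 0x700d031003001 14];
      Node 0x141110501001001001001 [:: 0x5f004040d5001; 0x4044334404001; 0x53004040c5001;
        0x500d001001001]%positive 0 0x7001001001001 0x7001001001001
        [:: Child 0x550 0x5001001001001 11; Child 0x544 0x5001000404001 11;
           Child 0x514 0x5000400410001 11; Child 0x701 0x5001001001001 14;
           Child 0x441 0x5001001001001 15; Child 0x541 0x7401003003001 15;
           Child 0x7c1 0x5c03001001001 15; Child 0x411 0x5000404001001 15;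
           Child 0x511 0x710040c003001 15; Child 0x551 0x5001001001001 16;
           Child 0x4d1 0x5c03001001001 16; Child 0x731 0x5300c04001001 15;
           Child 0x471 0x7401003003001 16; Child 0x7f1 0x7003003003001 16;
           Child 0x405 0x5000104004001 15; Child 0x505 0x704010c00c001 15;
           Child 0x545 0x5001000404001 16; Child 0x4c5 0x5c03000404001 16;
           Child 0x515 0x5000400410001 16; Child 0x435 0x5300c00410001 16;
           Child 0x70d 0x50c0304004001 15; Child 0x44d 0x7401000c0c001 16;
           Child 0x7cd 0x7003000c0c001 16; Child 0x41d 0x7100400c30001 16;
           Child 0x73d 0x7000c00c30001 16];
      Node 0x111110501001001001001 [:: 0x750041307d001; 0x7404001071001;
        0x4404001031001]%positive 0 0x5003003001001 0x5003003001001
        [:: Child 0x550 0x4700c13001001 10; Child 0x544 0x50c0304c04001 10;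
           Child 0x554 0x5001001001001 16; Child 0x734 0x44c4000c04001 16;
           Child 0x474 0x5301003001001 16; Child 0x501 0x5001001000404 14;
           Child 0x541 0x5001001001001 17; Child 0x4c1 0x4404000400c10 14;
           Child 0x7c1 0x7003003003001 17; Child 0x511 0x5001001001001 18;
           Child 0x551 0x5001001001001 19; Child 0x4d1 0x7103001003001 19;
           Child 0x431 0x5301003001001 18; Child 0x731 0x7003003003001 18;
           Child 0x471 0x5301003001001 19; Child 0x7f1 0x7003003003001 19;
           Child 0x405 0x4c4c00040c001 18; Child 0x705 0x4c4c00040c001 19;
           Child 0x445 0x4404000404001 18; Child 0x545 0x4404000404001 19;
           Child 0x415 0x5001001001001 20; Child 0x555 0x7103101001001 20;
           Child 0x735 0x5301003001001 20; Child 0x475 0x4c4c00040c001 20;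
           Child 0x50d 0x44c4000c04001 19; Child 0x4cd 0x4c0c000c0c001 18;
           Child 0x7cd 0x4c0c000c0c001 19; Child 0x51d 0x7103001003001 20;
           Child 0x4dd 0x44c4000c04001 20; Child 0x43d 0x7003003003001 20;
           Child 0x7fd 0x5301303003001 20];
      Node 0x155110501001001001001 [:: 0x750701307d001; 0x4044304c07001;
        0x440700d031001]%positive 0 0x4c0d013001001 0x7f0cc03001001
        [:: Child 0x444 0x5001001001001 15; Child 0x544 0x7501001001001 15;
           Child 0x501 0x5001001000404 14; Child 0x701 0x5001001000c04 14;
           Child 0x441 0x5001001000404 18; Child 0x541 0x7501001000404 18;
           Child 0x4c1 0x5001001000c04 18; Child 0x7c1 0x7501001000c04 18;
           Child 0x431 0x5000404000c04 18; Child 0x731 0x7500404000c04 18;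
           Child 0x7f1 0x5001001001001 20; Child 0x405 0x5001001001001 21;
           Child 0x445 0x5001001001001 22; Child 0x545 0x7501001001001 22;
           Child 0x415 0x5000404001001 22; Child 0x515 0x7500404001001 22;
           Child 0x555 0x7043103401001 21; Child 0x4cd 0x7003003003001 22;
           Child 0x7cd 0x5f03003003001 22; Child 0x43d 0x7000c0c003001 22;
           Child 0x73d 0x5f00c0c003001 22; Child 0x7fd 0x50c1301c03001 21];
      Node 0x101510501001001001001 [:: 0x40470040d400d;
        0x5001031001001]%positive 0 0x7001001003001 0x7001001003001
        [:: Child 0x550 0x5001001001001 9; Child 0x504 0x5000104004001 12;
           Child 0x544 0x4c47000404001 16; Child 0x4c4 0x4444000404001 16;
           Child 0x7c4 0x444d00040c001 16; Child 0x514 0x4344c00410001 16;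
           Child 0x554 0x5001001001001 20; Child 0x4d4 0x5c03001001001 20;
           Child 0x434 0x4144000410001 16; Child 0x734 0x414c400430001 16;
           Child 0x474 0x7401003001001 20; Child 0x7f4 0x7003003001001 20;
           Child 0x701 0x700004c00c004 12; Child 0x441 0x4c1c00010c004 16;
           Child 0x541 0x4c17000104004 16; Child 0x7c1 0x441d00010c004 16;
           Child 0x411 0x431c000130004 16; Child 0x511 0x4314c00110004 16;
           Child 0x551 0x5001001000404 20; Child 0x4d1 0x5c03001000404 20;
           Child 0x731 0x411c400130004 16; Child 0x471 0x7401003000404 20;
           Child 0x7f1 0x7003003000404 20; Child 0x505 0x700030c00c00d 12;
           Child 0x705 0x500030400400d 12; Child 0x445 0x44c4000c0400d 16;
           Child 0x545 0x44cd000c0c00d 16; Child 0x4c5 0x4ccc000c0c00d 16;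
           Child 0x7c5 0x4cc7000c0400d 16; Child 0x415 0x41c4000c1000d 16;
           Child 0x515 0x41cc400c3000d 16; Child 0x555 0x700300300300d 20;
           Child 0x4d5 0x740100300300d 20; Child 0x435 0x43cc000c3000d 16;
           Child 0x735 0x43c4c00c1000d 16; Child 0x475 0x5c0300100300d 20;
           Child 0x7f5 0x500100100300d 20];
      Node 0x141510501001001001001 [:: 0x40473040d500d; 0x53004040c5311; 0x5c010010d1341;
        0x50010010c1301; 0x5f004040d5351]%positive 0 0x5003003003351 0x5013043103001
        [:: Child 0x550 0x5001001001001 9; Child 0x504 0x704010c00c001 11;
           Child 0x544 0x4c47000404001 16; Child 0x4c4 0x4444000404001 16;
           Child 0x514 0x4344c00410001 16; Child 0x434 0x4144000410001 16;
           Child 0x541 0x4c17000104004 16; Child 0x511 0x4314c00110004 16;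
           Child 0x545 0x44c4300c0400d 16; Child 0x515 0x41c4300c1000d 16];
      Node 0x111510501001001001001 [:: 0x4047104cd700d; 0x750041307d1f1; 0x74040010711c1;
        0x44040010310c1]%positive 0 0x70010010031f1 0x7011041103001
        [:: Child 0x550 0x4700c13001001 8; Child 0x704 0x740100040c001 11;
           Child 0x444 0x4404000404001 14; Child 0x544 0x440d00040c001 15;
           Child 0x414 0x5000404001001 16; Child 0x554 0x5001001001001 19;
           Child 0x734 0x5300c04001001 16; Child 0x474 0x5301003001001 19;
           Child 0x541 0x440d00010c004 15; Child 0x551 0x5001001000404 19;
           Child 0x731 0x5300c04000404 16; Child 0x471 0x5301003000404 19;
           Child 0x545 0x50c0304c0400d 11; Child 0x555 0x4304c00c1300d 16;
           Child 0x735 0x500130100300d 19; Child 0x475 0x4104000c1300d 16];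
      Node 0x155510501001001001001 [:: 0x750701307d1f1; 0x4044304c0700d; 0x40140c4304c07;
        0x440700d0310c1]%positive 0 0x4407031003031 0x5514441103001
        [:: Child 0x444 0x7103101001001 15; Child 0x544 0x4c47000404001 15;
           Child 0x414 0x7400d04001001 15; Child 0x514 0x4344c00410001 15;
           Child 0x554 0x7043103401001 17; Child 0x441 0x7103041000404 15;
           Child 0x541 0x4c17000104004 15; Child 0x445 0x4304c00c1300d 15;
           Child 0x545 0x430d000c1300d 15];
      Node 0x1c4414501001001001001 [:: 0x40104d01d0c35; 0x74074040dd1c1; 0x70044040cd101;
        0x410400400d001]%positive 0 0x70010030011c1 0x7011043001001
        [:: Child 0x710 0x700040c001001 11; Child 0x450 0x7400430001001 13;
           Child 0x7d0 0x7000434001001 13; Child 0x504 0x41cc001030001 13;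
           Child 0x544 0x4400134004001 14; Child 0x4c4 0x4c00130004001 14;
           Child 0x714 0x410c001c30001 13; Child 0x454 0x4c00330007001 14;
           Child 0x7d4 0x4400334007001 14; Child 0x7c1 0x700d000104004 16;
           Child 0x7d1 0x4c300f0304c04 16; Child 0x415 0x4300d00340040 16;
           Child 0x715 0x40d0043140440 16; Child 0x455 0x5001001001001 18;
           Child 0x7d5 0x5c03001001001 18; Child 0x7cd 0x440d001c04001 18];
      Node 0x144514501001001001001 [:: 0x41c01130d4035; 0x40140f4104c04; 0x4044334407001;
        0x4010110fd141f; 0x500d001001001]%positive 0 0x700101f001001 0x7301c03001001
        [:: Child 0x550 0x700d003003001 14; Child 0x504 0x41c4301010001 12;
           Child 0x544 0x4c47000404001 16; Child 0x4c4 0x4444000404001 16;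
           Child 0x554 0x7500431007001 16; Child 0x501 0x41340c1010004 12;
           Child 0x541 0x4c17000104004 16; Child 0x4c1 0x4414000104004 16;
           Child 0x551 0x7500431004c04 16; Child 0x515 0x4300d0314c040 15];
      Node 0x154514501001001001001 [:: 0x75070130d11f1; 0x4010110f10c1f; 0x440341301d0c1;
        0x50010310c1001; 0x500d031001301]%positive 0 0x4c0d013001001 0x7f0cc03001001
        [:: Child 0x504 0x7440104004001 12; Child 0x4c4 0x5c04000404001 15;
           Child 0x441 0x4404000104004 15; Child 0x541 0x4c1005c004004 12;
           Child 0x515 0x7103003000c34 16; Child 0x555 0x710d003003031 16;
           Child 0x44d 0x40c0c0744c035 16];
      Node 0x1f0544541001001001001 [:: 0x71401010d013d; 0x401105c034c04; 0x404131c035001;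
        0x4010110d13410; 0x7100434001131]%positive 0 0x500d003003001 0x5401003003001
        [:: Child 0x510 0x5001013001001 12; Child 0x504 0x5001010c04001 12;
           Child 0x554 0x5004c10c70001 12; Child 0x701 0x700303030c004 12;
           Child 0x7f1 0x700c4303d0004 12; Child 0x7cd 0x700c1303d0010 12];
      Node 0x144544541001001001001 [:: 0x5c04c350c5341; 0x4d40104c4f07d; 0x50c0104cc5305;
        0x4d01013001071; 0x5001031001301]%positive 0 0x4c0d00044f001 0x7f0cc0340c001
        [:: Child 0x444 0x4404004c04001 13; Child 0x554 0x53c4313070001 13;
           Child 0x501 0x41340c1010004 13; Child 0x4c1 0x5c0401c34c004 13;
           Child 0x505 0x5001001001001 15; Child 0x555 0x5004c1c001001 15;
           Child 0x4cd 0x7500431013341 15];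
      Node 0x50454110501001001001001 [:: 0x404d51cc4f001; 0x7507013001001; 0x50010010c1001;
        0x440700d001001]%positive 0 0x4c0d001001001 0x7c0c001001001
        [:: Child 0x4c4 0x5001001001001 15; Child 0x514 0x5f00c0c001001 15;
           Child 0x701 0x5001001001001 16; Child 0x441 0x5001001001001 17;
           Child 0x4c1 0x7003003003001 17; Child 0x7c1 0x5f03003001001 17;
           Child 0x411 0x5000404001001 17; Child 0x511 0x7500404003001 17;
           Child 0x551 0x5001001001001 18; Child 0x731 0x5f00c0c001001 17;
           Child 0x7f1 0x7003003003001 18; Child 0x405 0x5001001001001 19;
           Child 0x505 0x7043003001001 19; Child 0x545 0x5001001001001 20;
           Child 0x4c5 0x5f03003001001 20; Child 0x515 0x5000404001001 20;
           Child 0x435 0x5f00c0c001001 20; Child 0x70d 0x50c1001003001 19;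
           Child 0x44d 0x7501001003001 20; Child 0x7cd 0x7003003003001 20;
           Child 0x41d 0x7500404003001 20; Child 0x73d 0x7000c0c003001 20];
      Node 0x40554110501001001001001 [:: 0x404d41c04c00d;
        0x440700d001001]%positive 0 0x4c0d001003001 0x7c0c001003001
        [:: Child 0x504 0x5001001001001 18; Child 0x444 0x4700c13001001 18;
           Child 0x544 0x5007001001001 18; Child 0x4c4 0x4d00431001001 18;
           Child 0x514 0x5001013001001 18; Child 0x554 0x5007013001001 18;
           Child 0x434 0x4701034001001 18; Child 0x734 0x7003031001001 18;
           Child 0x7f4 0x700d031001001 18; Child 0x701 0x7003003000404 18;
           Child 0x441 0x4700c13000404 18; Child 0x4c1 0x4d00431000404 18;
           Child 0x7c1 0x700d003000404 18; Child 0x411 0x4d0301c000404 18;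
           Child 0x511 0x5001013000404 18; Child 0x551 0x5007013000404 18;
           Child 0x731 0x7003031000404 18; Child 0x7f1 0x700d031000404 18;
           Child 0x505 0x700300300300d 18; Child 0x705 0x500100100300d 18;
           Child 0x445 0x4d0043100300d 18; Child 0x545 0x700d00300300d 18;
           Child 0x4c5 0x4700c1300300d 18; Child 0x7c5 0x500700100300d 18;
           Child 0x415 0x470103400300d 18; Child 0x515 0x700303100300d 18;
           Child 0x555 0x700d03100300d 18; Child 0x435 0x4d0301c00300d 18;
           Child 0x735 0x500101300300d 18; Child 0x7f5 0x500701300300d 18];
      Node 0x50554110501001001001001 [:: 0x404d51cc4f00d; 0x40140f41c4407; 0x7507013001001;
        0x50010010c1301; 0x440700d001001;
        0x5f004040d5351]%positive 0 0x4407003003311 0x5414043103001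
        [:: Child 0x504 0x7043003001001 17; Child 0x544 0x5007001001001 18;
           Child 0x4c4 0x5f04c03001001 18; Child 0x514 0x5004c04001001 18;
           Child 0x434 0x5f0700c001001 18; Child 0x4c1 0x5f04c03000404 18;
           Child 0x511 0x5004c04000404 18; Child 0x4c5 0x4dc730100300d 18;
           Child 0x515 0x5fc730c00300d 18];
      Node 0x70141110501001001001001 [:: 0x75401010101fd; 0x4014074304004; 0x4014c41010317;
        0x4044334404001; 0x4104c35001001;
        0x704010400410d]%positive 0 0x5003003003001 0x5003003003001
        [:: Child 0x550 0x5001001001001 13; Child 0x544 0x5001000404001 13;
           Child 0x514 0x5000400410001 13; Child 0x7c1 0x700300010c004 13;
           Child 0x731 0x7000c00130004 13; Child 0x70d 0x7000300130010 13];
      Node 0x44141110501001001001001 [:: 0x4017c41010f57; 0x7440110c041cd; 0x5c01035001001;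
        0x53004040c5001; 0x74040010011c1;
        0x5f004040d5001]%positive 0 0x5003003003001 0x5003003003001
        [:: Child 0x550 0x5001001001001 13; Child 0x544 0x5001000404001 13;
           Child 0x514 0x5000400410001 15; Child 0x541 0x701004c10c004 12;
           Child 0x551 0x5001001001001 17; Child 0x731 0x7003043003001 17;
           Child 0x471 0x5301003001001 17; Child 0x545 0x5001000404001 17;
           Child 0x70d 0x7003040c0c001 17; Child 0x44d 0x50c1000c04001 17];
      Node 0x55141110501001001001001 [:: 0x4017c41310f57; 0x50c01344c5305; 0x75070130011f1;
        0x500d031001301; 0x440700d0010c1;
        0x5f004040d5001]%positive 0 0x4c0d00044f001 0x7f0cc0340c001
        [:: Child 0x4c4 0x50c1000c04001 15; Child 0x514 0x5000400410001 15;
           Child 0x441 0x5001001001001 16; Child 0x541 0x7501001003001 16;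
           Child 0x545 0x5001001001001 17; Child 0x515 0x5000404001001 17;
           Child 0x44d 0x7501001003001 17];
      Node 0x55411110501001001001001 [:: 0x750701307d001; 0x4044304c07001; 0x440700d031001;
        0x7404001071001]%positive 0 0x5c00c31001001 0x4c0fc3c001001
        [:: Child 0x414 0x5001001001001 17; Child 0x501 0x5001001000404 15;
           Child 0x701 0x5001001000c04 15; Child 0x4c1 0x4404000400c10 15;
           Child 0x7c1 0x5001001001001 18; Child 0x411 0x4347d00431001 18;
           Child 0x511 0x7003031000cc4 15; Child 0x431 0x41cd700c13001 18;
           Child 0x731 0x70030310004c4 15; Child 0x7f1 0x5001001001001 19;
           Child 0x405 0x41cd7010c4001 18; Child 0x445 0x4c0c00c400f10 15;
           Child 0x545 0x7003031031001 19; Child 0x415 0x5001001001001 20;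
           Child 0x555 0x7003031031001 18; Child 0x4cd 0x4c0c00c400710 15;
           Child 0x7cd 0x5001013013001 19; Child 0x43d 0x7003003003001 20;
           Child 0x7fd 0x5001013013001 18];
      Node 0x54111110501001001001001 [:: 0x40110d03c44c5; 0x750041307d001; 0x7404001071001;
        0x4404001031001]%positive 0 0x700041f001001 0x7c0340c001001
        [:: Child 0x550 0x5f04c03003001 10; Child 0x704 0x740100040c001 10;
           Child 0x414 0x7103101001001 17; Child 0x554 0x7003003003001 17;
           Child 0x734 0x4c4c00040c001 17; Child 0x501 0x5001000104004 10;
           Child 0x511 0x4c17000104004 17; Child 0x551 0x5f03003000c04 17;
           Child 0x431 0x4c17c0010c004 17; Child 0x445 0x701d000101010 17;
           Child 0x545 0x74cc000c00c10 17; Child 0x555 0x5001001001001 20;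
           Child 0x475 0x5301003001001 20; Child 0x50d 0x740c000400c10 17;
           Child 0x51d 0x44c4000c04001 20; Child 0x43d 0x5301303003001 20];
      Node 0x51111110501001001001001 [:: 0x410d41307d031; 0x5c40104cd734d; 0x5c01035001341;
        0x5001031001301]%positive 0 0x4400c31003001 0x440cc30003001
        [:: Child 0x4d0 0x5c04001003001 10; Child 0x544 0x714010c404001 11;
           Child 0x414 0x7400d04001001 16; Child 0x554 0x7003031000cc4 13;
           Child 0x474 0x74c0f04c03001 16; Child 0x541 0x4c17000104004 16;
           Child 0x411 0x50300c1310004 11; Child 0x551 0x5f00c13003031 13;
           Child 0x4d1 0x4c370c0304c04 16; Child 0x545 0x5001001001001 20;
           Child 0x415 0x7500404000404 20; Child 0x555 0x5001001001001 21;
           Child 0x50d 0x5001301003001 20; Child 0x4cd 0x4c3c00c0c40c4 21;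
           Child 0x51d 0x5001301003001 21; Child 0x4dd 0x5f40c0c400c04 20];
      Node 0x55111110501001001001001 [:: 0x401d4c134c1f5; 0x44c011c4350c5; 0x440700d0010c1;
        0x750041307d001; 0x500d031001301]%positive 0 0x5c00c31001001 0x4c0fc3c001001
        [:: Child 0x704 0x5041000404001 11; Child 0x734 0x4c4c00c0c4001 16;
           Child 0x411 0x4c17c4010c404 15; Child 0x511 0x5f00c13003031 12;
           Child 0x445 0x4404000404001 19; Child 0x555 0x75301f1000c13 19;
           Child 0x51d 0x75f03f1000c13 19];
      Node 0x41511110501001001001001 [:: 0x401d4c134c5f4; 0x40101c4d71c13; 0x4404031031001;
        0x404071341000d; 0x5c01035001001; 0x7404001071001;
        0x410101003d031]%positive 0 0x50030030d7001 0x50c3303c03001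
        [:: Child 0x554 0x5001001001001 16; Child 0x7c1 0x7103101001001 17;
           Child 0x411 0x7103101001001 19; Child 0x511 0x7500404000404 18;
           Child 0x4d1 0x5c701d0000c13 18; Child 0x555 0x443d4c0304c07 17];
      Node 0x7f155110501001001001001 [:: 0x5f4011c04c35d; 0x401105c0340c7; 0x70401340c410d;
        0x40104530d4404]%positive 0 0x4407031003001 0x5504401003001
        [:: Child 0x444 0x5001001001001 14; Child 0x544 0x7501001001001 14;
           Child 0x4c1 0x7003003000404 14; Child 0x7c1 0x5f03003000404 14;
           Child 0x7fd 0x5001001001001 19];
      Node 0x40555110501001001001001 [:: 0x5f4d41c04c35d; 0x40101d0d1341d; 0x4044304c07001;
        0x440700d031001]%positive 0 0x4407031003001 0x5504401003001
        [:: Child 0x444 0x41cd7010c4001 12; Child 0x544 0x41c4301070001 12;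
           Child 0x4c1 0x4414000104004 16; Child 0x7c1 0x441d400104004 16;
           Child 0x445 0x4434000304007 16; Child 0x545 0x443d400304007 16;
           Child 0x415 0x4134000310007 16; Child 0x515 0x413d400310007 16;
           Child 0x555 0x7013043100407 18];
      Node 0x44555110501001001001001 [:: 0x7407104cd71c1; 0x401041301cc37; 0x750041307d1f1;
        0x4044304c07001; 0x440700d031001;
        0x7044004cc410d]%positive 0 0x5c00c31013001 0x4ccff3cc03001
        [:: Child 0x414 0x5000404001001 13; Child 0x701 0x7501001000404 9;
           Child 0x441 0x4404000104004 15; Child 0x731 0x50d035300304c 15];
      Node 0x455c4414501001001001001 [:: 0x774071d0471c1; 0x4040350d13013; 0x44030413704f5;
        0x7001011001101; 0x740401d0711c1;
        0x440400d0310c1]%positive 0 0x7001000c0d1c1 0x7011043c0c001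
        [:: Child 0x710 0x7400404001001 13; Child 0x544 0x407c1c03d0c13 13;
           Child 0x454 0x7400430007001 13];
      Node 0x50544544541001001001001 [:: 0x5c04c350c5341; 0x40101c4d70cd7; 0x50c0104cc5305;
        0x5c0100d0d1341; 0x53004070c5311; 0x470041c035001; 0x4d01013001071;
        0x4040413c1003d]%positive 0 0x4400c00cc5001 0x440cc30cc0001
        [:: Child 0x555 0x5001001001001 16];
      Node 0x13110454110501001001001001 [:: 0x7144c35473001; 0x4d0041301d001; 0x5c01035001001;
        0x50010010c1001]%positive 0 0x4400c31001001 0x440cc30001001
        [:: Child 0x701 0x5001001001001 16; Child 0x441 0x4d0c401001001 16;
           Child 0x541 0x4cc7300c0c001 16; Child 0x7c1 0x444d100404001 16;
           Child 0x411 0x5001001001001 17; Child 0x551 0x4d0c401001001 17;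
           Child 0x431 0x7003003003001 17; Child 0x731 0x5fc4c03003001 17;
           Child 0x7f1 0x4704c03003001 17; Child 0x405 0x5c03000404001 17;
           Child 0x505 0x7143000404001 17; Child 0x4c5 0x444d100404001 17;
           Child 0x515 0x5001001001001 18; Child 0x70d 0x53c1000c0c001 17;
           Child 0x44d 0x4cc7300c0c001 17; Child 0x73d 0x7003003003001 18];
      Node 0x1c050454110501001001001001 [:: 0x401013577353d; 0x5c0100d0d1001; 0x75004040011f1;
        0x4014044004307; 0x53004040c5001]%positive 0 0x4407003003001 0x5404003003001
        [:: Child 0x4c4 0x5001001001001 15; Child 0x514 0x5f00c0c001001 15;
           Child 0x441 0x7003003000404 15; Child 0x731 0x7500404000404 15;
           Child 0x70d 0x5001001001001 18];
      Node 0x11050454110501001001001001 [:: 0x4704c010c50d1; 0x75004130011f1; 0x7440110c041cd;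
        0x754010104f1fd]%positive 0 0x4c00413003001 0x4c04410003001
        [:: Child 0x544 0x4d0c501003001 14; Child 0x434 0x5000404001001 15;
           Child 0x541 0x74310c030c004 14; Child 0x551 0x4700c13000404 15;
           Child 0x545 0x5001001001001 18; Child 0x70d 0x4734c03000c04 18;
           Child 0x44d 0x50c1001003001 18];
      Node 0x15450454110501001001001001 [:: 0x4017c41310f57; 0x50c01344c5305; 0x7507013001001;
        0x500d031001301; 0x440700d001001;
        0x5f004040d5001]%positive 0 0x4c0d00044f001 0x7f0cc0340c001
        [:: Child 0x4c4 0x4d0c401001001 14; Child 0x514 0x4704c04003001 14;
           Child 0x441 0x4700c13000404 14; Child 0x541 0x4d0041c000c04 14;
           Child 0x545 0x5001001001001 18; Child 0x515 0x5000404001001 18;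
           Child 0x44d 0x7501001003001 18];
      Node 0x10150454110501001001001001 [:: 0x40101f577353d; 0x40443344c5001; 0x7507013001001;
        0x440700d001001; 0x5f004040d5001;
        0x704400400410d]%positive 0 0x4407003003001 0x5404003003001
        [:: Child 0x4c4 0x5c03000404001 13; Child 0x514 0x5c00400430001 13;
           Child 0x441 0x7043043001001 16; Child 0x731 0x4d1c50c000404 16;
           Child 0x505 0x7013003000407 15; Child 0x545 0x473d1c3000c07 16;
           Child 0x4c5 0x50d1041003401 16; Child 0x515 0x4d3c5cc000c07 16;
           Child 0x435 0x50d0444003401 16];
      Node 0x15150454110501001001001001 [:: 0x40101f577353c; 0x470041c0350d1; 0x40140c43c4407;
        0x5f004040d5001; 0x50010010c1001]%positive 0 0x4c0d00104f001 0x7ccc301c03001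
        [:: Child 0x441 0x5001001001001 15; Child 0x541 0x7541001001001 15;
           Child 0x551 0x5001001001001 16];
      Node 0x15444141110501001001001001 [:: 0x4017c41310f57; 0x50c01344c5305; 0x75070130011f1;
        0x4017044304347; 0x500d031001301; 0x440700d0010c1;
        0x5f004040d5001]%positive 0 0x5c00c00cc5001 0x4c0fc3ccf0001
        [:: Child 0x4c4 0x50c1000c04001 14; Child 0x514 0x41fd4c0c00c43 14;
           Child 0x411 0x5001001001001 16; Child 0x44d 0x5001001001001 17];
      Node 0x15155141110501001001001001 [:: 0x5f1d41c010f57; 0x50c01344c5305; 0x470041c0350c1;
        0x53004350c5311; 0x5f004040d5001;
        0x7447010c041cd]%positive 0 0x5c00c00cc5001 0x4c0fc3ccf0001
        [::];
      Node 0x10515411110501001001001001 [:: 0x750701307d001; 0x4044304c07001; 0x440700d031001;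
        0x7404001071001; 0x710400404d001;
        0x410101003d001]%positive 1 0x5001001001001 0x5001001001001
        [:: Child 0x501 0x5001001000404 14; Child 0x701 0x5001001000c04 14;
           Child 0x441 0x4404000400410 14; Child 0x541 0x700d003000c34 14;
           Child 0x4c1 0x4404000400c10 14; Child 0x7c1 0x700d003000434 14;
           Child 0x411 0x4104000400440 14; Child 0x431 0x4104000400c40 14;
           Child 0x731 0x70030310004c4 14; Child 0x405 0x4041001000500 14;
           Child 0x445 0x4c0c00c400f10 14; Child 0x415 0x430c003400f40 14;
           Child 0x40d 0x4041001000d00 14; Child 0x4cd 0x4c0c00c400710 14;
           Child 0x43d 0x430c003400740 14; Child 0x7fd 0x5007013000df4 14];
      Node 0x1f055411110501001001001001 [:: 0x710d41c07d131; 0x4010110d1341c; 0x4d0041c00d071;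
        0x700d001071101; 0x500d0310c1001]%positive 0 0x7400413003001 0x4405414003001
        [:: Child 0x414 0x700d003000434 13; Child 0x701 0x5001000304004 11;
           Child 0x411 0x5001001001001 15; Child 0x415 0x5001001001001 16;
           Child 0x7cd 0x5f44c00400c10 15; Child 0x7fd 0x70330c3003001 16];
      Node 0x1fc55411110501001001001001 [:: 0x5f4713404c35d; 0x70401340c410d; 0x4c0700d001041;
        0x4301c13035011; 0x5c01035001001]%positive 0 0x7400413003001 0x4405414003001
        [:: Child 0x431 0x5001001101001 14; Child 0x731 0x75c0431003011 13;
           Child 0x7fd 0x41c0404c00d30 14];
      Node 0x10555411110501001001001001 [:: 0x7104d01cd7131; 0x5c4d0100d734d; 0x704403400710d;
        0x750700407d1f1; 0x4d0101c00d071;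
        0x410101003d031]%positive 1 0x4104000410001 0x4104000410001
        [:: Child 0x7c1 0x5001001001001 14; Child 0x411 0x4347d00431001 14;
           Child 0x405 0x41cd7010c4001 14];
      Node 0x15554111110501001001001001 [:: 0x7114c04340df4; 0x4044304c0700d; 0x5c4d004cd734d;
        0x750701307d1f1; 0x410130347d0f5; 0x440700d0310c1;
        0x4044c01cd731d]%positive 1 0x5000404001001 0x5000404001001
        [:: Child 0x511 0x4c17000104004 13; Child 0x551 0x75c1301000404 13;
           Child 0x445 0x701d000101010 13; Child 0x545 0x5f44c00400410 13];
      Node 0x15151111110501001001001001 [:: 0x5f4d775071c4c; 0x4044304cc5301; 0x4403050314cc4;
        0x5c01035001341; 0x7404001071001]%positive 0 0x430d400c31001 0x730c03ccf0001
        [:: Child 0x405 0x701d340103410 12; Child 0x555 0x750d0310c04c4 12];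
      Node 0x15551111110501001001001001 [:: 0x7507c4134c1f4; 0x4044304c0700d; 0x401d050304dc7;
        0x440700d0310c1; 0x7404001071001]%positive 0 0x7404c00c31001 0x7300c3fcfc001
        [:: Child 0x414 0x7400d04001001 11; Child 0x541 0x4c17000104004 11;
           Child 0x405 0x5c071cc031310 11; Child 0x545 0x750d0310c04c4 11;
           Child 0x415 0x500701307d031 11];
      Node 0x1ff7f155110501001001001001 [:: 0x75d7d35170130; 0x4010110d1341d; 0x40c4304c07005;
        0x440700d031001]%positive 0 0x5c0c400413001 0x5100415454001
        [:: Child 0x414 0x44c1001c00dc0 9; Child 0x514 0x4c43003400530 9;
           Child 0x4c1 0x4110404101130 9; Child 0x7c1 0x4330c0c3031c0 9];
      Node 0x15550544544541001001001001 [:: 0x714701301307d; 0x40140c4304c07; 0x5c0100d0d1341;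
        0x5c01035031341; 0x4104c0700d031; 0x53004070c5311; 0x470041c035001; 0x4d01013001071;
        0x41070070c1371; 0x4404c0d0f5301; 0x50c0104cc5305; 0x4c41010c0404d; 0x4047004cc434d;
        0x4040413c1003d; 0x7144c10cd013d]%positive 3 0x4c01c340c1301 0x7ff0c30f01001
        [::];
      Node 0x7013110454110501001001001001 [:: 0x401c5d31d5dcd; 0x5f004130d5001; 0x4d0041301d001;
        0x704010400410d; 0x74010010011c1]%positive 0 0x4c00413003001 0x4c04410003001
        [:: Child 0x7c1 0x5001001001001 9; Child 0x411 0x5001001001001 10;
           Child 0x70d 0x53c1000c0c001 10];
      Node 0x4113110454110501001001001001 [:: 0x401c5d31d5dcc; 0x4d0041301d001; 0x5f004040d5001;
        0x41040040c1031; 0x4dc0104473075;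
        0x75070040011f1]%positive 0 0x4400c00473001 0x5400c10440001
        [:: Child 0x511 0x7000c4c000c04 9; Child 0x551 0x700d103103001 9;
           Child 0x515 0x5001001001001 10];
      Node 0x5153110454110501001001001001 [:: 0x7547c1cc4c1fd; 0x4d0101301d071;
        0x50010310c1301]%positive 0 0x4400c31073001 0x44ccf30c03001
        [:: Child 0x411 0x5001001001001 9; Child 0x511 0x754c401001001 9;
           Child 0x551 0x4d0c401001001 9];
      Node 0x70dc050454110501001001001001 [:: 0x40cd51cc4f005; 0x4010110dd1f17; 0x7507013001001;
        0x440700d001001; 0x75004040011f1]%positive 0 0x4400c00473001 0x5400c10440001
        [:: Child 0x544 0x5cc3000c04001 7; Child 0x434 0x5cc0400c30001 7;
           Child 0x441 0x7133000304004 7; Child 0x731 0x7130400330004 7];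
      Node 0x5451050454110501001001001001 [:: 0x530c444334714; 0x404131c03500d; 0x40473040d5001;
        0x75004130011f1; 0x500d0010c1301]%positive 0 0x5c00c00cc5001 0x4c0fc3ccf0001
        [:: Child 0x405 0x5001001001001 8];
      Node 0x5455450454110501001001001001 [:: 0x744735c0d5d3c; 0x40110cd14cc07; 0x40140c4304f05;
        0x404131c03500d; 0x5f004040d5001;
        0x75070130011f1]%positive 0 0x5c00c00cc5001 0x4c0fc3ccf0001
        [::];
      Node 0x4115444141110501001001001001 [:: 0x4c114c317c757; 0x50c01344c5305; 0x75070130011f1;
        0x4017044304347; 0x4014c41310317; 0x500d031001301; 0x440700d0010c1;
        0x5f004040d5001]%positive 1 0x700303103040c 0x73030c100040c
        [:: Child 0x4c4 0x50c1000c04001 6; Child 0x514 0x5000400410001 6;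
           Child 0x434 0x50c0400c10001 6];
      Node 0x44d5444141110501001001001001 [:: 0x5fdd51f173043; 0x470041301d0c1; 0x40140c4304f05;
        0x4017044304347; 0x5c01035001001;
        0x53c4c010d5315]%positive 0 0x430c400473001 0x7f0f00c430001
        [::];
      Node 0x411f055411110501001001001001 [:: 0x75c7d5c4d0131; 0x704013400710d; 0x4d0041c00d071;
        0x4c07035001041; 0x410310047107d]%positive 0 0x5c00c00413001 0x5000c14450001
        [:: Child 0x415 0x5001001001001 5];
      Node 0x415f055411110501001001001001 [:: 0x7507c5c04c5f4; 0x4d0041c00d071; 0x704013400710d;
        0x5c4d0100d734d; 0x700d001001101; 0x710400404d131;
        0x410101003d031]%positive 1 0x710c00c430001 0x410cc00433001
        [:: Child 0x411 0x5001001001001 4; Child 0x405 0x4404000404001 4];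
      Node 0x1f07013110454110501001001001001 [:: 0x401c5d31d51cc; 0x74434074041cd; 0x75004040011f1;
        0x40101045730df; 0x50010010c1001]%positive 0 0x4400c00473001 0x5400c10440001
        [::];
      Node 0x1047013110454110501001001001001 [:: 0x5cdd13174c757; 0x5f004130d5001; 0x40134c134c475;
        0x4014074304004; 0x50010010c1001]%positive 0 0x4400c00473001 0x5400c10440001
        [::];
      Node 0x1454113110454110501001001001001 [:: 0x531c4317d5dcc; 0x40140f4104c07; 0x4d0041301d001;
        0x5f004040d5001; 0x50010010c1001; 0x75070040011f1;
        0x4dc0104473075]%positive 0 0x4c04c00cd1001 0x7f00c33ccc001
        [::];
      Node 0x1015451050454110501001001001001 [:: 0x7144f407d5dcd; 0x470041c0350d1; 0x75004130011f1;
        0x500d0010c1301; 0x5f004040d5001; 0x4041c0104c0dd;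
        0x704400400410d]%positive 1 0x7003030430430 0x70c30c0400430
        [::];
      Node 0x105411f055411110501001001001001 [:: 0x5f5d735370131; 0x44d310d71c531; 0x704013400710d;
        0x710400404d131; 0x4c07001001041; 0x440700d031001; 0x410101003d031;
        0x5c4d0100d734d]%positive 2 0x5001004c134f4 0x5001103f00430
        [::]].

Lemma rank3_targets_ok : all (target_check 3) rank3_targets.
Proof. by vm_compute. Qed.

Lemma rank4_targets_ok : all (target_check 4) rank4_targets.
Proof. by vm_compute. Qed.

Lemma rank5_targets_ok : all (target_check 5) rank5_targets.
Proof. by vm_compute. Qed.

Lemma rank3_cert_ok : check_cert 3 rank3_targets rank3_cert.
Proof. by vm_compute. Qed.

Lemma rank4_cert_ok : check_cert 4 rank4_targets rank4_cert.
Proof. by vm_compute. Qed.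

Lemma rank5_cert_ok : check_cert 5 rank5_targets rank5_cert.
Proof. by vm_compute. Qed.

(** Cross-multiplication relates the stated fraction to [thr] over the total weight, so only natural
    numbers remain to be evaluated. *)
Lemma cosystole_target (R : realType) (d : nat) (Ts : seq (seq (seq int)))
    (T : seq (seq int)) (E : finType) (M : matroid E) (ws : seq nat) (thr : nat)
    (fam : seq (nat * seq nat)) (p q : nat) :
  all (target_check d) Ts -> T \in Ts ->
  isomorphic M (vector_matroid (colmx 'F_2 d T)) ->
  cosystole_check d T ws thr fam -> (0 < q)%N -> (thr * q == p * sumn ws)%N ->
  is_cosystole3 M (p%:R / q%:R : R).
Proof.
move=> /allP Tok /Tok {}Tok iso chk q0 /eqP pq.
apply: isomorphic_cosystole iso _.
have W0 : (0 < sumn ws)%N by have /and3P [] := chk.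
suff -> : p%:R / q%:R = thr%:R / (sumn ws)%:R :> R by apply: (cosystole_checkP Tok R chk).
apply/eqP; rewrite eqr_div ?pnatr_eq0 -?lt0n //.
by rewrite -!natrM eqr_nat -pq mulnC.
Qed.

Theorem theorem4 (R : realType) (d : nat) (hd : d \in [:: 3; 4; 5]%N)
    (E : finType) (M : matroid E) (hM : maximal_simple_regular d M) :
  (isomorphic M (cycle_matroid (complete_graph d.+1)) /\
     is_cosystole3 M (6%:R / d.+1%:R : R)) \/
  [/\ d = 4%N, isomorphic M (dual (cycle_matroid K33)) &
      is_cosystole3 M (4%:R / 3%:R : R)] \/
  [/\ d = 5%N, isomorphic M (dual (cycle_matroid G53)) &
      is_cosystole3 M (12%:R / 11%:R : R)] \/
  [/\ d = 5%N, isomorphic M (dual (cycle_matroid G54)) &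
      is_cosystole3 M (9%:R / 8%:R : R)] \/
  [/\ d = 5%N, isomorphic M R10 & is_cosystole3 M (6%:R / 5%:R : R)].
Proof.
move: hd hM; rewrite !inE => /or3P [] /eqP -> hM.
- have [T TT iso] := classification rank3_targets_ok rank3_cert_ok hM.
  have cos := cosystole_target R rank3_targets_ok TT iso.
  move: TT cos iso; rewrite !inE => /eqP -> cos iso; left; split.
    by apply: isomorphic_trans iso _; apply: complete_isomorphic; vm_compute.
  (* A graphic cut separates the vertices given by the binary digits of its index from the rest. So
     1, 2, 4 are stars of vertices and 7, by complement, is the star of the last one. All four
     triples of stars are used, and 9 is three times the degree. *)
  by apply: (cos (nseq 6 1%N) 9 [:: (1, [:: 1; 2; 4]); (1, [:: 1; 2; 7]);
    (1, [:: 1; 4; 7]); (1, [:: 2; 4; 7])]%N); vm_compute.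
- have [T TT iso] := classification rank4_targets_ok rank4_cert_ok hM.
  have cos := cosystole_target R rank4_targets_ok TT iso.
  move: TT cos iso; rewrite !inE => /orP [] /eqP -> cos iso.
    left; split.
      by apply: isomorphic_trans iso _; apply: complete_isomorphic; vm_compute.
    (* The five vertex stars, each used three times when counted with multiplicity. *)
    by apply: (cos (nseq 10 1%N) 12 [:: (1, [:: 1; 2; 15]); (1, [:: 1; 4; 15]);
      (1, [:: 1; 8; 15]); (2, [:: 2; 4; 8])]%N); vm_compute.
  right; left; split=> //; first exact: isomorphic_trans iso K33_isomorphic.
  (* Cocircuits of the dual are cycles of the graph. The nine indices are the nine 4-cycles of
     [K33], and every edge lies in four of them. *)
  by apply: (cos (nseq 9 1%N) 12 [:: (1, [:: 1; 10; 15]); (1, [:: 2; 8; 12]);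
    (1, [:: 3; 4; 5])]%N); vm_compute.
have [T TT iso] := classification rank5_targets_ok rank5_cert_ok hM.
have cos := cosystole_target R rank5_targets_ok TT iso.
move: TT cos iso; rewrite !inE => /or4P [] /eqP -> cos iso.
- left; split.
    by apply: isomorphic_trans iso _; apply: complete_isomorphic; vm_compute.
  (* The six vertex stars, split into two triples. *)
  by apply: (cos (nseq 15 1%N) 15 [:: (1, [:: 1; 16; 31]); (1, [:: 2; 4; 8])]%N); vm_compute.
- do 2 right; left; split=> //; first exact: isomorphic_trans iso G53_isomorphic.
  (* Contracting the edges 1-6 and 2-7 of weight 0 leaves the graph K_{3,3} with unit weights and
     the edge 1-2 of weight 2 inside one part. Hence every cycle weighs at least 4, and the total
     weight is 9 + 2. *)
  by apply: (cos [:: 1; 2; 1; 1; 0; 0; 1; 1; 1; 1; 1; 1]%N 12 [:: (1, [:: 1; 10; 30]);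
    (2, [:: 1; 17; 24]); (1, [:: 1; 20; 24]); (2, [:: 1; 20; 30]); (1, [:: 2; 5; 10]);
    (1, [:: 2; 6; 10]); (1, [:: 2; 8; 17]); (2, [:: 5; 6; 8])]%N); vm_compute.
- do 3 right; left; split=> //; first exact: isomorphic_trans iso G54_isomorphic.
  (* Weight 1 on the rim and 2 on the rungs: the least weight of a cycle is 6, attained by the
     4-cycles with two rungs as well as by the 5-cycles with one rung. *)
  by apply: (cos (nseq 8 1%N ++ nseq 4 2%N) 18 [:: (3, [:: 2; 19; 24]);
    (3, [:: 3; 19; 24]); (1, [:: 4; 12; 17]); (2, [:: 4; 16; 17]); (2, [:: 5; 6; 12]);
    (1, [:: 5; 12; 16]); (2, [:: 6; 8; 9]); (1, [:: 6; 8; 12]); (1, [:: 6; 9; 12])]%N);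
    vm_compute.
do 4 right; split=> //; first exact: isomorphic_trans iso R10_isomorphic.
(* The smallest cocircuits of [R10] have four elements, and the uniform weight is optimal. *)
by apply: (cos (nseq 10 1%N) 12 [:: (1, [:: 1; 21; 26]); (2, [:: 1; 22; 24]);
  (1, [:: 4; 6; 11]); (1, [:: 4; 8; 11])]%N); vm_compute.
Qed.
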